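(* Let $C:f=0$ be a reduced curve of degree $d\geq 3$ in $\mathbb{P}^2$ with exponents $d_1\leq\dots\leq d_m$, $m\geq 3$, and let $r_1\in AR(f)$ be a nonzero syzygy of minimal degree. Let $d'$ be the smallest integer such that $d_3\leq d'\leq\min(d_m,d-1)$ and the linear system $B(C,r_1)_{d_1+d'-d+1}$ has a $0$-dimensional base locus. Then $$\tau(C)\geq (d-1)(d-d_1-1)+d_1^2-[d_1-(d-1-d_2)][d_1-(d-1-d')],$$ and equality holds if and only if $C$ is a 3-syzygy curve, and then $d'=d_3$. In particular, one has the following. (1) The equality $\tau(C)=(d-1)(d-d_1-1)$ holds if and only if $C$ is a 3-syzygy curve and $d_2=d_3=d-1$. (2) When $C$ is a line arrangement, then $$\tau(C)\geq (d-1)(d-d_1-1)+2d_1-1.$$ In other words, for line arrangements $C$ the du Plessis-Wall inequality $\tau(C)\geq (d-1)(d-d_1-1)$ is strict.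
   Context: Let $S=\mathbb{C}[x,y,z]$ with its standard grading, $f\in S$ homogeneous of degree $d$. Put $AR(f)=\{(a,b,c)\in S^3: af_x+bf_y+cf_z=0\}$, a graded $S$-module in which $(a,b,c)$ has degree $k$ when $a,b,c\in S_k$. The curve $C$ is an $m$-syzygy curve if a minimal set of homogeneous generators of $AR(f)$ has $m$ elements; the degrees $d_1\leq\dots\leq d_m$ of these generators are the exponents of $C$. Write $r_1=(a_1,b_1,c_1)$, of degree $d_1$. For a homogeneous $r=(a,b,c)\in AR(f)$ let $\Delta(r)$ be the determinant of the $3\times 3$ matrix with rows $(x,y,z)$, $(a_1,b_1,c_1)$, $(a,b,c)$. It is known that $f$ divides $\Delta(r)$, and one defines the morphism of graded $S$-modules $v:AR(f)\to S(d_1-d+1)$, $v(r)=\Delta(r)/f$. The Bourbaki ideal $B(C,r_1)\subset S$ is the homogeneous ideal with $\operatorname{im} v=B(C,r_1)(d_1-d+1)$; $B(C,r_1)_k$ denotes its homogeneous component of degree $k$, viewed as a linear system of plane curves of degree $k$, whose base locus is the common zero set in $\mathbb{P}^2$ of all its elements. A line arrangement is a curve that is a union of distinct lines. The total Tjurina number $\tau(C)$ is the sum of the Tjurina numbers of the singular points of $C$. *)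

(* Defs.v *)
From mathcomp Require Import all_boot all_order all_algebra.
From mathcomp Require Import complex.
From mathcomp Require Import boolp classical_sets cardinality fsbigop reals.
From mathcomp Require Import mpoly.

Set Implicit Arguments.
Unset Strict Implicit.
Unset Printing Implicit Defensive.

Import GRing.Theory.
Local Open Scope ring_scope.
Local Open Scope classical_set_scope.

Section PlaneCurves.
Variable K : closedFieldType.

Local Notation S := {mpoly K[3]}.

(* A point of P^2(K) is represented by its unique homogeneous coordinate
   vector whose last nonzero coordinate is 1. *)
Definition normalized (p : 'rV[K]_3) : bool :=
  [exists i : 'I_3, (p 0 i == 1) && [forall j : 'I_3, (i < j)%N ==> (p 0 j == 0)]].

Definition P2 : choiceType := {p : 'rV[K]_3 | normalized p}.

Definition coords (p : P2) : 'I_3 -> K := fun i => val p 0 i.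

Definition squarefree (f : S) : Prop :=
  forall g h : S, f = g ^+ 2 * h -> g \is a GRing.unit.

(* Triples of polynomials are row vectors; 'rV[S]_3 is the S-module S^3. *)

Definition AR (f : S) : set 'rV[S]_3 :=
  [set r | \sum_(i < 3) r 0 i * f^`M(i) = 0].

Definition homog_triple (k : nat) (r : 'rV[S]_3) : Prop :=
  forall i, r 0 i \is k.-homog.

Definition generates_AR (f : S) (m : nat) (r : 'I_m -> 'rV[S]_3)
    (I : {set 'I_m}) : Prop :=
  forall s, AR f s <-> exists c : 'I_m -> S, s = \sum_(i in I) c i *: r i.

Definition minimal_generators (f : S) (m : nat) (r : 'I_m -> 'rV[S]_3) : Prop :=
  generates_AR f r [set: 'I_m]%SET /\
  forall I : {set 'I_m}, generates_AR f r I -> I = [set: 'I_m]%SET.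

Definition exponents (f : S) (ds : seq nat) : Prop :=
  sorted leq ds /\
  exists r : 'I_(size ds) -> 'rV[S]_3,
    minimal_generators f r /\
    forall i : 'I_(size ds), homog_triple (nth 0%N ds i) (r i).

Definition syzygy_curve (m : nat) (f : S) : Prop :=
  exists2 ds, exponents f ds & size ds = m.

Definition Delta (r1 r : 'rV[S]_3) : S :=
  \det (\matrix_(i < 3, j < 3)
          (if i == 0%N :> nat then 'X_j
           else if i == 1%N :> nat then r1 0 j else r 0 j)).

(* The image of r |-> Delta r1 r / f on AR f. *)
Definition bourbaki (f : S) (r1 : 'rV[S]_3) : set S :=
  [set h | exists2 r, AR f r & Delta r1 r = h * f].

Definition component (k : int) (B : set S) : set S :=
  [set h | B h /\ match k with
                  | Posz n => (h \is n.-homog) : Prop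
                  | Negz _ => h = 0
                  end].

Definition base_locus (B : set S) : set P2 :=
  [set p | forall h, B h -> h.@[coords p] = 0].

(* A Zariski closed subset of P^2 has dimension 0 when it is nonempty and
   consists of finitely many points. *)
Definition zero_dimensional (Z : set P2) : Prop :=
  finite_set Z /\ Z !=set0.

Definition singular_points (f : S) : set P2 :=
  [set p | f.@[coords p] = 0 /\ forall i : 'I_3, (f^`M(i)).@[coords p] = 0].

(* The local ring of the affine plane at the origin, inside K(u, v). *)
Definition local_ring : set {fraction {mpoly K[2]}} :=
  [set q | exists h s : {mpoly K[2]},
             s.@[fun=> 0] != 0 /\ q = tofrac h / tofrac s].

(* The ideal (g, g_u, g_v) of the local ring. *)
Definition tjurina_ideal (g : {mpoly K[2]}) : set {fraction {mpoly K[2]}} :=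
  [set q | exists a : {fraction {mpoly K[2]}}, exists b : 'I_2 -> {fraction {mpoly K[2]}},
     [/\ local_ring a, forall j, local_ring (b j) &
         q = a * tofrac g + \sum_(j < 2) b j * tofrac (g^`M(j))]].

(* The classes of e_0, ..., e_{n-1} form a K-basis of local_ring / I. *)
Definition quotient_basis (I : set {fraction {mpoly K[2]}}) (n : nat)
    (e : 'I_n -> {fraction {mpoly K[2]}}) : Prop :=
  (forall i, local_ring (e i)) /\
  forall q, local_ring q ->
    exists! c : 'rV[K]_n, I (q - \sum_(i < n) tofrac (c 0 i)%:MP * e i).

(* Takes the junk value 0 when the quotient is infinite-dimensional. *)
Definition quotient_dim (I : set {fraction {mpoly K[2]}}) : nat :=
  xget 0%N [set n | exists e : 'I_n -> {fraction {mpoly K[2]}}, quotient_basis I e].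

(* An affine chart {x_i <> 0} containing p; any choice gives the same
   Tjurina number. *)
Definition chart (p : P2) : 'I_3 := odflt ord0 [pick i | coords p i != 0].

(* Local equation at p in that chart, with p moved to the origin: x_i is set to
   the constant p_i, and the two other variables x_k to p_k + u, p_k + v. *)
Definition local_equation (f : S) (p : P2) : {mpoly K[2]} :=
  f \mPo [tuple (coords p k)%:MP +
                (if unlift (chart p) k is Some j then 'X_j else 0) | k < 3].

Definition tjurina (f : S) (p : P2) : nat :=
  quotient_dim (tjurina_ideal (local_equation f p)).

(* Finitely supported sum: it would be 0 if infinitely many terms were nonzero,
   which does not happen for a reduced curve. *)
Definition total_tjurina (f : S) : nat :=
  \big[addn/0%N]_(p \in singular_points f) tjurina f p.

Definition line_arrangement (f : S) : Prop :=
  exists n (l : 'I_n -> S) (c : K),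
    [/\ c != 0,
        forall i, l i != 0 /\ l i \is 1.-homog,
        forall i j, i != j -> forall a : K, l i <> a *: l j &
        f = c *: \prod_(i < n) l i].

Definition is_least (P : nat -> Prop) (k : nat) : Prop :=
  P k /\ forall j, P j -> (k <= j)%N.

(* For exponents ds = (d_1, ..., d_m): d_3 <= k <= min (d_m, d - 1) and
   B(C, r1)_(d_1 + k - d + 1) has a 0-dimensional base locus. *)
Definition admissible (f : S) (d : nat) (ds : seq nat) (r1 : 'rV[S]_3)
    (k : nat) : Prop :=
  [/\ (nth 0%N ds 2 <= k)%N,
      (k <= minn (last 0%N ds) (d - 1))%N &
      zero_dimensional (base_locus
        (component ((nth 0%N ds 0)%:Z + k%:Z - d%:Z + 1) (bourbaki f r1)))].

End PlaneCurves.

(* Main.v *)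
(* Let [B] be the Bourbaki ideal of [r1], and [e = d - 1]. The Jacobian ideal and
   [B] have constant codimensions [tau] and [delta] in large degrees: a graded
   ideal of constant codimension [D] is exhausted by [D] steps, each of which
   adds a form generating a copy of the coordinate ring of a point, and lowers by
   one the length of the local ring at that point only; for the Jacobian ideal
   these lengths are the Tjurina numbers. Counting dimensions in the exact
   sequence [0 -> S r1 -> AR f -> B -> 0] gives [tau + delta + e d1 = e^2 + d1^2].

   The second generator of [AR f] has an image [h2] in [B] of degree
   [e2 = d1 - (e - d2)]. If [B] has a finite base locus in degree
   [k = d1 - (e - d')], it contains a form [h] of that degree coprime to [h2],
   whence [delta <= e2 k], the codimension of the complete intersection [(h2, h)].
   That ideal is saturated, so that equality forces [B = (h2, h)], and [AR f]
   is then generated by [r1] and two lifts.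

   If [f] is a product of lines [l_i], then [r1 (l_i) = m_i l_i] for some forms
   [m_i] of degree [d1 - 1], which all lie in [B]. A common divisor of the [m_i]
   would divide [r1], hence [delta <= (d1 - 1)^2]. *)

Require Import Defs.
From HB Require Import structures.
From mathcomp Require Import all_boot all_order all_algebra.
From mathcomp Require Import complex.
From mathcomp Require Import boolp classical_sets cardinality fsbigop reals.
From mathcomp Require Import mpoly.
From mathcomp Require Import perm zify ring.

Set Implicit Arguments.
Unset Strict Implicit.
Unset Printing Implicit Defensive.

Import GRing.Theory Num.Theory.
Local Open Scope ring_scope.

(** * Dimensions of quotient spaces *)

Section QuotientDimension.
Variable K : fieldType.

(** All invariants are dimensions of quotients, of graded pieces in large degree or of local rings;
    [qdim] is a relation between predicates because the ambient spaces are infinite-dimensional. The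
    passage from global to local codimensions needs a linear form [l] that acts bijectively on the
    quotient in large degrees: the [X_i / l] then commute on a finite-dimensional space, and a
    common eigenvector is the form supported at one point. Coprimality is the absence of common
    primes, hence the factoriality of polynomial rings; general members of linear systems and
    Euler's relation use characteristic zero. Saturation is a depth property, derived from the
    Koszul complex of the variables; it also gives [delta > 0], since otherwise [B] would contain
    [1] and [C] would be free, against [m >= 3]. A degree [d'] exists because the Koszul syzygies of
    the partial derivatives put the components of [r1] into [B], and these have finitely many common
    zeros. Part (1) reads [delta = d1^2], where [e2] and [k] are both at most [d1]; in part (2) the
    surplus is [d1^2 - (d1 - 1)^2]. *)

Definition subspace (M : lmodType K) (P : M -> Prop) : Prop :=
  P 0 /\ forall c x y, P x -> P y -> P (c *: x + y).

Definition lincomb (M : lmodType K) n (e : 'I_n -> M) (c : 'rV[K]_n) : M :=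
  \sum_(i < n) c 0 i *: e i.

Definition qspan (M : lmodType K) (P Q : M -> Prop) n (e : 'I_n -> M) : Prop :=
  forall x, P x -> exists c, Q (x - lincomb e c).

Definition qfree (M : lmodType K) (Q : M -> Prop) n (e : 'I_n -> M) : Prop :=
  forall c, Q (lincomb e c) -> c = 0.

(* The quotient [P / Q] has dimension [n]. *)
Definition qdim (M : lmodType K) (P Q : M -> Prop) (n : nat) : Prop :=
  exists e : 'I_n -> M, [/\ forall i, P (e i), qspan P Q e & qfree Q e].

Section Subspaces.
Variable M : lmodType K.
Implicit Types P Q R : M -> Prop.

Lemma subspaceD P x y : subspace P -> P x -> P y -> P (x + y).
Proof. by move=> [_ h] px py; have := h 1 _ _ px py; rewrite scale1r. Qed.

Lemma subspaceZ P c x : subspace P -> P x -> P (c *: x).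
Proof. by move=> [h0 h] px; have := h c _ _ px h0; rewrite addr0. Qed.

Lemma subspaceN P x : subspace P -> P x -> P (- x).
Proof. by move=> hP px; rewrite -scaleN1r; apply: subspaceZ. Qed.

Lemma subspaceB P x y : subspace P -> P x -> P y -> P (x - y).
Proof. by move=> hP px py; apply: subspaceD => //; apply: subspaceN. Qed.

Lemma subspace_sum P (I : Type) (r : seq I) (B : pred I) (F : I -> M) :
  subspace P -> (forall i, B i -> P (F i)) -> P (\sum_(i <- r | B i) F i).
Proof.
move=> hP hF; elim/big_rec: _ => [|i x Bi px]; first by case: hP.
by apply: subspaceD => //; apply: hF.
Qed.

Lemma subspace_lincomb P n (e : 'I_n -> M) c :
  subspace P -> (forall i, P (e i)) -> P (lincomb e c).
Proof.
by move=> hP he; apply: subspace_sum => // i _; apply: subspaceZ.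
Qed.

Lemma lincombD n (e : 'I_n -> M) c d : lincomb e (c + d) = lincomb e c + lincomb e d.
Proof. by rewrite -big_split /=; apply: eq_bigr => i _; rewrite mxE scalerDl. Qed.

Lemma lincombZ n (e : 'I_n -> M) a c : lincomb e (a *: c) = a *: lincomb e c.
Proof. by rewrite scaler_sumr; apply: eq_bigr => i _; rewrite mxE scalerA. Qed.

Lemma lincombN n (e : 'I_n -> M) c : lincomb e (- c) = - lincomb e c.
Proof. by rewrite -[- c]scaleN1r lincombZ scaleN1r. Qed.

Lemma lincombB n (e : 'I_n -> M) c d : lincomb e (c - d) = lincomb e c - lincomb e d.
Proof. by rewrite lincombD lincombN. Qed.

Lemma lincomb0 n (e : 'I_n -> M) : lincomb e 0 = 0.
Proof. by rewrite /lincomb big1 // => i _; rewrite mxE scale0r. Qed.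

Lemma lincomb_mul m n (e : 'I_n -> M) (c : 'rV[K]_m) (A : 'M[K]_(m, n)) :
  lincomb e (c *m A) = lincomb (fun j => lincomb e (row j A)) c.
Proof.
rewrite /lincomb; under eq_bigr do rewrite mxE scaler_suml.
rewrite exchange_big; apply: eq_bigr => j _; rewrite scaler_sumr.
by apply: eq_bigr => i _; rewrite mxE scalerA.
Qed.

(** Bridge to [quotient_basis], which speaks of unique coordinates: existence is spanning, and
    uniqueness is freeness applied to a difference of coordinate vectors. *)
Lemma qdim_unique_coords P Q n (e : 'I_n -> M) : subspace P -> subspace Q ->
  (forall i, P (e i)) ->
  (qspan P Q e /\ qfree Q e) <->
  (forall x, P x -> exists! c, Q (x - lincomb e c)).
Proof.
move=> hP hQ he; split=> [[hs hf] x px|h].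
  have [c qc] := hs x px; exists c; split => // d qd.
  apply/esym/eqP; rewrite -subr_eq0; apply/eqP/hf; rewrite lincombB.
  have -> : lincomb e d - lincomb e c = (x - lincomb e c) - (x - lincomb e d).
    by rewrite opprB [RHS]addrC addrA subrK.
  exact: subspaceB.
split=> [x px|c qc]; first by have [c [qc _]] := h x px; exists c.
have [d [_ hd]] := h _ (subspace_lincomb c hP he).
rewrite -(hd c); first by apply: hd; rewrite lincomb0 subr0.
by rewrite subrr; case: hQ.
Qed.

(** The coordinates of the [m] free vectors in the [n] spanning ones form an [m x n] matrix; for
    [n < m] it has a nonzero left kernel vector, which would be a relation modulo [Q]. *)
Lemma qfree_leq_qspan P Q n m (e : 'I_n -> M) (f : 'I_m -> M) : subspace Q ->
  (forall j, P (f j)) -> qspan P Q e -> qfree Q f -> (m <= n)%N.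
Proof.
move=> hQ hf hs fr; rewrite leqNgt; apply/negP => nm.
have /choice [A hA] : forall j : 'I_m, exists c, Q (f j - lincomb e c).
  by move=> j; apply: hs.
pose B := \matrix_(j < m) A j.
have : kermx B != 0.
  rewrite -mxrank_eq0 mxrank_ker -lt0n subn_gt0.
  by apply: leq_ltn_trans (rank_leq_col B) nm.
case/rowV0Pn => v /sub_kermxP vB /eqP; apply; apply: fr.
have -> : lincomb f v = \sum_j v 0 j *: (f j - lincomb e (A j)).
  transitivity (lincomb f v - lincomb e (v *m B)).
    by rewrite vB lincomb0 subr0.
  rewrite lincomb_mul /lincomb -sumrB; apply: eq_bigr => j _.
  by rewrite scalerBr rowK.
by apply: subspace_sum => // j _; apply: subspaceZ.
Qed.

Lemma qdim_uniq P Q n m : subspace Q -> qdim P Q n -> qdim P Q m -> n = m.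
Proof.
move=> hQ [e [pe se fe]] [f [pf sf ff]]; apply/eqP; rewrite eqn_leq.
by rewrite (qfree_leq_qspan hQ pe sf fe) (qfree_leq_qspan hQ pf se ff).
Qed.

Lemma qdim_eq0 P Q : subspace Q -> (forall x, P x -> Q x) -> qdim P Q 0.
Proof.
move=> hQ h; exists (fun=> 0); split=> [[] //|x px|c _].
  by exists 0; rewrite lincomb0 subr0; apply: h.
by apply/rowP => -[].
Qed.

Lemma qdim0_sub P Q x : qdim P Q 0 -> P x -> Q x.
Proof.
by move=> [e [_ s _]] /s [c]; rewrite /lincomb big_ord0 subr0.
Qed.

Definition fcons (x : M) n (e : 'I_n -> M) (i : 'I_n.+1) : M :=
  if unlift ord0 i is Some j then e j else x.

Lemma lincomb_fcons x n (e : 'I_n -> M) (c : 'rV[K]_n.+1) :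
  lincomb (fcons x e) c = c 0 ord0 *: x + lincomb e (\row_i c 0 (lift ord0 i)).
Proof.
rewrite /lincomb big_ord_recl /fcons unlift_none; congr (_ + _).
by apply: eq_bigr => i _; rewrite liftK mxE.
Qed.

Lemma fcons_in P x n (e : 'I_n -> M) :
  P x -> (forall i, P (e i)) -> forall i, P (fcons x e i).
Proof. by move=> px pe i; rewrite /fcons; case: unlift. Qed.

Lemma fcons_coord0 n (c : 'rV[K]_n.+1) :
  c 0 ord0 = 0 -> \row_i c 0 (lift ord0 i) = 0 -> c = 0.
Proof.
move=> c0 /rowP cl; apply/rowP => i; rewrite mxE.
by case: (unliftP ord0 i) => [j ->|->] //; have := cl j; rewrite !mxE.
Qed.

Lemma qfree_fcons Q x n (e : 'I_n -> M) : subspace Q -> qfree Q e ->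
  ~ (exists c, Q (x - lincomb e c)) -> qfree Q (fcons x e).
Proof.
move=> hQ fe hx c; rewrite lincomb_fcons => qc.
case: (eqVneq (c 0 ord0) 0) => [c0|cn0].
  by apply: fcons_coord0 => //; apply: fe; rewrite c0 scale0r add0r in qc.
case: hx; exists (- (c 0 ord0)^-1 *: (\row_i c 0 (lift ord0 i))).
rewrite lincombZ scaleNr opprK.
have := subspaceZ (c 0 ord0)^-1 hQ qc.
by rewrite scalerDr scalerA mulVf // scale1r.
Qed.

(** A free family in [R] of maximal length spans [R] modulo [Q], since a vector outside its span
    could be prepended; the lengths are bounded by [n]. *)
Lemma qspan_sub P R Q n (e : 'I_n -> M) : subspace Q -> (forall x, R x -> P x) ->
  qspan P Q e -> exists2 a, (a <= n)%N & qdim R Q a.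
Proof.
move=> hQ RP se.
pose B a := `[< exists f : 'I_a -> M, (forall i, R (f i)) /\ qfree Q f >].
have B0 : exists a, B a.
  exists 0%N; apply/asboolP; exists (fun=> 0); split=> [[]//|c _].
  by apply/rowP => -[].
have Bn a : B a -> (a <= n)%N.
  move=> /asboolP [f [Rf ff]].
  by apply: (@qfree_leq_qspan P Q _ _ e f) => // j; apply: RP.
case: (ex_maxnP B0 Bn) => a Ba amax; exists a; first exact: Bn.
have /asboolP [f [Rf ff]] := Ba; exists f; split => // x Rx.
apply: contrapT => hx; suff : B a.+1 by move/amax; rewrite ltnn.
apply/asboolP; exists (fcons x f); split; first exact: fcons_in.
exact: qfree_fcons.
Qed.

Lemma qdim_sub P R Q n : subspace Q -> (forall x, R x -> P x) -> qdim P Q n ->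
  exists2 a, (a <= n)%N & qdim R Q a.
Proof. by move=> hQ RP [e [_ se _]]; apply: qspan_sub RP se. Qed.

Lemma qdim_quot P R Q n : subspace R -> (forall x, Q x -> R x) -> qdim P Q n ->
  exists2 a, (a <= n)%N & qdim P R a.
Proof.
move=> hR QR [e [_ se _]]; apply: (@qspan_sub P P R n e) => // x px.
by have [c qc] := se x px; exists c; apply: QR.
Qed.

Lemma qdim_add P R Q a b : subspace P -> subspace R -> subspace Q ->
  (forall x, Q x -> R x) -> (forall x, R x -> P x) ->
  qdim R Q a -> qdim P R b -> qdim P Q (a + b).
Proof.
move=> hP hR hQ QR RP [e [Re se fe]] [f [Pf sf ff]].
pose g (i : 'I_(a + b)) := match split i with inl j => e j | inr j => f j end.
have gE c : lincomb g c = lincomb e (lsubmx c) + lincomb f (rsubmx c).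
  rewrite /lincomb big_split_ord /=; congr (_ + _); apply: eq_bigr => i _.
    by rewrite /g mxE -[lshift b i]/(unsplit (inl i)) unsplitK.
  by rewrite /g mxE -[rshift a i]/(unsplit (inr i)) unsplitK.
exists g; split.
- by move=> i; rewrite /g; case: split => j //; apply: RP.
- move=> x px; have [d rd] := sf x px; have [c qc] := se _ rd.
  exists (row_mx c d); rewrite gE row_mxKl row_mxKr.
  by rewrite [lincomb e c + _]addrC opprD addrA.
- move=> c; rewrite gE => qc.
  have d0 : rsubmx c = 0.
    apply: ff; rewrite -[lincomb f _](addKr (lincomb e (lsubmx c))) [- _ + _]addrC.
    apply: subspaceB => //; [exact: QR | exact: subspace_lincomb].
  have c0 : lsubmx c = 0 by apply: fe; move: qc; rewrite d0 lincomb0 addr0.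
  by rewrite -[c]hsubmxK c0 d0 row_mx0.
Qed.

Lemma qdim_split P R Q n : subspace P -> subspace R -> subspace Q ->
  (forall x, Q x -> R x) -> (forall x, R x -> P x) -> qdim P Q n ->
  exists a b, [/\ qdim R Q a, qdim P R b & n = (a + b)%N].
Proof.
move=> hP hR hQ QR RP h.
have [a _ ha] := qdim_sub hQ RP h; have [b _ hb] := qdim_quot hR QR h.
by exists a, b; split=> //; apply: qdim_uniq h (qdim_add _ _ _ _ _ ha hb).
Qed.

Lemma qdim_ext P Q P' Q' n : (forall x, P x <-> P' x) -> (forall x, Q x <-> Q' x) ->
  qdim P Q n -> qdim P' Q' n.
Proof.
move=> hP hQ; have -> : P = P' by apply/funext => x; apply/propext.
by have -> : Q = Q' by apply/funext => x; apply/propext.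
Qed.

End Subspaces.

(** The hypotheses say that [f] induces an isomorphism from [P / Q] to [P' / Q']: the last
    equivalence is well-definedness together with injectivity. [qdim_preimage] goes back along the
    same isomorphism. *)
Lemma qdim_image (M N : lmodType K) (f : {linear M -> N}) (P Q : M -> Prop)
    (P' Q' : N -> Prop) n :
  subspace P -> subspace Q' ->
  (forall x, P x -> P' (f x)) ->
  (forall y, P' y -> exists2 x, P x & Q' (y - f x)) ->
  (forall x, P x -> (Q' (f x) <-> Q x)) ->
  qdim P Q n -> qdim P' Q' n.
Proof.
move=> hP hQ' fP fsurj fQ [e [Pe se fe]].
have fE c : lincomb (f \o e) c = f (lincomb e c).
  by rewrite /lincomb linear_sum; apply: eq_bigr => i _; rewrite linearZ.
exists (f \o e); split=> [i|y Py|c].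
- exact: fP.
- have [x px qx] := fsurj y Py; have [c qc] := se x px; exists c.
  rewrite fE -[y](subrK (f x)) -addrA -linearB; apply: subspaceD => //.
  by apply/fQ => //; apply: subspaceB => //; apply: subspace_lincomb.
- rewrite fE => qc; apply: fe; apply/fQ => //; exact: subspace_lincomb.
Qed.

Lemma qdim_preimage (M N : lmodType K) (f : {linear M -> N}) (P Q : M -> Prop)
    (P' Q' : N -> Prop) n :
  subspace P -> subspace Q' ->
  (forall x, P x -> P' (f x)) ->
  (forall y, P' y -> exists2 x, P x & Q' (y - f x)) ->
  (forall x, P x -> (Q' (f x) <-> Q x)) ->
  qdim P' Q' n -> qdim P Q n.
Proof.
move=> hP hQ' fP fsurj fQ [e' [Pe se fe]].
have /choice [e he] : forall i, exists x, P x /\ Q' (e' i - f x).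
  by move=> i; have [x px qx] := fsurj _ (Pe i); exists x.
have diff c : Q' (lincomb e' c - f (lincomb e c)).
  rewrite /lincomb linear_sum -sumrB; apply: subspace_sum => // i _.
  by rewrite linearZ -scalerBr; apply: subspaceZ => //; case: (he i).
have Pec c : P (lincomb e c) by apply: subspace_lincomb => // i; case: (he i).
exists e; split=> [i|x px|c qc]; first by case: (he i).
  have [c qc] := se _ (fP x px); exists c; apply/fQ; first exact: subspaceB.
  by rewrite linearB -(subrK (lincomb e' c) (f x)) -addrA; apply: subspaceD.
apply: fe; rewrite -(subrK (f (lincomb e c)) (lincomb e' c)).
by apply: subspaceD => //; apply/fQ.
Qed.

End QuotientDimension.

(** * Unique factorization *)

Section Divisibility.
Variable R : idomainType.
Implicit Types a b c p : R.

Definition divides a b : Prop := exists c, b = a * c.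

Definition prime_elt p : Prop :=
  [/\ p != 0, p \isn't a GRing.unit &
      forall a b, divides p (a * b) -> divides p a \/ divides p b].

(** The factors are prime elements rather than irreducible ones, so that uniqueness never has to be
    stated. *)
Definition factored a : Prop :=
  exists2 us : R * seq R, us.1 \is a GRing.unit &
    (forall p, p \in us.2 -> prime_elt p) /\ a = us.1 * \prod_(p <- us.2) p.

Definition factorial : Prop := forall a, a != 0 -> factored a.

Lemma factored_mul a b : factored a -> factored b -> factored (a * b).
Proof.
move=> [[u s] /= uu [ps ->]] [[v t] /= vv [pt ->]].
exists (u * v, s ++ t); rewrite /= ?unitrM ?uu //; split; last first.
  by rewrite big_cat /= mulrACA.
by move=> p; rewrite mem_cat => /orP [/ps|/pt].
Qed.

Lemma divides_refl a : divides a a.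
Proof. by exists 1; rewrite mulr1. Qed.

Lemma divides0 a : divides a 0.
Proof. by exists 0; rewrite mulr0. Qed.

Lemma divides_trans b a c : divides a b -> divides b c -> divides a c.
Proof. by move=> [x ->] [y ->]; exists (x * y); rewrite mulrA. Qed.

Lemma divides_mulr a b c : divides a b -> divides a (b * c).
Proof. by move=> [x ->]; exists (x * c); rewrite mulrA. Qed.

Lemma divides_mull a b c : divides a b -> divides a (c * b).
Proof. by rewrite mulrC; apply: divides_mulr. Qed.

Lemma dividesD a b c : divides a b -> divides a c -> divides a (b + c).
Proof. by move=> [x ->] [y ->]; exists (x + y); rewrite mulrDr. Qed.

Lemma dividesN a b : divides a b -> divides a (- b).
Proof. by move=> [x ->]; exists (- x); rewrite mulrN. Qed.

Lemma dividesB a b c : divides a b -> divides a c -> divides a (b - c).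
Proof. by move=> hb hc; apply: dividesD => //; apply: dividesN. Qed.

Lemma divides_sum a (I : Type) (r : seq I) (P : pred I) (F : I -> R) :
  (forall i, P i -> divides a (F i)) -> divides a (\sum_(i <- r | P i) F i).
Proof.
by move=> h; elim/big_rec: _ => [|i x Pi hx];
  [exact: divides0 | apply: dividesD => //; apply: h].
Qed.

Lemma divides_unit a u : divides a u -> u \is a GRing.unit -> a \is a GRing.unit.
Proof. by move=> [c ->]; rewrite unitrM => /andP []. Qed.

Lemma prime_prod p (s : seq R) : prime_elt p -> divides p (\prod_(q <- s) q) ->
  exists2 q, q \in s & divides p q.
Proof.
move=> [p0 pu hp]; elim: s => [|q s ih].
  by rewrite big_nil => /divides_unit -/(_ (unitr1 _)); rewrite (negbTE pu).
rewrite big_cons => /hp [h|/ih [r rs h]]; first by exists q; rewrite ?mem_head.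
by exists r; rewrite // in_cons rs orbT.
Qed.

Lemma prime_divisor_exists a : factorial -> a != 0 -> a \isn't a GRing.unit ->
  exists2 p, prime_elt p & divides p a.
Proof.
move=> fR a0 au; have [[u s] /= uu [ps ea]] := fR a a0.
case: s ps ea => [|p s] ps ea.
  by move: au; rewrite ea big_nil mulr1 uu.
exists p; first by apply: ps; rewrite mem_head.
by rewrite ea big_cons mulrCA; exists (u * \prod_(j <- s) j).
Qed.

End Divisibility.

Lemma factorial_of_units (R : idomainType) :
  (forall a : R, a != 0 -> a \is a GRing.unit) -> factorial R.
Proof. by move=> h a a0; exists (a, [::]); rewrite ?h //= big_nil mulr1. Qed.

Lemma factorial_iso (R R' : idomainType) (f : {rmorphism R -> R'}) (g : {rmorphism R' -> R}) :
  cancel f g -> cancel g f -> factorial R' -> factorial R.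
Proof.
move=> fK gK hR a a0.
have fa0 : f a != 0 by apply: contra_neq a0 => fa; rewrite -[a]fK fa rmorph0.
have [[u s] /= uu [ps fa]] := hR _ fa0.
exists (g u, map g s); first by rewrite /= rmorph_unit.
split=> /=; last by rewrite big_map -rmorph_prod -rmorphM -fa fK.
move=> _ /mapP [p /ps [p0 pu hp] ->]; split.
- by apply: contra_neq p0 => gp; rewrite -[p]gK gp rmorph0.
- by apply: contra pu => gpu; rewrite -[p]gK rmorph_unit.
move=> x y [c e].
have /hp [[d ed]|[d ed]] : divides p (f x * f y).
- by exists (f c); rewrite -rmorphM e rmorphM gK.
- by left; exists (g d); rewrite -rmorphM -ed fK.
- by right; exists (g d); rewrite -rmorphM -ed fK.
Qed.

(** * Gauss's lemma and factoriality of univariate polynomial rings *)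

Section Gauss.
Variable R : idomainType.
Implicit Types (p c : R) (A B C : {poly R}).

(** Content one, phrased by primes so that no gcd of the coefficients is formed. *)
Definition primitive A : Prop := forall p, prime_elt p -> ~ divides p%:P A.

Lemma divides_polyC p A : divides p%:P A <-> forall i, divides p A`_i.
Proof.
split=> [[B ->] i|h]; first by exists B`_i; rewrite coefCM.
have /choice [b hb] := h; exists (\poly_(i < size A) b i).
apply/polyP => i; rewrite coefCM coef_poly; case: ltnP => [_|hi]; first exact: hb.
by rewrite mulr0 nth_default.
Qed.

(** If [p] divides neither factor, take in each the lowest coefficient not divisible by [p]; their
    product is the only term of the coefficient of degree [i + j] that [p] fails to divide. *)
Lemma prime_polyC p : prime_elt p -> prime_elt p%:P.
Proof.
move=> [p0 pu hp]; split; first by rewrite polyC_eq0.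
  by rewrite poly_unitE size_polyC p0 /= coefC.
move=> A B hAB; apply: contrapT => /not_orP [nA nB].
have ex D : ~ divides p%:P D -> exists i, `[< ~ divides p D`_i >].
  move=> nD; apply: contrapT => /forallNP h; apply: nD; apply/divides_polyC => i.
  by apply: contrapT => nd; apply: (h i); apply/asboolP.
case: (ex_minnP (ex _ nA)) => i /asboolP hi mi.
case: (ex_minnP (ex _ nB)) => j /asboolP hj mj.
have dA k : (k < i)%N -> divides p A`_k.
  by move=> ki; apply: contrapT => /asboolP/mi; rewrite leqNgt ki.
have dB k : (k < j)%N -> divides p B`_k.
  by move=> kj; apply: contrapT => /asboolP/mj; rewrite leqNgt kj.
have /divides_polyC /(_ (i + j)%N) := hAB.
have li : (i < (i + j).+1)%N by rewrite ltnS leq_addr.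
rewrite coefM (bigD1 (Ordinal li)) //= addKn => h.
have {}h : divides p (A`_i * B`_j).
  rewrite -[_ * _](addrK (\sum_(k < (i + j).+1 | k != Ordinal li) A`_k * B`_(i + j - k))).
  apply: dividesB => //; apply: divides_sum => k ki.
  have := ki; rewrite -val_eqE /= neq_ltn => /orP [lt|gt].
    exact/divides_mulr/dA.
  by apply/divides_mull/dB; have := ltn_ord k; lia.
by case: (hp _ _ h).
Qed.

(** The primes of the constant are cancelled one at a time: each divides [A * D] but not the
    primitive [A], hence divides [D]. *)
Lemma primitive_cancel (s : seq R) u A B D : u \is a GRing.unit ->
  (forall p, p \in s -> prime_elt p) -> primitive A ->
  (u * \prod_(p <- s) p)%:P * B = A * D -> divides A B.
Proof.
move=> uu; elim: s D => [|p s ih] D ps hA.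
  rewrite big_nil mulr1 => e; exists (u^-1%:P * D).
  by rewrite mulrCA -e mulrA -polyCM mulVr // mul1r.
rewrite big_cons mulrCA polyCM -mulrA => e.
have hp : prime_elt p by apply: ps; rewrite mem_head.
have [p0 _ /(_ A D)] := prime_polyC hp.
case=> [|/(hA _ hp) //|[D' eD]]; first by exists ((u * \prod_(j <- s) j)%:P * B).
apply: (ih D') => // [q qs|]; first by apply: ps; rewrite in_cons qs orbT.
by apply: (mulfI p0); rewrite e eD mulrCA.
Qed.

(** Each prime of the constant divides one of the two factors and is removed from it. The sizes are
    recorded for the induction on the size in [factorial_poly]. *)
Lemma split_cancel (s : seq R) u A B C : u \is a GRing.unit ->
  (forall p, p \in s -> prime_elt p) ->
  (u * \prod_(p <- s) p)%:P * A = B * C ->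
  exists B' C', [/\ A = B' * C', size B' = size B & size C' = size C].
Proof.
move=> uu; elim: s B C => [|p s ih] B C ps.
  rewrite big_nil mulr1 => e; exists (u^-1%:P * B), C; split => //.
    by rewrite -mulrA -e mulrA -polyCM mulVr // mul1r.
  by rewrite mul_polyC size_scale // invr_eq0; apply: contraTneq uu => ->; rewrite unitr0.
rewrite big_cons mulrCA polyCM -mulrA => e.
have hp : prime_elt p by apply: ps; rewrite mem_head.
have [p0 _ /(_ B C)] := prime_polyC hp.
have ps' : forall q, q \in s -> prime_elt q.
  by move=> q qs; apply: ps; rewrite in_cons qs orbT.
have sz D D' : D = p%:P * D' -> size D' = size D.
  by move=> ->; rewrite mul_polyC size_scale // -(polyC_eq0 p).
case=> [|[D eD]|[D eD]]; first by exists ((u * \prod_(j <- s) j)%:P * A).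
  have [|B' [C' [-> sB sC]]] := ih D C ps'.
    by apply: (mulfI p0); rewrite e eD mulrA.
  by exists B', C'; rewrite sB sC (sz _ _ eD).
have [|B' [C' [-> sB sC]]] := ih B D ps'.
  by apply: (mulfI p0); rewrite e eD mulrCA.
by exists B', C'; rewrite sB sC (sz _ _ eD).
Qed.

Hypothesis factR : factorial R.

(** Induction on the number of primes in the leading coefficient: a prime dividing [A] divides this
    coefficient, hence is associated to one of its primes, and pulling that one out shortens the
    list. *)
Lemma primitive_part A : A != 0 -> exists c A0, [/\ c != 0, A = c%:P * A0 & primitive A0].
Proof.
move=> A0; have lA0 : lead_coef A != 0 by rewrite lead_coef_eq0.
have [[u s] /= uu [ps e]] := factR lA0.
elim: {s}(size s) {-2}s (erefl (size s)) A A0 lA0 ps e => [|n ih] s sn A A0 lA0 ps e.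
  exists 1, A; split; rewrite ?oner_neq0 ?mul1r // => p [p0 pu _] /divides_polyC hp.
  have := hp (size A).-1; rewrite -/(lead_coef A) e (size0nil sn) big_nil mulr1.
  by move=> /divides_unit/(_ uu); rewrite (negbTE pu).
case: (pselect (exists2 q, q \in s & divides q%:P A)) => [[q qs [B eB]]|nq].
  have q0 : q != 0 by have [] := ps q qs.
  have B0 : B != 0 by apply: contra_neq A0 => B0; rewrite eB B0 mulr0.
  have [||||c [B' [c0 eB' pB]]] := ih (rem q s) _ B B0.
  - by rewrite size_rem // sn.
  - by rewrite lead_coef_eq0.
  - by move=> p /mem_rem; apply: ps.
  - apply: (mulfI q0); move: e; rewrite (big_rem q qs) /= eB lead_coefM lead_coefC.
    by move=> ->; rewrite mulrCA.
  by exists (q * c), B'; rewrite mulf_neq0 // polyCM -mulrA -eB'.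
exists 1, A; split; rewrite ?oner_neq0 ?mul1r // => p hp dp.
have [p0 pu pp] := hp.
have := dp => /divides_polyC/(_ (size A).-1); rewrite -/(lead_coef A) e.
case/pp => [/divides_unit/(_ uu)|/(prime_prod hp) [q qs [t et]]].
  by rewrite (negbTE pu).
apply: nq; exists q => //; have [q0 qu qp] := ps q qs.
have [|[w ew]|[w ew]] := qp p t; first by exists 1; rewrite mulr1.
  by apply: divides_trans dp; exists w%:P; rewrite -polyCM -ew.
case/negP: pu; apply/unitrPr; exists w; apply: (mulfI q0).
by rewrite mulr1 mulrA (mulrC q) -mulrA -ew.
Qed.

(** Over a domain [%|] is divisibility up to a nonzero scalar; primitivity of [A] removes the
    scalar. *)
Lemma primitive_divides_dvdp A B : primitive A -> A %| B -> divides A B.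
Proof.
move=> pA /Pdiv.WeakIdomain.dvdpP [[k D] /= k0 e].
have [[u s] /= uu [ps ek]] := factR k0.
by apply: (primitive_cancel (D := D) uu ps pA); rewrite -ek mul_polyC e mulrC.
Qed.

Lemma primitive_irreducible_prime A : primitive A -> irreducible_poly A -> prime_elt A.
Proof.
move=> pA irrA; have A0 := irredp_neq0 irrA; split=> //.
  by rewrite poly_unitE; case: irrA => sA _; rewrite eqn_leq leqNgt sA.
move=> B C [D e]; have dA : A %| B * C.
  by apply/Pdiv.WeakIdomain.dvdpP; exists (1, D); rewrite ?oner_neq0 //= scale1r e mulrC.
case: (eqVneq (size (gcdp A B)) 1%N) => [/eqP s1|s1].
  right; apply: primitive_divides_dvdp => //.
  by move: dA; rewrite Pdiv.CommonIdomain.Gauss_dvdpr // Pdiv.CommonIdomain.coprimep_def.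
left; apply: primitive_divides_dvdp => //.
have := irrA _ s1 (Pdiv.CommonIdomain.dvdp_gcdl A B).
move=> /Pdiv.CommonIdomain.eqp_dvdl <-; exact: Pdiv.CommonIdomain.dvdp_gcdr.
Qed.

(** Induction on the size. The content factors in [R]; a primitive polynomial of positive degree is
    either irreducible, hence prime, or has a proper divisor up to a scalar, and then [split_cancel]
    writes it as a product of smaller polynomials. *)
Lemma factorial_poly : factorial {poly R}.
Proof.
move=> A; elim: {A}(size A) {-2}A (leqnn (size A)) => [|n ih] A sA A0.
  by move: A0; rewrite -size_poly_gt0; case: (size A) sA.
have [c [B [c0 eA pB]]] := primitive_part A0.
have sAB : size A = size B by rewrite eA mul_polyC size_scale.
rewrite eA; apply: factored_mul.
  have [[u s] /= uu [ps ->]] := factR c0.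
  exists (u%:P, map polyC s); first by rewrite /= rmorph_unit.
  split=> /=; last by rewrite big_map polyCM rmorph_prod.
  by move=> _ /mapP [p /ps hp ->]; apply: prime_polyC.
have B0 : B != 0 by apply: contra_neq A0 => B0; rewrite eA B0 mulr0.
case: (leqP (size B) 1) => [/size1_polyC eB|sB].
  set b := B`_0 in eB; have b0 : b != 0 by rewrite -polyC_eq0 -eB.
  have [bu|bu] := boolP (b \is a GRing.unit).
    by exists (B, [::]); rewrite /= ?big_nil ?mulr1 // eB rmorph_unit.
  have [p hp [t et]] := prime_divisor_exists factR b0 bu.
  by case: (pB p hp); exists t%:P; rewrite eB et polyCM.
case: (pselect (irreducible_poly B)) => [irr|nirr].
  exists (1, [:: B]); rewrite /= ?unitr1 //; split; last by rewrite big_seq1 mul1r.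
  by move=> p; rewrite inE => /eqP ->; apply: primitive_irreducible_prime.
have [q [sq dq nq]] : exists q : {poly R}, [/\ size q != 1%N, q %| B & ~ q %= B].
  apply: contrapT => h; apply: nirr; split=> // q sq dq.
  by apply: contrapT => nq; apply: h; exists q.
have [[k D] /= k0 e] := Pdiv.WeakIdomain.dvdpP _ _ dq.
have kB0 : k *: B != 0 by rewrite -mul_polyC mulf_neq0 ?polyC_eq0.
have D0 : D != 0 by apply: contra_neq kB0 => D0; rewrite e D0 mul0r.
have q0 : q != 0 by apply: contra_neq kB0 => q0; rewrite e q0 mulr0.
have sqB : (size q < size B)%N.
  rewrite ltn_neqAle Pdiv.CommonIdomain.dvdp_leq // andbT.
  by rewrite Pdiv.CommonIdomain.dvdp_size_eqp //; apply/negP.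
have [[u s] /= uu [ps ek]] := factR k0.
have [|E [F [-> sE sF]]] := @split_cancel s u B D q uu ps.
  by rewrite -ek mul_polyC.
have sDq : size B = (size D + size q).-1.
  by rewrite -size_mul // -e size_scale.
have sq1 : (1 < size q)%N by rewrite ltn_neqAle eq_sym sq size_poly_gt0.
have q0s : (0 < size q)%N := ltnW sq1.
have sD1 : (0 < size D)%N by rewrite size_poly_gt0.
have [sDn sqn] : (size D <= n)%N /\ (size q <= n)%N.
  move: sA sAB sqB sDq sq1 sD1; clear.
  move: (size A) (size B) (size q) (size D) => *; lia.
apply: factored_mul; apply: ih; rewrite ?sE ?sF //.
  by rewrite -size_poly_gt0 sE sD1.
by rewrite -size_poly_gt0 sF q0s.
Qed.

End Gauss.

(** * Factoriality in several variables, by splitting off the last one *)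

Section FactorialMpoly.
Variable K : fieldType.

Section Muni.
Variable n : nat.

(** Inverse of [muni]: the two exhibit the ring in [n + 1] variables as univariate polynomials over
    the ring in [n] variables, so that Gauss's lemma applies inductively. *)
Definition of_muni (q : {poly {mpoly K[n]}}) : {mpoly K[n.+1]} :=
  (map_poly (@mwiden n K) q).['X_ord_max].

Fact of_muni_is_zmod_morphism : zmod_morphism of_muni.
Proof. by move=> p q; rewrite /of_muni rmorphB hornerD hornerN. Qed.
Fact of_muni_is_monoid_morphism : monoid_morphism of_muni.
Proof.
by split=> [|p q]; rewrite /of_muni ?rmorph1 ?hornerC // rmorphM hornerM.
Qed.
HB.instance Definition _ := GRing.isZmodMorphism.Build _ _ of_muni of_muni_is_zmod_morphism.
HB.instance Definition _ := GRing.isMonoidMorphism.Build _ _ of_muni of_muni_is_monoid_morphism.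

Lemma muniX (m : 'X_{1..n.+1}) : muni 'X_[m] =
  'X_[[multinom (m (widen_ord (leqnSn n) i)) | i < n]] *: 'X^(m ord_max)
    :> {poly {mpoly K[n]}}.
Proof.
rewrite muniE msuppX big_seq1 mcoeffX eqxx scale1r.
by congr ('X_[_] *: _); apply/mnmP => i; rewrite !mnmE; congr (m _); apply: val_inj.
Qed.

Lemma of_muniD p q : of_muni (p + q) = of_muni p + of_muni q.
Proof. exact: rmorphD. Qed.

Lemma muniK : cancel (@muni n K) of_muni.
Proof.
elim/mpolyind => [|c m p _ _ ih]; first by rewrite muni0 rmorph0.
rewrite muniD of_muniD; apply: (congr2 +%R); last exact: ih.
rewrite muniZ muniX /of_muni 2!map_polyZ map_polyXn !hornerZ hornerXn /=.
rewrite mwidenC mwidenX mpolyXn -mpolyXD mul_mpolyC; congr (_ *: 'X_[_]).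
apply/mnmP => i; rewrite mnmDE mulmnE mnm1E.
case: (unliftP ord_max i) => [j ->|->].
  have -> : lift ord_max j = widen_ord (leqnSn n) j by apply: val_inj; rewrite /= /bump leqNgt ltn_ord.
  rewrite mnmwiden_widen mnmE (_ : _ == _ = false) ?addn0 //.
  by rewrite -val_eqE /= gtn_eqF.
by rewrite mnmwiden_ordmax eqxx mul1n.
Qed.

Lemma muni_mwiden (p : {mpoly K[n]}) : muni (mwiden p) = p%:P.
Proof.
elim/mpolyind: p => [|c m p _ _ ih]; first by rewrite mwiden0 muni0.
rewrite mwidenD muniD ih polyCD mwidenZ mwidenX muniZ muniX; congr (_ + _).
rewrite -mul_mpolyC polyCM mnmwiden_ordmax expr0 alg_polyC mul_polyC.
congr (_ *: ('X_[_])%:P).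
by apply/mnmP => i; rewrite mnmE mnmwiden_widen.
Qed.

Lemma of_muniK : cancel of_muni (@muni n K).
Proof.
move=> q; rewrite /of_muni horner_coef size_map_inj_poly ?rmorph0 //; last first.
  exact: inj_mwiden.
rewrite rmorph_sum -[RHS]coefK poly_def; apply: eq_bigr => i _ /=.
rewrite coef_map_id0 ?rmorph0 // rmorphM rmorphXn /= muni_mwiden.
rewrite mul_polyC; congr (_ *: _ ^+ _).
rewrite muniX mnm1E eqxx expr1 (_ : [multinom _ | _ < n] = 0%MM) ?mpolyX0 ?scale1r //.
apply/mnmP => j; rewrite mnmE mnm1E mnm0E.
by rewrite -val_eqE /= gtn_eqF.
Qed.

End Muni.

Lemma factorial_mpoly n : factorial {mpoly K[n]}.
Proof.
elim: n => [|n ih].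
  apply: factorial_of_units => a a0; rewrite (nvar0_mpolyC a) rmorph_unit // unitfE.
  by apply: contra_neq a0 => a00; rewrite (nvar0_mpolyC a) a00 mpolyC0.
apply: (@factorial_iso _ _ (@muni n K) (@of_muni n) _ _ (factorial_poly ih)).
  exact: muniK.
exact: of_muniK.
Qed.

End FactorialMpoly.

(** * Forms and points *)

Section Grading.
Variables (n : nat) (K : fieldType).
Local Notation S := {mpoly K[n]}.
Implicit Types (p q : S).

Lemma pihomogMr p q k e : q \is e.-homog ->
  pihomog mdeg (k + e) (p * q) = pihomog mdeg k p * q.
Proof.
move=> hq; elim/mpolyind: p => [|c m p _ _ ih].
  by rewrite mul0r !pihomog0 mul0r.
rewrite mulrDl !pihomogD ih mulrDl; congr (_ + _).
rewrite -scalerAl !linearZ /= pihomogX -scalerAl; congr (_ *: _).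
have hm : 'X_[m] * q \is (mdeg m + e).-homog by rewrite dhomogM // dhomogX.
case: eqP => [<-|/eqP mk]; first exact: pihomog_dE.
by rewrite mul0r (pihomog_ne0 _ hm) // eqn_add2r.
Qed.

Lemma pihomogMr_lt p q k e : q \is e.-homog -> (k < e)%N ->
  pihomog mdeg k (p * q) = 0.
Proof.
move=> hq ke; elim/mpolyind: p => [|c m p _ _ ih].
  by rewrite mul0r !pihomog0.
rewrite mulrDl !pihomogD ih addr0 -scalerAl linearZ /=.
have hm : 'X_[m] * q \is (mdeg m + e).-homog by rewrite dhomogM // dhomogX.
by rewrite (pihomog_ne0 _ hm) ?scaler0 // gtn_eqF // (leq_trans ke) // leq_addl.
Qed.

(* The image of [p] under X_i |-> t X_i: its coefficients in t are the
   homogeneous components of [p]. *)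
Definition grading p : {poly S} := mmap (polyC \o @mpolyC n K) (fun i => 'X_i *: 'X) p.

Lemma gradingX m : grading 'X_[m] = 'X_[m] *: 'X^(mdeg m).
Proof.
rewrite /grading mmapX /mmap1 mdegE mpolyXE_id.
elim/big_rec3: _ => [|i a b c _ ->]; first by rewrite expr0 alg_polyC.
by rewrite exprZn -scalerAl -scalerAr scalerA exprD.
Qed.

Lemma grading_coef p k : (grading p)`_k = pihomog mdeg k p.
Proof.
elim/mpolyind: p => [|c m p _ _ ih]; first by rewrite /grading mmap0 coef0 pihomog0.
rewrite [X in _ = X]pihomogD -ih {1}/grading mmapD coefD; congr (_ + _).
rewrite mmapZ -/(grading _) gradingX linearZ /= pihomogX mul_polyC !coefZ coefXn mul_mpolyC.
by rewrite eq_sym; case: eqP; rewrite ?mulr1 ?mulr0.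
Qed.

Lemma gradingM p q : grading (p * q) = grading p * grading q.
Proof. by rewrite /grading rmorphM. Qed.

Lemma grading_homog p k : p \is k.-homog -> grading p = p *: 'X^k.
Proof.
move=> hp; apply/polyP => i; rewrite grading_coef coefZ coefXn.
case: eqP => [->|/eqP ik]; first by rewrite mulr1 pihomog_dE.
by rewrite mulr0 (pihomog_ne0 _ hp) // eq_sym.
Qed.

Lemma homog_of_grading p c k : grading p = c *: 'X^k -> p \is k.-homog.
Proof.
move=> e; rewrite homog_piE; apply/eqP.
rewrite [RHS](@pihomog_partitionE _ _ mdeg (maxn (msize p) k.+1)) ?leq_maxl //.
have hk : (k < maxn (msize p) k.+1)%N by rewrite leq_max leqnn orbT.
rewrite (bigD1 (Ordinal hk)) //= big1 ?addr0 // => i ik.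
rewrite -grading_coef e coefZ coefXn (_ : _ == _ = false) ?mulr0 //.
by move: ik; rewrite -val_eqE /= => /negbTE.
Qed.

(** Splitting off the powers of the indeterminate leaves factors with nonzero constant terms; their
    product is forced to be the constant [c], so both are constant. *)
Lemma mulr_eqXn (R : idomainType) (A B : {poly R}) c k : c != 0 ->
  A * B = c *: 'X^k -> exists a i, A = a *: 'X^i.
Proof.
move=> c0 e.
have cX0 : c *: 'X^k != 0 :> {poly R}.
  by rewrite -mul_polyC mulf_neq0 ?polyC_eq0 // -size_poly_eq0 size_polyXn.
have A0 : A != 0 by apply: contra_neq cX0 => A0; rewrite -e A0 mul0r.
have B0 : B != 0 by apply: contra_neq cX0 => B0; rewrite -e B0 mulr0.
have [i [A' rA eA]] := multiplicity_XsubC A 0.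
have [j [B' rB eB]] := multiplicity_XsubC B 0.
rewrite A0 B0 !subr0 /= in rA eA rB eB.
have eAB : A' * B' * 'X^(i + j) = c *: 'X^k by rewrite -e eA eB exprD mulrACA.
have rAB : (A' * B')`_0 != 0.
  by rewrite -horner_coef0 hornerM mulf_neq0 // -rootE.
have ijk : (i + j)%N = k.
  have /polyP/(_ (i + j)%N) := eAB; rewrite coefMXn ltnn subnn coefZ coefXn.
  by case: eqP => // _; rewrite mulr0 => h; rewrite h eqxx in rAB.
have sA : size A' == 1%N.
  have : A' * B' = c%:P.
    apply: (@mulIf _ 'X^(i + j)); first by rewrite -size_poly_eq0 size_polyXn.
    by rewrite eAB ijk mul_polyC.
  move/(congr1 (fun p : {poly R} => size p)); rewrite size_polyC c0 /= => s1.
  have A'0 : A' != 0 by apply: contra_neq A0 => A'0; rewrite eA A'0 mul0r.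
  have B'0 : B' != 0 by apply: contra_neq B0 => B'0; rewrite eB B'0 mul0r.
  move: s1; rewrite size_mul //; move: A'0 B'0; rewrite -!size_poly_gt0.
  by case: (size A') => [|[|a]] //; case: (size B') => [|b] //; rewrite addnS.
by have /size_poly1P [a a0 eA'] := sA; exists a, i; rewrite eA eA' mul_polyC.
Qed.

(** [grading] is multiplicative, and a polynomial is homogeneous exactly when its image is a
    monomial in the new indeterminate; factors of such a monomial are monomials. *)
Lemma homog_factor p q k : p * q != 0 -> p * q \is k.-homog ->
  exists i j, [/\ p \is i.-homog, q \is j.-homog & k = (i + j)%N].
Proof.
move=> pq0 hpq; have e := grading_homog hpq; rewrite gradingM in e.
have [a [i /homog_of_grading hp]] := mulr_eqXn pq0 e.
have [b [j /homog_of_grading hq]] : exists a i, grading q = a *: 'X^i.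
  by apply: (@mulr_eqXn _ _ (grading p) _ k pq0); rewrite mulrC.
exists i, j; split=> //; apply: dhomog_uniq pq0 hpq _; exact: dhomogM.
Qed.

Lemma homog_divl p q e k : q != 0 -> q \is e.-homog -> p * q \is (k + e).-homog ->
  p \is k.-homog.
Proof.
move=> q0 hq hpq; case: (eqVneq p 0) => [->|p0]; first exact: dhomog0.
have pq0 : p * q != 0 by rewrite mulf_neq0.
have [i [j [hp hq' /eqP]]] := homog_factor pq0 hpq.
by rewrite (dhomog_uniq q0 hq' hq) eqn_add2r => /eqP ->.
Qed.

Lemma homog_divl_lt p q e k : q \is e.-homog -> p * q \is k.-homog -> (k < e)%N ->
  q != 0 -> p = 0.
Proof.
move=> hq hpq ke q0; apply/eqP; apply: contraLR ke => p0.
have pq0 : p * q != 0 by rewrite mulf_neq0.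
have [i [j [hp hq' ->]]] := homog_factor pq0 hpq.
by rewrite (dhomog_uniq q0 hq' hq) -leqNgt leq_addl.
Qed.

Lemma homog0_const p : p \is 0.-homog -> p = (p@_0%MM)%:MP.
Proof.
move=> hp; apply/mpolyP => m; rewrite mcoeffC; case: eqP => [->|/eqP m0].
  by rewrite mulr1.
by rewrite mulr0 (dhomog_nemf_coeff hp) // mdeg_eq0.
Qed.

Lemma meval_homog p k (v : 'I_n -> K) c : p \is k.-homog ->
  p.@[fun i => c * v i] = c ^+ k * p.@[v].
Proof.
move=> hp; rewrite !mevalE mulr_sumr big_seq [RHS]big_seq; apply: eq_bigr => m mp.
under eq_bigr do rewrite exprMn.
rewrite big_split /= mulrCA; congr (_ * _).
by rewrite prodrXr -mdegE (dhomog_mf hp mp).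
Qed.

Lemma meval_homog0 p k : p \is k.+1.-homog -> p.@[fun=> 0] = 0.
Proof.
move=> hp; rewrite (meval_eq _ (v2 := fun i => 0 * 0)); last by move=> i; rewrite mul0r.
by rewrite (meval_homog _ _ hp) exprS !mul0r.
Qed.

Lemma mpoly_unitP p : reflect (exists2 c, c != 0 & p = c%:MP) (p \is a GRing.unit).
Proof.
apply: (iffP idP) => [/andP [/eqP e u]|[c c0 ->]].
  by exists (p@_0); rewrite // -unitfE.
by rewrite rmorph_unit // unitfE.
Qed.

Lemma homog_unit p k : p != 0 -> p \is k.-homog -> p \is a GRing.unit -> k = 0%N.
Proof.
move=> p0 hp /mpoly_unitP [c _ e].
by apply: (dhomog_uniq p0 hp); rewrite e -[c%:MP]mulr1 mul_mpolyC dhomogZ // dhomog1.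
Qed.

Lemma homog0_unit p : p != 0 -> p \is 0.-homog -> p \is a GRing.unit.
Proof.
move=> p0 /homog0_const e; apply/mpoly_unitP; exists (p@_0%MM) => //.
by apply: contra_neq p0 => c0; rewrite e c0 mpolyC0.
Qed.

Lemma homog_ind (P : S -> Prop) k : subspace P ->
  (forall m : 'X_{1..n}, mdeg m = k -> P 'X_[m]) -> forall h, h \is k.-homog -> P h.
Proof.
move=> hP hX h hh; rewrite [h]mpolyE big_seq; apply: subspace_sum => // m mh.
by apply: subspaceZ => //; apply: hX; apply: (dhomog_mf hh).
Qed.

End Grading.

Definition form (n : nat) (K : fieldType) k : {mpoly K[n]} -> Prop := fun h => h \is k.-homog.
Definition zeros (V : nmodType) : V -> Prop := fun x => x = 0.

Lemma zeros_subspace (K : fieldType) (V : lmodType K) : subspace (@zeros V).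
Proof. by split=> // c x y -> ->; rewrite scaler0 addr0. Qed.

Lemma form_subspace n (K : fieldType) k : subspace (@form n K k).
Proof.
by split=> [|c x y hx hy]; [exact: dhomog0 | apply: dhomogD => //; apply: dhomogZ].
Qed.

Definition sdim k : nat := 'C(k + 2, k).

(** The binomial coefficient cleared of its denominator, as a polynomial identity for the dimension
    counts. *)
Lemma sdimE k : (2 * sdim k = (k + 1) * (k + 2))%N.
Proof.
rewrite /sdim -bin_sub ?leq_addr // addKn mulnC.
have := bin_ffact (k + 2) 2; rewrite (_ : 2`! = 2)%N // => ->.
by rewrite ffactnS ffactn1 addn2 addn1 /= mulnC.
Qed.

Import VectorInternalTheory.

Lemma vect_qdim (K : fieldType) (V : vectType K) :
  qdim (fun _ : V => True) (@zeros V) (dim V).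
Proof.
pose F : 'rV[K]_(dim V) -> V := r2v.
have FZD a x y : F (a *: x + y) = a *: F x + F y by rewrite /F linearP.
have F0 : F 0 = 0 by have := FZD (-1) 0 0; rewrite !scaleN1r !addNr.
have FD x y : F (x + y) = F x + F y by have := FZD 1 x y; rewrite !scale1r.
have FZ a x : F (a *: x) = a *: F x by have := FZD a x 0; rewrite !addr0 F0 addr0.
have e c : lincomb (fun i => F (delta_mx 0 i)) c = F c.
  rewrite /lincomb [in RHS](row_sum_delta c) (big_morph F FD F0).
  by apply: eq_bigr => i _; rewrite FZ.
exists (fun i => F (delta_mx 0 i)); split=> // [x _|c].
  by exists (v2r x); rewrite e /F v2rK /zeros subrr.
by rewrite e => h; apply: (can_inj (@r2vK _ V)); rewrite -/F F0.
Qed.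

Lemma form_dim (K : fieldType) k : qdim (@form 3 K k) (@zeros _) (sdim k).
Proof.
apply: (@qdim_image K (dhomog 3 K k) _ (@mpoly_of_dhomog 3 K k)
  _ _ _ _ _ _ _ _ _ _ (vect_qdim (dhomog 3 K k))) => //.
- exact: zeros_subspace.
- by move=> x _; apply: dhomog_is_dhomog.
- by move=> y hy; exists (DHomog hy); rewrite // /zeros subrr.
- by move=> x _; split=> [h|->] //; apply: val_inj.
Qed.

Section Points.
Variable K : closedFieldType.

Lemma P2_exists (w : 'I_3 -> K) i : w i != 0 ->
  exists (p : P2 K) c, c != 0 /\ forall j, w j = c * coords p j.
Proof.
move=> wi.
have [j wj hj] : exists2 j : 'I_3, w j != 0 & forall k : 'I_3, (j < k)%N -> w k = 0.
  case: (@arg_maxnP _ i (fun j => w j != 0) (@nat_of_ord 3) wi) => j wj hj.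
  by exists j => // k jk; apply/eqP; apply: contraLR jk => /hj; rewrite -leqNgt.
pose v := \row_k (w k / w j).
have nv : normalized v.
  apply/existsP; exists j; rewrite mxE divff // eqxx /=.
  by apply/forallP => k; apply/implyP => jk; rewrite mxE hj // mul0r.
exists (exist _ v nv), (w j); split=> // k.
by rewrite /coords /= mxE mulrCA divff // mulr1.
Qed.

Lemma coords_neq0 (p : P2 K) : exists i, coords p i != 0.
Proof.
case: p => v nv; have /existsP [i /andP [/eqP vi _]] := nv; exists i.
by rewrite /coords /= vi oner_neq0.
Qed.

Lemma chart_neq0 (p : P2 K) : coords p (chart p) != 0.
Proof.
rewrite /chart; case: pickP => [//|h]; have [i hi] := coords_neq0 p.
by rewrite h in hi.
Qed.

Lemma P2_eq (p q : P2 K) c : (forall i, coords p i = c * coords q i) -> p = q.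
Proof.
case: p q => v nv [w nw] h; apply: val_inj => /=; apply/rowP => k.
have {}h i : v 0 i = c * w 0 i := h i.
have /existsP [i /andP [/eqP vi /forallP hi]] := nv.
have /existsP [j /andP [/eqP wj /forallP hj]] := nw.
have c0 : c != 0.
  by apply: contraTneq (oner_neq0 K) => c0; rewrite -vi h c0 mul0r eqxx.
suff c1 : c = 1 by rewrite h c1 mul1r.
case: (ltngtP i j) => [ij|ji|/val_inj ij].
- have := hi j; rewrite ij /= h wj mulr1 => /eqP c0'; by rewrite c0' eqxx in c0.
- have := hj i; rewrite ji /= => /eqP wi.
  by have := h i; rewrite vi wi mulr0 => /eqP; rewrite oner_eq0.
by have := h i; rewrite vi ij wj mulr1.
Qed.

End Points.

(** * Regular pairs of polynomials *)

(** For [n] spanning vectors of an [n]-dimensional quotient, the transition matrices to and from a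
    basis are inverse on one side, hence on both, being square. *)
Lemma qspan_qfree (K : fieldType) (M : lmodType K) (P Q : M -> Prop) n (e : 'I_n -> M) :
  subspace Q -> (forall i, P (e i)) -> qdim P Q n -> qspan P Q e -> qfree Q e.
Proof.
move=> hQ Pe [f [Pf sf ff]] se c qc.
have /choice [A hA] i : exists a, Q (e i - lincomb f a) := sf _ (Pe i).
have /choice [B hB] j : exists b, Q (f j - lincomb e b) := se _ (Pf j).
pose mA := \matrix_i A i; pose mB := \matrix_j B j.
have eA d : Q (lincomb e d - lincomb f (d *m mA)).
  rewrite lincomb_mul /lincomb -sumrB; apply: subspace_sum => // i _.
  by rewrite -scalerBr rowK; apply: subspaceZ.
have fB d : Q (lincomb f d - lincomb e (d *m mB)).
  rewrite lincomb_mul /lincomb -sumrB; apply: subspace_sum => // i _.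
  by rewrite -scalerBr rowK; apply: subspaceZ.
have BA : mB *m mA = 1%:M.
  apply/row_matrixP => i; rewrite !rowE -[RHS](subrK (delta_mx 0 i *m (mB *m mA))).
  rewrite [_ - _](ff _ _) ?add0r // mulmx1 lincombB mulmxA.
  have := subspaceD hQ (fB (delta_mx 0 i)) (eA (delta_mx 0 i *m mB)).
  by rewrite addrA subrK.
rewrite -[c]mulmx1 -(mulmx1C BA) mulmxA [c *m mA](ff _ _) ?mul0mx //.
have := subspaceB hQ qc (eA c); by rewrite opprB addrC subrK.
Qed.

(** Pigeonhole: each [x] in [s] excludes at most one integer, and [size s + 1] integers are
    tried. *)
Lemma exists_avoiding (T : eqType) (s : seq T) (B : T -> nat -> Prop) :
  (forall x, x \in s -> forall t u, B x t -> B x u -> t = u) ->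
  exists t, forall x, x \in s -> ~ B x t.
Proof.
move=> hB; apply: contrapT => /forallNP h.
have /choice [f hf] : forall t, exists x, x \in s /\ B x t.
  move=> t; apply: contrapT => nh; apply: (h t) => x xs Bx; apply: nh; by exists x.
have : (size (map f (iota 0 (size s).+1)) <= size s)%N.
  apply: uniq_leq_size => [|_ /mapP [t _ ->]]; last by case: (hf t).
  rewrite map_inj_in_uniq ?iota_uniq // => t u _ _ e.
  by have [fs ft] := hf t; apply: (hB _ fs) => //; rewrite e; case: (hf u).
by rewrite size_map size_iota ltnn.
Qed.

Section Nonvanishing.
Variable K : numClosedFieldType.

Lemma poly_nonroot (p : {poly K}) : p != 0 -> exists x, p.[x] != 0.
Proof.
move=> p0; apply: contrapT => /forallNP h.
have : (size [seq t%:R : K | t <- iota 0 (size p)] < size p)%N.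
  apply: max_poly_roots => //.
    by apply/allP => _ /mapP [t _ ->]; apply/negPn/negP/h.
  by rewrite map_inj_uniq ?iota_uniq // => t u /eqP; rewrite eqr_nat => /eqP.
by rewrite size_map size_iota ltnn.
Qed.

Definition extend_point n (v : 'I_n -> K) (x : K) (i : 'I_n.+1) : K :=
  if unlift ord_max i is Some j then v j else x.

Lemma meval_muni n (v : 'I_n -> K) x (p : {mpoly K[n.+1]}) :
  p.@[extend_point v x] = (map_poly (meval v) (muni p)).[x].
Proof.
elim/mpolyind: p => [|c m p _ _ ih]; first by rewrite meval0 muni0 map_poly0 horner0.
rewrite mevalD muniD rmorphD hornerD; apply: (congr2 +%R); last exact: ih.
rewrite mevalZ mevalX muniZ muniX /= 2!map_polyZ /= map_polyXn !hornerZ hornerXn.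
rewrite mevalC mevalX big_ord_recr /= /extend_point unlift_none; congr (_ * (_ * _)).
apply: eq_bigr => i _; rewrite mnmE (_ : widen_ord _ i = lift ord_max i) ?liftK //.
by apply: val_inj; rewrite /= /bump leqNgt ltn_ord.
Qed.

Lemma mpoly_nonvanishing n (p : {mpoly K[n]}) : p != 0 -> exists v, p.@[v] != 0.
Proof.
elim: n p => [|n ih] p p0.
  exists (fun=> 0); rewrite (nvar0_mpolyC p) mevalC.
  by apply: contra_neq p0 => c0; rewrite (nvar0_mpolyC p) c0 mpolyC0.
have q0 : muni p != 0.
  by apply: contra_neq p0 => q0; rewrite -[p]muniK q0 rmorph0.
have [v hv] : exists v, (lead_coef (muni p)).@[v] != 0 by apply: ih; rewrite lead_coef_eq0.
have [x hx] : exists x, (map_poly (meval v) (muni p)).[x] != 0.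
  apply: poly_nonroot; apply: contra_neq hv => /polyP /(_ (size (muni p)).-1).
  by rewrite coef_map coef0.
by exists (extend_point v x); rewrite meval_muni.
Qed.

End Nonvanishing.

Section RegularPair.
Variables (n : nat) (K : numClosedFieldType).
Local Notation S := {mpoly K[n]}.
Implicit Types g h : S.

(** For nonzero [g] in a factorial ring this is coprimality, in the form in which the syzygies of
    the pair are computed. *)
Definition regular g h : Prop := forall a b, a * g = b * h -> divides g b.

Lemma natr_unit_mpoly m : (0 < m)%N -> (m%:R : S) \is a GRing.unit.
Proof.
move=> m0; apply/mpoly_unitP; exists m%:R; first by rewrite pnatr_eq0 -lt0n.
by rewrite mpolyC_nat.
Qed.

Lemma divides_mulrn q h m : (0 < m)%N -> divides q (h *+ m) -> divides q h.
Proof.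
move=> m0 [c e]; exists (c / m%:R); rewrite mulrA -e -[h *+ m]mulr_natr mulrK //.
exact: natr_unit_mpoly.
Qed.

(** A vector space over an infinite field is not a finite union of proper subspaces. Each [q]
    divides at most one member of the family [h + t h']: two would make [q] divide [(u - t) h'],
    hence [h'] in characteristic zero, and then [h]. *)
Lemma exists_not_divided (s : seq S) (L : S -> Prop) : subspace L ->
  (forall q, q \in s -> exists2 h, L h & ~ divides q h) ->
  exists2 h, L h & forall q, q \in s -> ~ divides q h.
Proof.
move=> hL; elim: s => [|q s ih] hs; first by exists 0 => //; case: hL.
have [h Lh hh] : exists2 h, L h & forall q, q \in s -> ~ divides q h.
  by apply: ih => r rs; apply: hs; rewrite in_cons rs orbT.
have [h' Lh' hh'] : exists2 h, L h & ~ divides q h by apply: hs; rewrite mem_head.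
have two r t u : (t < u)%N -> divides r (h + h' *+ t) -> divides r (h + h' *+ u) ->
    divides r h' /\ divides r h.
  move=> tu dt du; have d' : divides r h'.
    apply: (divides_mulrn (m := (u - t)%N)); first by rewrite subn_gt0.
    have := dividesB du dt; rewrite opprD addrACA subrr add0r.
    by rewrite mulrnBr // ltnW.
  split=> //; rewrite -[h](addrK (h' *+ t)); apply: dividesB => //.
  by rewrite -mulr_natr; apply: divides_mulr.
have [|t ht] := @exists_avoiding _ (q :: s) (fun r t => divides r (h + h' *+ t)).
  move=> r; rewrite in_cons => rs t u dt du; apply/eqP; apply/negPn/negP.
  rewrite neq_ltn => tu; have [d' d] : divides r h' /\ divides r h.
    by case/orP: tu => tu; apply: (two r _ _ tu).
  by case/orP: rs => [/eqP rq|/hh]; [apply: hh'; rewrite -rq | apply].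
exists (h + h' *+ t) => //; apply: subspaceD => //.
by rewrite -scaler_nat; apply: subspaceZ.
Qed.

Lemma regular_of_primes (s : seq S) u h : u \is a GRing.unit ->
  (forall q, q \in s -> prime_elt q) -> (forall q, q \in s -> ~ divides q h) ->
  regular (u * \prod_(q <- s) q) h.
Proof.
move=> uu; elim: s => [|q s ih] ps hs a b e.
  by rewrite big_nil mulr1; exists (u^-1 * b); rewrite mulrA divrr // mul1r.
have qs : q \in q :: s by rewrite mem_head.
have [q0 _ pq] := ps q qs; rewrite big_cons in e *.
set P := \prod_(j <- s) j in ih e *.
have {}e : b * h = q * (a * (u * P)) by rewrite -e; ring.
have [|[b' eb]|/(hs q qs)] // := pq b h; first by exists (a * (u * P)).
have [c ec] : divides (u * P) b'.
  apply: (ih _ _ a) => [r rs|r rs|]; first by apply: ps; rewrite in_cons rs orbT.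
    by apply: hs; rewrite in_cons rs orbT.
  by apply: (mulfI q0); rewrite -e eb; ring.
by exists c; rewrite eb ec; ring.
Qed.

(** The source of the coprime pairs below: a general member of the linear system [L] avoids each of
    the finitely many prime divisors of [g]. *)
Lemma regular_pair_exists g (L : S -> Prop) : g != 0 -> subspace L ->
  (forall q, prime_elt q -> divides q g -> exists2 h, L h & ~ divides q h) ->
  exists2 h, L h & regular g h.
Proof.
move=> g0 hL hg; have [[u s] /= uu [ps e]] := factorial_mpoly g0.
have [q qs|h Lh hh] := @exists_not_divided s L hL.
  apply: hg; first exact: ps.
  by rewrite e (big_rem q) //= mulrCA; exists (u * \prod_(y <- rem q s) y).
by exists h => //; rewrite e; apply: regular_of_primes.
Qed.

End RegularPair.

(** * Codimension of a complete intersection of two plane curves *)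

Section CompleteIntersection.
Variable K : numClosedFieldType.
Local Notation S := {mpoly K[3]}.
Implicit Types (g h : S).

Definition mulby g (a : S) : S := a * g.
Fact mulby_is_linear g : linear (mulby g).
Proof. by move=> c x y; rewrite /mulby mulrDl scalerAl. Qed.
HB.instance Definition _ g := GRing.isLinear.Build K S S _ (mulby g) (mulby_is_linear g).

Definition multiples g j : S -> Prop := fun h => exists2 a, form j a & h = a * g.

(** A graded piece of the ideal [(g1, g2)]; the indices are the degrees of the coefficients, not of
    the result. *)
Definition combinations g1 g2 j1 j2 : S -> Prop :=
  fun h => exists a b, [/\ form j1 a, form j2 b & h = a * g1 + b * g2].

Lemma multiples_subspace g j : subspace (multiples g j).
Proof.
split=> [|c x y [a ha ->] [b hb ->]]; first by exists 0; rewrite ?mul0r //; apply: dhomog0.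
exists (c *: a + b); last by rewrite mulrDl scalerAl.
by apply: dhomogD => //; apply: dhomogZ.
Qed.

Lemma combinations_subspace g1 g2 j1 j2 : subspace (combinations g1 g2 j1 j2).
Proof.
split=> [|c x y [a [b [ha hb ->]]] [a' [b' [ha' hb' ->]]]].
  by exists 0, 0; rewrite !mul0r addr0; split=> //; apply: dhomog0.
exists (c *: a + a'), (c *: b + b'); split.
- by apply: dhomogD => //; apply: dhomogZ.
- by apply: dhomogD => //; apply: dhomogZ.
- by rewrite !mulrDl scalerDr -!scalerAl addrACA.
Qed.

Lemma multiples_dim g j : g != 0 -> qdim (multiples g j) (@zeros _) (sdim j).
Proof.
move=> g0; apply: (@qdim_image K S S (mulby g) (form j) (@zeros _)) (form_dim K j).
- exact: form_subspace.
- exact: zeros_subspace.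
- by move=> x hx; exists x.
- by move=> y [a ha ->]; exists a; rewrite // /zeros /mulby subrr.
- move=> x _; split=> [/eqP|->]; last exact: mul0r.
  by rewrite [X in X == _]/(x * g) mulf_eq0 (negbTE g0) orbF => /eqP.
Qed.

Lemma form_multiples_dim g e j : g != 0 -> g \is e.-homog ->
  exists2 a, qdim (form (j + e)) (multiples g j) a & (a + sdim j = sdim (j + e))%N.
Proof.
move=> g0 ge.
have gin h : multiples g j h -> form (j + e) h by move=> [a ha ->]; apply: dhomogM.
have [||||| a [b [ha hb e1]]] := @qdim_split K S (form (j + e)) (multiples g j) (@zeros _) _ _ _ _ _ _ (form_dim K (j + e)).
- exact: form_subspace.
- exact: multiples_subspace.
- exact: zeros_subspace.
- by move=> x ->; case: (multiples_subspace g j).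
- exact: gin.
exists b; rewrite // e1 addnC; congr (_ + _)%N.
by apply: qdim_uniq (multiples_dim _ g0) ha; exact: zeros_subspace.
Qed.

(** By regularity, multiplication by [g2] identifies [(g1, g2) / (g1)] with forms modulo multiples
    of [g1]. The codimension is then a second difference of [sdim], which is [e1 e2]; the degree is
    written [j + e1 + e2] to keep all four degrees nonnegative. *)
Lemma combinations_dim g1 g2 e1 e2 j : g1 != 0 -> g2 != 0 ->
  g1 \is e1.-homog -> g2 \is e2.-homog -> regular g1 g2 ->
  qdim (form (j + e1 + e2)) (combinations g1 g2 (j + e2) (j + e1)) (e1 * e2).
Proof.
move=> g10 g20 h1 h2 reg.
have [a ha ea] := form_multiples_dim (j + e2) g10 h1.
rewrite [(j + e2 + e1)%N]addnAC in ha ea.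
have [b hb eb] := form_multiples_dim j g10 h1.
have hc : qdim (combinations g1 g2 (j + e2) (j + e1)) (multiples g1 (j + e2)) b.
  apply: (@qdim_image K S S (mulby g2)) hb.
  - exact: form_subspace.
  - exact: multiples_subspace.
  - move=> x hx; exists 0, x; rewrite mul0r add0r; split=> //; exact: dhomog0.
  - move=> y [c [d [hc hd ->]]]; exists d => //; exists c => //.
    by rewrite /mulby addrK.
  - move=> x hx; split=> [[c hc e]|[c hc ->]]; last first.
      by exists (c * g2); [apply: dhomogM | rewrite /mulby mulrAC].
    have [y ey] := reg _ _ (esym e); exists y; last by rewrite ey mulrC.
    by apply: (homog_divl g10 h1); rewrite mulrC -ey.
have [||||| b' [c [hb' hc' e]]] := @qdim_split K S (form (j + e1 + e2))
    (combinations g1 g2 (j + e2) (j + e1)) (multiples g1 (j + e2)) a _ _ _ _ _ ha.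
- exact: form_subspace.
- exact: combinations_subspace.
- exact: multiples_subspace.
- move=> x [y hy ->]; exists y, 0; rewrite mul0r addr0; split=> //; exact: dhomog0.
- move=> x [y [z [hy hz ->]]]; apply: dhomogD; last exact: dhomogM.
  by rewrite addnAC; apply: dhomogM.
have eb' : b' = b by apply: qdim_uniq hb' hc; apply: multiples_subspace.
suff <- : c = (e1 * e2)%N by [].
move: (sdimE (j + e1 + e2)) (sdimE (j + e2)) (sdimE (j + e1)) (sdimE j) ea eb.
by rewrite e eb'; move: (sdim _) (sdim _) (sdim _) (sdim _) => *; nia.
Qed.

End CompleteIntersection.

(** * Homogeneous ideals of stable codimension *)

Section GradedIdeals.
Variable K : numClosedFieldType.
Local Notation S := {mpoly K[3]}.
Local Notation X i := ('X_i : S).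
Implicit Types (h l s : S) (I J : nat -> S -> Prop).

(* A homogeneous ideal is given by the family of its graded pieces. *)
Definition gideal I : Prop :=
  [/\ forall k h, I k h -> h \is k.-homog,
      forall k, subspace (I k) &
      forall k j h s, I k h -> s \is j.-homog -> I (j + k)%N (s * h)].

Lemma homogX i : X i \is 1.-homog.
Proof. by rewrite dhomogX /= mdeg1. Qed.

Lemma homog_mul1 s h k : s \is 1.-homog -> h \is k.-homog -> s * h \is k.+1.-homog.
Proof. by move=> hs hh; rewrite -[k.+1]add1n; apply: dhomogM. Qed.

Lemma mpolyXU_neq0 i : X i != 0.
Proof. by rewrite -msupp_eq0 msuppX. Qed.

Lemma homogC (c : K) : (c%:MP : S) \is 0.-homog.
Proof. by rewrite -[c%:MP]mulr1 mul_mpolyC dhomogZ // dhomog1. Qed.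

Section Radical.
Variable J : nat -> S -> Prop.
Hypothesis hJ : gideal J.

Let Jh := let: And3 h _ _ := hJ in h.
Let Js := let: And3 _ h _ := hJ in h.
Let Jm := let: And3 _ _ h := hJ in h.

(** The radical of [J], degree by degree; no gradient is meant. *)
Definition grad k h : Prop := h \is k.-homog /\ exists m, J (k * m) (h ^+ m).

Lemma grad_gideal : gideal grad.
Proof.
have gD k x y : grad k x -> grad k y -> grad k (x + y).
  move=> [hx [m jm]] [hy [n jn]]; split; first exact: dhomogD.
  exists (m + n)%N; rewrite exprDn; apply: subspace_sum => // i _.
  rewrite -scaler_nat; apply: subspaceZ => //.
  case: (leqP n i) => [ni|ni].
    have -> : y ^+ i = y ^+ (i - n) * y ^+ n by rewrite -exprD subnK.
    rewrite mulrA.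
    have -> : (k * (m + n) = (k * (m + n - i) + k * (i - n)) + k * n)%N.
      by have := ltn_ord i; rewrite -!mulnDr => ?; congr (_ * _)%N; lia.
    by apply: Jm => //; apply: dhomogM; apply: dhomogMn.
  have e : (m + n - i = (n - i) + m)%N by lia.
  rewrite e exprD mulrAC.
  have -> : (k * (m + n) = (k * (n - i) + k * i) + k * m)%N.
    by rewrite -!mulnDr; congr (_ * _)%N; lia.
  by apply: Jm => //; apply: dhomogM; apply: dhomogMn.
have gM k j x s : grad k x -> s \is j.-homog -> grad (j + k) (s * x).
  move=> [hx [m jm]] hs; split; first exact: dhomogM.
  by exists m; rewrite mulnDl exprMn; apply: Jm => //; apply: dhomogMn.
split=> // [k h [//]|k]; split.
  split; first exact: dhomog0.
  by exists 1%N; rewrite expr1; case: (Js (k * 1)).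
move=> c x y hx hy; apply: gD => //.
have -> : c *: x = c%:MP * x by rewrite mul_mpolyC.
by rewrite -[k]add0n; apply: gM => //; apply: homogC.
Qed.

Lemma sub_grad k h : J k h -> grad k h.
Proof. by move=> jh; split; [apply: Jh | exists 1%N; rewrite muln1 expr1]. Qed.

Lemma grad_of_exp k h m : h \is k.-homog -> grad (k * m) (h ^+ m) -> grad k h.
Proof.
move=> hh [_ [n jn]]; split=> //; exists (m * n)%N.
by rewrite mulnA exprM.
Qed.

(** In a monomial whose degree is at least the sum of the nilpotency exponents, some variable
    reaches its own exponent. *)
Lemma grad_variables : (forall i, grad 1 (X i)) ->
  exists N, forall k h, (N <= k)%N -> h \is k.-homog -> J k h.
Proof.
move=> gX; have /choice [m hm] i : exists m, J m (X i ^+ m).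
  by have [_ [m]] := gX i; rewrite mul1n => jm; exists m.
exists (\sum_i (m i))%N => k h Nk; apply: homog_ind => // u uk.
have [i hi] : exists i, (m i <= u i)%N.
  apply: contrapT => /forallNP h'; move: Nk; rewrite -uk mdegE leqNgt => /negP; apply.
  have lt i : (u i < m i)%N by rewrite ltnNge; apply/negP.
  rewrite (bigD1 ord0) //= [in ltnRHS](bigD1 ord0) //= -addSn leq_add ?lt //.
  by apply: leq_sum => i _; apply: ltnW.
have e : u = (u - U_(i) *+ m i + U_(i) *+ m i)%MM.
  rewrite submK //; apply/mnm_lepP => j; rewrite mulmnE mnm1E.
  by case: eqP => [<-|_]; rewrite ?mul1n.
rewrite {1}e mpolyXD -mpolyXn.
have -> : k = (mdeg (u - U_(i) *+ m i) + m i)%N.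
  by rewrite -uk {1}e mdegD mdegMn mdeg1 mul1n.
by apply: Jm => //; rewrite dhomogX.
Qed.

End Radical.

(** Modulo [J] every variable is a multiple of [y], so a form is its value at [a] times a power of
    [y]. This serves for radicals and for the colon ideals of [colon_gideal]. *)
Lemma gideal_eval J (a : 'I_3 -> K) (y : S) : gideal J -> y \is 1.-homog ->
  (forall i, J 1%N (X i - a i *: y)) ->
  forall k h, h \is k.-homog -> J k (h - h.@[a] *: y ^+ k).
Proof.
move=> [Jh Js Jm] hy hX k h hh.
pose P k x := J k (x - x.@[a] *: y ^+ k).
have PM j j' x z : x \is j.-homog -> z \is j'.-homog -> P j x -> P j' z -> P (j + j')%N (x * z).
  move=> hx hz px pz; rewrite /P mevalM exprD.
  have -> : x * z - (x.@[a] * z.@[a]) *: (y ^+ j * y ^+ j') =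
    x * (z - z.@[a] *: y ^+ j') + (z.@[a] *: y ^+ j') * (x - x.@[a] *: y ^+ j).
    by rewrite -!mul_mpolyC mpolyCM; ring.
  apply: subspaceD => //; first exact: Jm.
  rewrite addnC; apply: Jm => //; apply: dhomogZ.
  by rewrite -[j' in j'.-homog]mul1n; apply: dhomogMn.
suff hm (m : 'X_{1..3}) : P (mdeg m) 'X_[m].
  move: h hh; apply: homog_ind => [|m <-]; last exact: hm.
  split=> [|c x z px pz]; first by rewrite /P meval0 scale0r subr0; case: (Js k).
  rewrite /P mevalD mevalZ.
  have -> : c *: x + z - (c * x.@[a] + z.@[a]) *: y ^+ k =
     c *: (x - x.@[a] *: y ^+ k) + (z - z.@[a] *: y ^+ k).
    by rewrite scalerDl scalerBr scalerA opprD addrACA.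
  by case: (Js k) => _; apply.
have PX i n : P n (X i ^+ n).
  elim: n => [|n ih]; first by rewrite /P meval1 expr0 scale1r subrr; case: (Js 0%N).
  rewrite -[n.+1]add1n exprD expr1; apply: PM => //; first exact: homogX.
    by rewrite -[n in n.-homog]mul1n; apply: dhomogMn; apply: homogX.
  by rewrite /P mevalXU expr1.
have Xn i n : X i ^+ n \is n.-homog.
  by rewrite -[n in n.-homog]mul1n; apply: dhomogMn; apply: homogX.
suff [] : ('X_[m] : S) \is (mdeg m).-homog /\ P (mdeg m) 'X_[m] by [].
rewrite mpolyXE_id mdegE; elim/big_rec2: _ => [|i n x _ [hx px]].
  split; first exact: dhomog1.
  by rewrite /P meval1 expr0 scale1r subrr; case: (Js 0%N).
by split; [apply: dhomogM | apply: PM].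
Qed.

(* [S / I] is eventually of constant dimension [D], and multiplication by [l] is
   then an isomorphism between consecutive degrees. *)
Definition stable I l k0 D : Prop :=
  l \is 1.-homog /\ forall k, (k0 <= k)%N ->
    qdim (form k) (I k) D /\
    forall h, h \is k.+1.-homog -> exists2 a, a \is k.-homog & I k.+1 (h - l * a).

Lemma form_codim I k : gideal I -> exists D, qdim (form k) (I k) D.
Proof.
move=> [_ Is _].
have [|D _ hD] := @qdim_quot K S (form k) (I k) (@zeros _) _ (Is k) _ (form_dim K k).
  by move=> x ->; case: (Is k).
by exists D.
Qed.

Lemma gideal_mul1 I k h s : gideal I -> I k h -> s \is 1.-homog -> I k.+1 (s * h).
Proof. by move=> [_ _ Im] ih hs; rewrite -[k.+1]add1n; apply: Im. Qed.

(** Multiplication by [l] maps onto a space of the same finite dimension, hence is injective. *)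
Lemma stable_cancel I l k0 D k h : gideal I -> stable I l k0 D -> (k0 <= k)%N ->
  h \is k.-homog -> I k.+1 (l * h) -> I k h.
Proof.
move=> hI [hl st] kk hh ilh; have [Ih Is Im] := hI.
have [[e [ee se fe]] surj] := st k kk; have [hD _] := st k.+1 (leqW kk).
have lE c : lincomb (fun i => l * e i) c = l * lincomb e c.
  by rewrite /lincomb mulr_sumr; apply: eq_bigr => i _; rewrite scalerAr.
have fle : qfree (I k.+1) (fun i => l * e i).
  apply: (qspan_qfree (Is _) _ hD) => [i|x hx].
    by rewrite /form -[k.+1]add1n; apply: dhomogM => //; apply: ee.
  have [a ha hxa] := surj x hx; have [c qc] := se a ha; exists c.
  rewrite lE -[x](subrK (l * a)) -addrA -mulrBr; apply: subspaceD => //.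
  exact: gideal_mul1.
have [c qc] := se h hh.
have c0 : c = 0.
  apply: fle; rewrite lE.
  have -> : l * lincomb e c = l * h - l * (h - lincomb e c) by rewrite -mulrBr subKr.
  by apply: subspaceB => //; apply: gideal_mul1.
by rewrite c0 lincomb0 subr0 in qc.
Qed.

(** Surjectivity makes the codimensions nonincreasing from [k1] on, so they stay at their minimum
    once it is reached. *)
Lemma stable_of_surjective I l k1 : gideal I -> l \is 1.-homog ->
  (forall k h, (k1 <= k)%N -> h \is k.+1.-homog ->
     exists2 a, a \is k.-homog & I k.+1 (h - l * a)) ->
  exists k0 D, stable I l k0 D.
Proof.
move=> hI hl surj; have [Ih Is Im] := hI.
have /choice [c hc] k : exists D, qdim (form k) (I k) D := form_codim k hI.
have dec k : (k1 <= k)%N -> (c k.+1 <= c k)%N.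
  move=> kk; have [e [ee se fe]] := hc k.
  have [|a ac ha] := @qspan_sub K S (form k.+1) (form k.+1) (I k.+1) _ (fun i => l * e i) (Is _) (fun _ => id).
    move=> x hx; have [a ha hxa] := surj k x kk hx; have [d qd] := se a ha; exists d.
    have -> : lincomb (fun i => l * e i) d = l * lincomb e d.
      by rewrite /lincomb mulr_sumr; apply: eq_bigr => i _; rewrite scalerAr.
    rewrite -[x](subrK (l * a)) -addrA -mulrBr; apply: subspaceD => //.
    exact: gideal_mul1.
  by rewrite (qdim_uniq (Is _) (hc _) ha).
have mono k k' : (k1 <= k)%N -> (k <= k')%N -> (c k' <= c k)%N.
  move=> kk /subnK <-; elim: (k' - k)%N => [|j ih] //.
  by apply: leq_trans (dec _ _) ih; rewrite ?addSn //; lia.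
pose B D := `[< exists2 k, (k1 <= k)%N & c k = D >].
have exB : exists D, B D by exists (c k1); apply/asboolP; exists k1.
case: (ex_minnP exB) => D /asboolP [k0 k10 ck0] minD.
exists k0, D; split=> // k kk; split; last by move=> h; apply: surj; apply: leq_trans kk.
have -> : D = c k by apply/eqP; rewrite eqn_leq -{2}ck0 mono // andbT; apply: minD;
  apply/asboolP; exists k => //; apply: leq_trans kk.
exact: hc.
Qed.

(** The ideal [J + (l)]. Homogeneity is asked of [l * a] rather than of [a], so that the degree of
    [l] does not appear; the same definition later adjoins a form [h] of any degree. *)
Definition sum_linear J l k h : Prop :=
  exists g a, [/\ J k g, l * a \is k.-homog & h = g + l * a].

Lemma sum_linear_gideal J l : gideal J -> gideal (sum_linear J l).
Proof.
move=> [Jh Js Jm]; split.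
- by move=> k _ [g [a [jg ha ->]]]; apply: dhomogD => //; apply: Jh.
- move=> k; split; first by exists 0, 0; rewrite mulr0 addr0; split; [case: (Js k)|exact: dhomog0|].
  move=> c _ _ [g [a [jg ha ->]]] [g' [a' [jg' ha' ->]]].
  exists (c *: g + g'), (c *: a + a'); split; first by case: (Js k) => _; apply.
    by rewrite mulrDr -scalerAr; apply: dhomogD => //; apply: dhomogZ.
  by rewrite mulrDr -scalerAr scalerDr addrACA.
- move=> k j _ s [g [a [jg ha ->]]] hs; exists (s * g), (s * a); split.
  + exact: Jm.
  + by rewrite mulrCA; apply: dhomogM.
  + by rewrite mulrDr mulrCA.
Qed.

Lemma linear_point (p : 'I_3 -> K) i : X i - p i *: X ord0 \is 1.-homog.
Proof. by apply: dhomogD; rewrite ?dhomogN ?dhomogZ //; apply: homogX. Qed.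

Definition o1 : 'I_3 := lift ord0 ord0.
Definition o2 : 'I_3 := ord_max.

Lemma ord3P (P : 'I_3 -> Prop) : P ord0 -> P o1 -> P o2 -> forall i, P i.
Proof.
move=> h0 h1 h2 [[|[|[|//]]] hi].
- by rewrite (_ : Ordinal hi = ord0) //; apply: val_inj.
- by rewrite (_ : Ordinal hi = o1) //; apply: val_inj.
- by rewrite (_ : Ordinal hi = o2) //; apply: val_inj.
Qed.

(** It suffices that [I + (l)] contains all forms of large degree. In the pencil of lines through a
    point [p] with [g1(p) <> 0], some product of [n] lines lies in [I], by counting; a member [l] of
    the pencil other than these makes [mu], then [lam], nilpotent modulo [I + (l)]. In the radical
    the variables become multiples of [X_0], and [g1] becomes [g1(p) X_0^e1], so [X_0] is nilpotent
    too. *)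
Theorem stable_exists I e1 e2 g1 g2 : gideal I -> I e1 g1 -> I e2 g2 ->
  g1 != 0 -> g2 != 0 -> regular g1 g2 -> exists l k0 D, stable I l k0 D.
Proof.
move=> hI I1 I2 g10 g20 reg; have [Ih Is Im] := hI.
have h1 := Ih _ _ I1; have h2 := Ih _ _ I2.
(* In this degree [(g1, g2)] has codimension [e1 e2], which is less than the number [n + 1] of
   products [E a]. *)
pose n := (e1 * e2 + e1 + e2)%N.
have [D Dle hD] : exists2 D, (D <= e1 * e2)%N & qdim (form n) (I n) D.
  have h := combinations_dim (e1 * e2) g10 g20 h1 h2 reg.
  apply: (qdim_quot (Is _) _ h) => x [a [b [ha hb ->]]]; apply: subspaceD => //.
    by rewrite /n addnAC; apply: Im.
  exact: Im.
have [v hv] : exists v, (g1 * X ord0).@[v] != 0.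
  by apply: mpoly_nonvanishing; rewrite mulf_neq0 // mpolyXU_neq0.
rewrite mevalM mevalXU mulf_eq0 negb_or in hv; have [gv v0] := andP hv.
pose p i := v i / v ord0.
have p0 : p ord0 = 1 by rewrite /p divff.
have gp : g1.@[p] != 0.
  apply: contra_neq gv => gp.
  rewrite (meval_eq _ (v2 := fun i => v ord0 * p i)); last by move=> i; rewrite /p mulrC divfK.
  by rewrite (meval_homog _ _ h1) gp mulr0.
pose lam := X o1 - p o1 *: X ord0; pose mu := X o2 - p o2 *: X ord0.
have hlam : lam \is 1.-homog := linear_point p o1.
have hmu : mu \is 1.-homog := linear_point p o2.
have hX1 (y : S) j : y \is 1.-homog -> y ^+ j \is j.-homog.
  by move=> hy; rewrite -[j in j.-homog]mul1n; apply: dhomogMn.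
pose E (a : 'I_n.+1) := lam ^+ a * mu ^+ (n - a).
have hE a : form n (E a).
  rewrite /form /E -[n in n.-homog](subnKC (leq_ord a)).
  by apply: dhomogM; apply: hX1.
have [c qc c0] : exists2 c, I n (lincomb E c) & c != 0.
  apply: contrapT => nc.
  have fE : qfree (I n) E.
    by move=> c qc; apply/eqP/negPn/negP => c0; apply: nc; exists c.
  have [b [bb sb _]] := hD.
  have := qfree_leq_qspan (Is n) hE sb fE; rewrite leqNgt => /negP; apply.
  by rewrite ltnS (leq_trans Dle) // /n -addnA leq_addr.
pose C := \poly_(a < n.+1) c 0 (inord a).
have C0 : C != 0.
  apply: contra_neq c0 => C0; apply/rowP => a; rewrite mxE.
  by have /polyP/(_ a) := C0; rewrite coef_poly ltn_ord coef0 inord_val.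
have [t Ct] := poly_nonroot C0.
pose l := lam - t *: mu.
have hl : l \is 1.-homog by apply: dhomogD; rewrite // dhomogN dhomogZ.
have l0 : l != 0.
  apply/eqP => /(congr1 (fun q : S => q@_U_(o1))).
  rewrite mcoeff0 !(mcoeffB, mcoeffZ, mcoeffX) !eqxx !eq_mnm1 /=.
  by rewrite !(mulr0, subr0) => /eqP; rewrite oner_eq0.
pose J := sum_linear I l; have hJ : gideal J := sum_linear_gideal l hI.
have [Jh Js Jm] := hJ.
have IJ k x : I k x -> J k x.
  by move=> ix; exists x, 0; rewrite mulr0 addr0; split=> //; apply: dhomog0.
have lJ : J 1%N l.
  exists 0, 1; rewrite mulr1 add0r; split=> //; by case: (Is 1%N).
(* Modulo [l], [lam] equals [t mu], so the combination of the [E a] with coefficients [c] becomes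
   [C(t) mu^n]. *)
have muJ : J n (mu ^+ n).
  have hEt a : J n (E a - (t ^+ a) *: mu ^+ n).
    have -> : E a - t ^+ a *: mu ^+ n = (lam ^+ a - (t *: mu) ^+ a) * mu ^+ (n - a).
      by rewrite mulrBl exprZn -scalerAl -exprD subnKC // leq_ord.
    exists 0, ((\sum_(j < a) lam ^+ (a.-1 - j) * (t *: mu) ^+ j) * mu ^+ (n - a)).
    rewrite mulrA -subrXX add0r; split=> //; first by case: (Is n).
    rewrite mulrBl; apply: dhomogD; first exact: hE.
    rewrite dhomogN exprZn -scalerAl; apply: dhomogZ.
    by rewrite -exprD subnKC ?leq_ord //; apply: hX1.
  have -> : mu ^+ n = C.[t]^-1 *: (lincomb E c - \sum_a c 0 a *: (E a - t ^+ a *: mu ^+ n)).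
    rewrite -sumrB (eq_bigr (fun a : 'I_n.+1 => (c 0 a * t ^+ a) *: mu ^+ n)); last first.
      by move=> a _; rewrite -scalerBr subKr scalerA.
    rewrite -scaler_suml scalerA (_ : \sum_a _ = C.[t]) ?mulVf ?scale1r //.
    by rewrite /C horner_poly; apply: eq_bigr => a _; rewrite inord_val.
  apply: subspaceZ => //; apply: subspaceB => //; first exact: IJ.
  by apply: subspace_sum => // a _; apply: subspaceZ.
have hG := grad_gideal hJ; have [Gh Gs Gm] := hG.
have muG : grad J 1%N mu by split=> //; exists n; rewrite mul1n.
have lamG : grad J 1%N lam.
  rewrite -[lam](subrK (t *: mu)); apply: subspaceD => //; last exact: subspaceZ.
  exact: sub_grad.
have pG i : grad J 1%N (X i - p i *: X ord0).
  by elim/ord3P: i => //; rewrite p0 scale1r subrr; case: (Gs 1%N).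
have X0G : grad J 1%N (X ord0).
  have := gideal_eval hG (homogX ord0) pG h1 => gq.
  have {}gq : grad J e1 (X ord0 ^+ e1).
    have -> : X ord0 ^+ e1 = g1.@[p]^-1 *: (g1 - (g1 - g1.@[p] *: X ord0 ^+ e1)).
      by rewrite subKr scalerA mulVf // scale1r.
    apply: subspaceZ => //; apply: subspaceB => //.
    by apply: sub_grad => //; apply: IJ.
  apply: (grad_of_exp (m := e1.+1)); first exact: homogX.
  by rewrite mul1n -[e1.+1]add1n exprD expr1; apply: Gm => //; apply: homogX.
have XG i : grad J 1%N (X i).
  rewrite -[X i](subrK (p i *: X ord0)); apply: subspaceD => //.
  exact: subspaceZ.
have [N hN] := grad_variables hJ XG.
exists l; apply: (@stable_of_surjective I l N hI hl) => k h Nk hh.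
have [g [a [ig hla e]]] := hN _ _ (leqW Nk) hh.
exists a; last by rewrite e addrK.
by apply: (homog_divl l0 hl); rewrite mulrC addn1.
Qed.

Lemma common_eigenvector_family D (A : 'I_3 -> 'M[K]_D) : (0 < D)%N ->
  (forall i j, A i *m A j = A j *m A i) ->
  exists2 v : 'rV_D, v != 0 & exists a : 'I_3 -> K, forall i, v *m A i = a i *: v.
Proof.
move=> D0 AC.
have [|v v0 /allP hv] := @spectral.common_eigenvector K D [seq A i | i <- enum 'I_3] D0.
  by move=> _ _ /mapP [i _ ->] /mapP [j _ ->]; apply: AC.
exists v => //; have /choice [a ha] i : exists a, v *m A i = a *: v.
  have : stablemx v (A i) by apply: hv; apply: map_f; rewrite mem_enum.
  by move=> /sub_rVP [a ->]; exists a.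
by exists a.
Qed.

Lemma colon_gideal I N h : gideal I -> h \is N.-homog ->
  gideal (fun k x => x \is k.-homog /\ I (k + N)%N (x * h)).
Proof.
move=> [Ih Is Im] hh; split=> [k x [] //|k|k j x s [hx ix] hs].
  split=> [|c x y [hx ix] [hy iy]].
    by split; [exact: dhomog0 | rewrite mul0r; case: (Is (k + N)%N)].
  split; first by apply: dhomogD => //; apply: dhomogZ.
  by rewrite mulrDl -scalerAl; case: (Is (k + N)%N) => _; apply.
by split; [exact: dhomogM | rewrite -mulrA -addnA; apply: Im].
Qed.

(** In degree [k0] the quotient has dimension [D > 0], and the [X_i / l] act on it by commuting
    matrices; [h] is a common eigenvector, and [a] collects the eigenvalues. These relations,
    applied to [l] itself, say that [l h] equals [l(a) l h] modulo [I], which forces [l(a) = 1]. *)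
Theorem nullstellensatz I l k0 D : gideal I -> stable I l k0 D -> (0 < D)%N ->
  exists h (a : 'I_3 -> K), [/\ h \is k0.-homog, ~ I k0 h, l.@[a] = 1 &
    forall i, I k0.+1 (X i * h - a i *: (l * h))].
Proof.
move=> hI st D0; have [Ih Is Im] := hI; have [hl st'] := st.
have [[e [ee se fe]] _] := st' k0 (leqnn _).
have [_ surj] := st' k0 (leqnn _).
have /choice [A hA] : forall i : 'I_3, exists A : 'M[K]_D,
    forall j, I k0.+1 (X i * e j - l * lincomb e (row j A)).
  move=> i; have /choice [B hB] j : exists b : 'rV[K]_D, I k0.+1 (X i * e j - l * lincomb e b).
    have [|a ha ia] := surj (X i * e j).
      by apply: homog_mul1; [exact: homogX | exact: ee].
    have [b qb] := se a ha; exists b.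
    rewrite -[_ * e j](subrK (l * a)) -addrA -mulrBr; apply: subspaceD => //.
    exact: gideal_mul1.
  by exists (\matrix_j B j) => j; rewrite rowK.
have lincomb_form c : lincomb e c \is k0.-homog.
  exact: (subspace_lincomb c (@form_subspace 3 K k0) ee).
have hAc i c : I k0.+1 (X i * lincomb e c - l * lincomb e (c *m A i)).
  rewrite lincomb_mul /lincomb !mulr_sumr -sumrB; apply: subspace_sum => // j _.
  by rewrite -!scalerAr -scalerBr; apply: subspaceZ.
have lfree c : I k0.+1 (l * lincomb e c) -> c = 0.
  by move=> h; apply: (fe c); apply: (stable_cancel hI st (leqnn _) (lincomb_form c) h).
have AC i j : A i *m A j = A j *m A i.
  apply/row_matrixP => r; rewrite !rowE; set d := delta_mx 0 r.
  apply/eqP; rewrite -subr_eq0; apply/eqP; apply: lfree.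
  (* Commutation is tested after multiplying by [l] twice, where both products become [X_i X_j]
     applied to a basis vector. *)
  apply: (stable_cancel hI st (leqnSn k0)); first exact: homog_mul1.
  have key i' j' : I k0.+2 (X j' * (X i' * lincomb e d) - l * (l * lincomb e (d *m (A i' *m A j')))).
    have := subspaceD (Is _) (gideal_mul1 hI (hAc i' d) (homogX j'))
                             (gideal_mul1 hI (hAc j' (d *m A i')) hl).
    by rewrite mulmxA; congr (I _ _); ring.
  have := subspaceB (Is _) (key j i) (key i j); rewrite lincombB.
  by congr (I _ _); ring.
have [v v0 [a va]] := common_eigenvector_family D0 AC.
pose h := lincomb e v; have hh : h \is k0.-homog := lincomb_form v.
have nh : ~ I k0 h by move=> ih; move: v0; rewrite (fe _ ih) eqxx.
have ha i : I k0.+1 (X i * h - a i *: (l * h)).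
  by have := hAc i v; rewrite va lincombZ scalerAr.
exists h, a; split=> //; apply/eqP; rewrite eq_sym -subr_eq0; apply/negPn/negP => la.
have hX i : X i - a i *: l \is 1.-homog /\ I (1 + k0)%N ((X i - a i *: l) * h).
  split; last by rewrite mulrBl -scalerAl add1n; apply: ha.
  by apply: dhomogD; rewrite ?dhomogN ?dhomogZ //; apply: homogX.
have [_] := gideal_eval (colon_gideal hI hh) hl hX hl.
rewrite expr1 add1n => ilh; apply: nh; apply: (stable_cancel hI st) => //.
have -> : l * h = (1 - l.@[a])^-1 *: ((l - l.@[a] *: l) * h).
  by rewrite mulrBl -scalerAl -{2}[l * h]scale1r -scalerBl scalerA mulVf ?scale1r.
exact: subspaceZ.
Qed.

End GradedIdeals.

(** * Local rings of points of the plane *)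

Section LocalRing.
Variable K : numClosedFieldType.
Local Notation S := {mpoly K[3]}.
Local Notation T := {mpoly K[2]}.
Local Notation L := {fraction T}.
Local Notation X i := ('X_i : S).
Local Notation o := (fun=> 0 : K).

(** A copy of the fraction field that carries a [K]-vector space structure, so that [qdim] applies
    to local rings. *)
Definition frac_module : Type := {fraction {mpoly K[2]}}.
HB.instance Definition _ := GRing.Zmodule.on frac_module.

Definition frac_scale (c : K) (q : frac_module) : frac_module :=
  (tofrac (c%:MP : T) : L) * (q : L).

Fact frac_scaleA a b v : frac_scale a (frac_scale b v) = frac_scale (a * b) v.
Proof. by rewrite /frac_scale mpolyCM tofracM mulrA. Qed.
Fact frac_scale1 : left_id 1 frac_scale.
Proof. by move=> v; rewrite /frac_scale mpolyC1 tofrac1 mul1r. Qed.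
Fact frac_scaleDr : right_distributive frac_scale +%R.
Proof. by move=> a u v; rewrite /frac_scale; exact: mulrDr. Qed.
Fact frac_scaleDl v : {morph frac_scale^~ v : a b / a + b}.
Proof. by move=> a b; rewrite /frac_scale mpolyCD tofracD; exact: mulrDl. Qed.
HB.instance Definition _ := GRing.Zmodule_isLmodule.Build K frac_module
  frac_scaleA frac_scale1 frac_scaleDr frac_scaleDl.

Local Notation O := (@local_ring K : frac_module -> Prop).

Lemma tofrac_neq0 (s : T) : s.@[o] != 0 -> tofrac s != 0 :> L.
Proof. by apply: contraNneq => /eqP; rewrite tofrac_eq0 => /eqP ->; rewrite meval0. Qed.

Lemma local_ring_tofrac (h : T) : local_ring (tofrac h).
Proof. by exists h, 1; rewrite meval1 oner_neq0 tofrac1 divr1. Qed.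

Lemma local_ringM (a b : L) : local_ring a -> local_ring b -> local_ring (a * b).
Proof.
move=> [h [s [s0 ->]]] [h' [s' [s0' ->]]]; exists (h * h'), (s * s').
by rewrite mevalM mulf_neq0 // !tofracM invfM mulrACA.
Qed.

Lemma local_ringD (a b : L) : local_ring a -> local_ring b -> local_ring (a + b).
Proof.
move=> [h [s [s0 ->]]] [h' [s' [s0' ->]]]; exists (h * s' + h' * s), (s * s').
rewrite mevalM mulf_neq0 // tofracD !tofracM; split=> //.
by rewrite addf_div // tofrac_neq0.
Qed.

Lemma local_ringV (s : T) : s.@[o] != 0 -> local_ring (tofrac s)^-1.
Proof. by move=> s0; exists 1, s; rewrite s0 tofrac1 mul1r. Qed.

Lemma local_ring_subspace : subspace O.
Proof.
split=> [|c x y hx hy]; first by rewrite -tofrac0; apply: local_ring_tofrac.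
by apply: local_ringD => //; apply: local_ringM => //; apply: local_ring_tofrac.
Qed.

Section Point.
Variable p : P2 K.
Local Notation i0 := (chart p).

Definition loc (g : S) : T := local_equation g p.

Lemma locD g h : loc (g + h) = loc g + loc h.
Proof. exact: comp_mpolyD. Qed.
Lemma locM g h : loc (g * h) = loc g * loc h.
Proof. exact: rmorphM. Qed.
Lemma locZ c g : loc (c *: g) = c *: loc g.
Proof. exact: comp_mpolyZ. Qed.
Lemma loc1 : loc 1 = 1.
Proof. exact: comp_mpoly1. Qed.
Lemma locB g h : loc (g - h) = loc g - loc h.
Proof. exact: comp_mpolyB. Qed.
Lemma loc0 : loc 0 = 0.
Proof. exact: comp_mpoly0. Qed.
Lemma loc_sum (I : Type) (r : seq I) (F : I -> S) :
  loc (\sum_(i <- r) F i) = \sum_(i <- r) loc (F i).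
Proof. exact: (big_morph _ locD loc0). Qed.

Lemma locX k : loc (X k) =
  (coords p k)%:MP + (if unlift i0 k is Some j then 'X_j else 0).
Proof. by rewrite /loc /local_equation comp_mpolyXU -tnth_nth tnth_mktuple. Qed.

Lemma locX_chart : loc (X i0) = (coords p i0)%:MP.
Proof. by rewrite locX unlift_none addr0. Qed.

Lemma locX_lift j : loc (X (lift i0 j)) = (coords p (lift i0 j))%:MP + 'X_j.
Proof. by rewrite locX liftK. Qed.

Lemma meval_loc (w : 'I_2 -> K) g : (loc g).@[w] =
  g.@[fun k => coords p k + (if unlift i0 k is Some j then w j else 0)].
Proof.
rewrite /loc /local_equation comp_mpoly_meval; apply: meval_eq => k.
rewrite tnth_mktuple mevalD mevalC; congr (_ + _).
by case: unlift => [j|]; rewrite ?mevalXU ?meval0.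
Qed.

Lemma meval0_loc g : (loc g).@[o] = g.@[coords p].
Proof.
by rewrite meval_loc; apply: meval_eq => k; case: unlift => [j|]; rewrite addr0.
Qed.

(* Homogenization: the form of degree [M] that restricts to [s] in the chart;
   [y] restricts to 1 and [w j] to the local coordinate [X_j]. *)
Let y : S := (coords p i0)^-1 *: X i0.
Let w (j : 'I_2) : S := X (lift i0 j) - coords p (lift i0 j) *: y.

Definition homogenize M (s : T) : S :=
  \sum_(m <- msupp s) s@_m *: (y ^+ (M - mdeg m) * \prod_j w j ^+ m j).

Lemma hy : y \is 1.-homog. Proof. by apply: dhomogZ; apply: homogX. Qed.
Lemma hw j : w j \is 1.-homog.
Proof.
apply: dhomogD; first exact: homogX.
by rewrite dhomogN; apply: dhomogZ; exact: hy.
Qed.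

Lemma homogX_exp (z : S) n : z \is 1.-homog -> z ^+ n \is n.-homog.
Proof. by move=> hz; rewrite -[n in n.-homog]mul1n; apply: dhomogMn. Qed.

Lemma homogenize_homog M s : (msize s <= M.+1)%N -> homogenize M s \is M.-homog.
Proof.
move=> sM; rewrite /homogenize big_seq; apply: rpred_sum => m ms; apply: dhomogZ.
have mM : (mdeg m <= M)%N by rewrite -ltnS; apply: leq_trans (msize_mdeg_lt ms) sM.
rewrite -{2}(subnK mM); apply: dhomogM; first exact/homogX_exp/hy.
rewrite mdegE; elim/big_rec2: _ => [|j n x _ hx]; first exact: dhomog1.
by apply: dhomogM => //; exact/homogX_exp/hw.
Qed.

Lemma meval_homogenize M s (v : 'I_3 -> K) : (msize s <= M.+1)%N -> v i0 != 0 ->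
  (homogenize M s).@[v] = y.@[v] ^+ M * s.@[fun j => (w j).@[v] / y.@[v]].
Proof.
move=> sM v0; have y0 : y.@[v] != 0.
  by rewrite /y mevalZ mevalXU mulf_neq0 // invr_neq0 // chart_neq0.
rewrite /homogenize raddf_sum /= (mevalE _ s) mulr_sumr big_seq [RHS]big_seq.
apply: eq_bigr => m ms.
have mM : (mdeg m <= M)%N by rewrite -ltnS; apply: leq_trans (msize_mdeg_lt ms) sM.
rewrite mevalZ mevalM [RHS]mulrCA; congr (_ * _).
under [in RHS]eq_bigr do rewrite exprMn.
rewrite big_split /= prodrXr -mdegE exprVn.
rewrite rmorph_prod rmorphXn /=; under eq_bigr do rewrite rmorphXn /=.
have -> : y.@[v] ^+ M = y.@[v] ^+ (M - mdeg m) * y.@[v] ^+ mdeg m.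
  by rewrite -exprD subnK.
by rewrite -mulrA; congr (_ * _); rewrite mulrCA divff ?mulr1 ?expf_neq0.
Qed.

Lemma meval_homogenize_point M s : (msize s <= M.+1)%N ->
  (homogenize M s).@[coords p] = s.@[o].
Proof.
move=> sM; have y1 : y.@[coords p] = 1.
  by rewrite /y mevalZ mevalXU mulVf // chart_neq0.
rewrite meval_homogenize ?chart_neq0 // y1 expr1n mul1r; apply: meval_eq => j.
by rewrite /w mevalB mevalZ mevalXU y1 mulr1 subrr mul0r.
Qed.

Lemma meval_loc_form g k (v : 'I_3 -> K) : g \is k.-homog -> v i0 != 0 ->
  y.@[v] ^+ k * (loc g).@[fun j => (w j).@[v] / y.@[v]] = g.@[v].
Proof.
move=> hg v0; have y0 : y.@[v] != 0.
  by rewrite /y mevalZ mevalXU mulf_neq0 // invr_neq0 // chart_neq0.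
rewrite meval_loc -(meval_homog _ _ hg); apply: meval_eq => j.
case: (unliftP i0 j) => [j' ->|->]; rewrite ?addr0.
  have -> : (w j').@[v] = v (lift i0 j') - coords p (lift i0 j') * y.@[v].
    by rewrite /w mevalB mevalXU; congr (_ - _); apply: mevalZ.
  by move: (y.@[v]) y0 => Y Y0; field.
by rewrite /y mevalZ mevalXU mulrC mulVKf // chart_neq0.
Qed.

(** [K] being infinite, polynomials can be compared by their values off the line at infinity of the
    chart; identities between homogenizations thereby reduce to evaluations. *)
Lemma eq_in_chart (g h : S) : (forall v : 'I_3 -> K, v i0 != 0 -> g.@[v] = h.@[v]) -> g = h.
Proof.
move=> e; apply/eqP; rewrite -subr_eq0; apply/negPn/negP => gh.
have [v] : exists v, (X i0 * (g - h)).@[v] != 0.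
  by apply: mpoly_nonvanishing; rewrite mulf_neq0 // mpolyXU_neq0.
rewrite mevalM mevalXU mulf_eq0 negb_or => /andP [v0].
by rewrite mevalB e // subrr eqxx.
Qed.

(** The extension of the homogeneous ideal to the local ring at [p]. Generators of different degrees
    may be mixed, since dehomogenization forgets the degree. *)
Definition ext (I : nat -> S -> Prop) : frac_module -> Prop := fun q =>
  exists2 s : seq (L * S), forall x, x \in s -> local_ring x.1 /\ exists k, I k x.2 &
    (q : L) = \sum_(x <- s) x.1 * tofrac (loc x.2).

Section Ext.
Variable I : nat -> S -> Prop.
Hypothesis hI : gideal I.

Lemma ext_gen k g : I k g -> ext I (tofrac (loc g)).
Proof.
move=> ig; exists [:: (1, g)]; last by rewrite big_seq1 mul1r.
by move=> x; rewrite inE => /eqP ->; split; [rewrite -tofrac1; apply: local_ring_tofrac | exists k].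
Qed.

Lemma extD (a b : L) : ext I a -> ext I b -> ext I (a + b).
Proof.
move=> [s hs ->] [t ht ->]; exists (s ++ t); last by rewrite big_cat.
by move=> x; rewrite mem_cat => /orP [/hs|/ht].
Qed.

Lemma extM (a b : L) : local_ring a -> ext I b -> ext I (a * b).
Proof.
move=> ha [s hs ->]; exists [seq (a * x.1, x.2) | x <- s].
  by move=> _ /mapP [x /hs [hx ik] ->] /=; split=> //; apply: local_ringM.
by rewrite big_map mulr_sumr; apply: eq_bigr => x _ /=; rewrite mulrA.
Qed.

Lemma ext0 : ext I 0.
Proof. by exists [::]; rewrite ?big_nil. Qed.

Lemma ext_subspace : subspace (ext I).
Proof.
split; first exact: ext0.
by move=> c x z hx hz; apply: extD => //; apply: extM => //; apply: local_ring_tofrac.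
Qed.

Lemma ext_local q : ext I q -> local_ring q.
Proof.
move=> [s hs ->]; rewrite big_seq; elim/big_rec: _ => [|x z xs hz].
  by rewrite -tofrac0; apply: local_ring_tofrac.
apply: local_ringD => //; apply: local_ringM; last exact: local_ring_tofrac.
by case: (hs x xs).
Qed.

Lemma ext_clear_denominators (q : L) : ext I q -> exists (d : T) (s : seq (T * S)),
  [/\ d.@[o] != 0, forall x, x \in s -> exists k, I k x.2 &
      tofrac d * q = tofrac (\sum_(x <- s) x.1 * loc x.2)].
Proof.
move=> [s hs ->]; elim: s hs => [|[a g] s ih] hs.
  by exists 1, [::]; rewrite meval1 oner_neq0 !big_nil tofrac0 mulr0.
have [d [t [d0 ht et]]] : exists (d : T) (t : seq (T * S)),
  [/\ d.@[o] != 0, forall x, x \in t -> exists k, I k x.2 &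
      tofrac d * (\sum_(x <- s) x.1 * tofrac (loc x.2)) =
      tofrac (\sum_(x <- t) x.1 * loc x.2) :> L].
  by apply: ih => x xs; apply: hs; rewrite in_cons xs orbT.
have [[h [b [b0 /= ea]]] [k /= ig]] := hs (a, g) (mem_head _ _).
exists (d * b), ((d * h, g) :: [seq (b * x.1, x.2) | x <- t]).
split.
- by rewrite mevalM mulf_neq0.
- move=> x; rewrite in_cons => /orP [/eqP -> /=|/mapP [z zt ->]]; first by exists k.
  exact: (ht z zt).
rewrite !big_cons big_map mulrDr tofracD [in RHS]tofracM; congr (_ + _).
  rewrite /= ea !tofracM !mulrA; congr (_ * _).
  by rewrite -!mulrA; congr (_ * _); rewrite mulrCA divff ?mulr1 // tofrac_neq0.
rewrite tofracM [_ * tofrac b]mulrC -mulrA et -tofracM mulr_sumr.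
by congr tofrac; apply: eq_bigr => x _ /=; rewrite mulrA.
Qed.

(** Denominators are cleared and the resulting identity is homogenized: locally at [p], membership
    in the ideal means membership after multiplication by a form that does not vanish at [p]. *)
Lemma ext_form h N : h \is N.-homog -> ext I (tofrac (loc h)) ->
  exists m t, [/\ t \is m.-homog, t.@[coords p] != 0 & I (m + N)%N (t * h)].
Proof.
have [Ih Is Im] := hI.
move=> hh /ext_clear_denominators [d [s [d0 hs e]]].
have {}e : d * loc h = \sum_(x <- s) x.1 * loc x.2.
  by move: e; rewrite -tofracM => /eqP; rewrite tofrac_eq => /eqP.
have [k hk] : exists k : T * S -> nat, forall x, x \in s -> I (k x) x.2.
  have /choice [k hk] : forall x, exists k, x \in s -> I k x.2.
    move=> x; case: (boolP (x \in s)) => [/hs [k ik]|_]; first by exists k.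
    by exists 0%N.
  by exists k.
(* A degree large enough to homogenize the common denominator and all coefficients at once. *)
pose M := (msize d + N + \sum_(x <- s) (k x + msize x.1))%N.
have MN : (N <= M)%N by rewrite /M -addnA addnCA leq_addr.
have dM : (msize d <= (M - N).+1)%N.
  by rewrite leqW // leq_subRL // addnC /M leq_addr.
have xM x : x \in s -> (k x + msize x.1 <= M)%N.
  move=> xs; rewrite /M (big_rem x xs) /= addnCA; exact: leq_addr.
exists (M - N)%N, (homogenize (M - N) d); split.
- exact: homogenize_homog.
- by rewrite meval_homogenize_point.
have -> : homogenize (M - N) d * h = \sum_(x <- s) homogenize (M - k x) x.1 * x.2.
  apply: eq_in_chart => v v0; rewrite mevalM meval_homogenize //.
  rewrite (raddf_sum (meval v)) /= -(meval_loc_form hh v0) mulrACA -exprD subnK //.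
  rewrite -mevalM e raddf_sum /= mulr_sumr big_seq [RHS]big_seq.
  apply: eq_bigr => x xs; have xM' := xM x xs.
  have hx : x.2 \is (k x).-homog by apply: Ih; apply: hk.
  rewrite !mevalM meval_homogenize //; last first.
    by rewrite leqW // leq_subRL ?(leq_trans (leq_addr _ _) xM').
  rewrite -(meval_loc_form hx v0) [RHS]mulrACA -exprD subnK //.
  exact: leq_trans (leq_addr _ _) xM'.
rewrite big_seq; apply: subspace_sum => // x xs; have xM' := xM x xs.
have -> : (M - N + N = M - k x + k x)%N.
  by rewrite !subnK // (leq_trans (leq_addr _ _) xM').
apply: Im; first exact: hk.
by apply: homogenize_homog; rewrite leqW // leq_subRL ?(leq_trans (leq_addr _ _) xM').
Qed.

End Ext.

End Point.

Lemma sub_ext I J p q : (forall k g, I k g -> J k g) -> ext p I q -> ext p J q.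
Proof.
move=> IJ [s hs ->]; exists s => // x /hs [hx [k ik]]; split=> //.
by exists k; apply: IJ.
Qed.

Lemma vanishing_at_origin n (h : {mpoly K[n]}) : h.@[fun=> 0] = 0 ->
  exists c : 'I_n -> {mpoly K[n]}, h = \sum_j c j * 'X_j.
Proof.
move=> h0; suff [c e] : exists c : 'I_n -> {mpoly K[n]}, h - (h.@[fun=> 0])%:MP = \sum_j c j * 'X_j.
  by exists c; rewrite -e h0 mpolyC0 subr0.
elim/mpolyind: h {h0} => [|a m h _ _ [c ih]].
  by exists (fun=> 0); rewrite meval0 subrr big1 // => j _; rewrite mul0r.
case: (eqVneq m 0%MM) => [->|m0].
  exists c; rewrite -ih mpolyX0 mevalD mevalZ meval1 mulr1 mpolyCD.
  by rewrite -mul_mpolyC mulr1 opprD addrACA subrr add0r.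
have [j mj] : exists j, m j != 0%N.
  apply: contrapT => /forallNP nm; case/eqP: m0; apply/mnmP => j; rewrite mnm0E.
  by have /negP/negPn/eqP := nm j.
exists (fun k => c k + (if k == j then a *: 'X_[m - U_(j)] else 0)).
under eq_bigr do rewrite mulrDl.
rewrite big_split /= -ih (bigD1 j) //= eqxx big1 ?addr0; last first.
  by move=> k /negbTE ->; rewrite mul0r.
rewrite -scalerAl -mpolyXD submK ?lep1mP // mevalD mevalZ mevalX (bigD1 j) //=.
by rewrite expr0n (negbTE mj) mul0r mulr0 add0r [RHS]addrC addrA.
Qed.

End LocalRing.

(** * Codimension as a sum of local lengths *)

Section LocalGlobal.
Variable K : numClosedFieldType.
Local Notation S := {mpoly K[3]}.
Local Notation T := {mpoly K[2]}.
Local Notation L := {fraction T}.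
Local Notation X i := ('X_i : S).
Local Notation O := (@local_ring K : frac_module K -> Prop).
Local Notation o := (fun=> 0 : K).

Lemma ext_top p I k : gideal I -> (forall h, h \is k.-homog -> I k h) ->
  forall q, O q -> ext p I q.
Proof.
move=> hI Ik q hq.
have h : I k (X (chart p) ^+ k) by apply: Ik; apply: homogX_exp; apply: homogX.
have := ext_gen p h.
have -> : loc p (X (chart p) ^+ k) = ((coords p (chart p)) ^+ k)%:MP.
  elim: k {h Ik} => [|k ih]; first by rewrite !expr0 loc1.
  by rewrite !exprS locM ih locX_chart mpolyCM.
have c0 : coords p (chart p) ^+ k != 0 by rewrite expf_neq0 // chart_neq0.
move: (coords p (chart p) ^+ k) c0 => c c0 hc.
have -> : q = (q * (tofrac c^-1%:MP : L)) * tofrac c%:MP :> L.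
  by rewrite -mulrA -tofracM -mpolyCM mulVf // tofrac1 mulr1.
apply: extM => //; apply: local_ringM => //; exact: local_ring_tofrac.
Qed.

Lemma eval_comb (c : K) (a b : 'I_3 -> K) i j : (forall k, a k = c * b k) ->
  (a i *: X j - a j *: X i).@[b] = 0.
Proof.
by move=> h; rewrite mevalB !mevalZ !mevalXU !h; ring.
Qed.

Lemma homog_comb (a : 'I_3 -> K) i j : a i *: X j - a j *: X i \is 1.-homog.
Proof. by apply: dhomogD; rewrite ?dhomogN; apply: dhomogZ; apply: homogX. Qed.

(** Modulo [I], a product [s h] equals [s(a) l^j h], so in each degree from [k0] on [h] adds only
    the class of [l^j h], which is nonzero because [l] can be cancelled. *)
Lemma stable_add_socle I l k0 D h (a : 'I_3 -> K) : gideal I -> stable I l k0 D ->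
  h \is k0.-homog -> ~ I k0 h -> l.@[a] = 1 ->
  (forall i, I k0.+1 (X i * h - a i *: (l * h))) ->
  exists2 D', D = D'.+1 & stable (sum_linear I h) l k0 D'.
Proof.
move=> hI st hh nh la ha; have [Ih Is Im] := hI; have [hl st'] := st.
have hI' := sum_linear_gideal h hI; have [Ih' Is' Im'] := hI'.
have II' k x : I k x -> sum_linear I h k x.
  by move=> ix; exists x, 0; rewrite mulr0 addr0; split=> //; apply: dhomog0.
have h0 : h != 0 by apply: contra_notN nh => /eqP ->; case: (Is k0).
have hX i : X i - a i *: l \is 1.-homog /\ I (1 + k0)%N ((X i - a i *: l) * h).
  split; last by rewrite mulrBl -scalerAl add1n; apply: ha.
  by apply: dhomogD; rewrite ?dhomogN ?dhomogZ //; apply: homogX.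
have hs j s : s \is j.-homog -> I (j + k0)%N (s * h - s.@[a] *: (l ^+ j * h)).
  move=> hs; have [_] := gideal_eval (colon_gideal hI hh) hl hX hs.
  by rewrite mulrBl -scalerAl.
have ncl j : ~ I (j + k0)%N (l ^+ j * h).
  elim: j => [|j ih]; first by rewrite expr0 mul1r.
  rewrite addSn exprS -mulrA => /(stable_cancel hI st (leq_addl _ _)) h'.
  by apply/ih/h'; apply: dhomogM => //; apply: homogX_exp.
have one k : (k0 <= k)%N -> qdim (sum_linear I h k) (I k) 1.
  move=> kk; have ek := subnK kk; exists (fun=> l ^+ (k - k0) * h); split.
  - move=> _; exists 0, (l ^+ (k - k0)); rewrite add0r mulrC; split=> //.
      by case: (Is k).
    by rewrite -[k in k.-homog]ek; apply: dhomogM => //; apply: homogX_exp.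
  - move=> x [g [s [ig hsh ->]]].
    have hs' : s \is (k - k0).-homog by apply: (homog_divl h0 hh); rewrite ek mulrC.
    exists (const_mx s.@[a]); rewrite /lincomb big_ord1 mxE -addrA.
    apply: subspaceD => //; rewrite [h * s]mulrC -[k in I k]ek; exact: hs.
  - move=> c; rewrite /lincomb big_ord1 => ic; apply/rowP => i; rewrite ord1 mxE.
    apply/eqP/negPn/negP => c0; apply: (ncl (k - k0)%N); rewrite ek.
    have := subspaceZ (c 0 0)^-1 (Is k) ic.
    by rewrite scalerA mulVf // scale1r.
have dimk k : (k0 <= k)%N -> exists2 D', D = D'.+1 & qdim (form k) (sum_linear I h k) D'.
  move=> kk; have [hD _] := st' k kk.
  have [||||| u [v [hu hv e]]] := @qdim_split _ _ (form k) (sum_linear I h k) (I k) D _ _ _ _ _ hD.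
  - exact: form_subspace.
  - exact: Is'.
  - exact: Is.
  - by move=> x; apply: II'.
  - by move=> x /Ih'.
  by exists v => //; rewrite e (qdim_uniq (Is k) hu (one k kk)).
have [D' eD _] := dimk k0 (leqnn _); exists D' => //; split=> // k kk; split.
  by have [D'' eD'' h''] := dimk k kk; move: eD'' h''; rewrite eD => -[<-].
move=> x hx; have [_ surj] := st' k kk; have [y hy iy] := surj x hx.
by exists y => //; apply: II'.
Qed.

Lemma ext_sum_linear p I h k0 q : gideal I -> h \is k0.-homog -> ext p (sum_linear I h) q ->
  exists q0 a, [/\ ext p I q0, local_ring a & q = q0 + a * tofrac (loc p h) :> L].
Proof.
move=> hI hh [s hs ->] {q}; elim: s hs => [|[b g] s ih] hs.
  exists 0, 0; rewrite big_nil mul0r addr0; split=> //; first exact: ext0.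
  by rewrite -tofrac0; apply: local_ring_tofrac.
have [q0 [a [hq0 ha e]]] : exists (q0 a : L), [/\ ext p I q0, local_ring a &
    \sum_(x <- s) x.1 * tofrac (loc p x.2) = q0 + a * tofrac (loc p h)].
  by apply: ih => x xs; apply: hs; rewrite in_cons xs orbT.
have [/= hb [k [g' [c [ig' hc eg]]]]] := hs (b, g) (mem_head _ _).
exists (b * tofrac (loc p g') + q0), (b * tofrac (loc p c) + a); split.
- apply: extD => //; apply: extM => //; exact: ext_gen ig'.
- apply: local_ringD => //; apply: local_ringM => //; exact: local_ring_tofrac.
rewrite big_cons e /= eg locD locM tofracD tofracM.
by move: (tofrac _) (tofrac _) (tofrac _) => u v w; ring.
Qed.

Lemma local_ring_at_origin (a : L) : local_ring a ->
  exists (c : K) (b : 'I_2 -> L), (forall j, local_ring (b j)) /\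
    a = tofrac c%:MP + \sum_j b j * tofrac 'X_j.
Proof.
move=> [h [s [s0 ->]]]; pose c := h.@[o] / s.@[o].
have [|d ed] := @vanishing_at_origin K 2 (h - c *: s).
  by rewrite mevalB mevalZ /c divfK // subrr.
exists c, (fun j => tofrac (d j) / tofrac s); split.
  move=> j; apply: local_ringM; first exact: local_ring_tofrac.
  exact: local_ringV.
have sn0 := tofrac_neq0 s0.
apply: (mulIf sn0); rewrite divfK // mulrDl mulr_suml.
rewrite (eq_bigr (fun j => tofrac (d j * 'X_j))); last first.
  by move=> j _; rewrite mulrAC divfK // tofracM.
rewrite -(big_morph _ (@tofracD _) (@tofrac0 _)) -ed -tofracM mul_mpolyC -tofracD.
by rewrite addrCA subrr addr0.
Qed.

(* Induction on the length [D]: adding to [I] a form [h] that spans a copy of the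
   coordinate ring of one point [a] lowers [D] by one, lowers the length of the
   local ring at [a] by one, and changes no other local ring. *)
Theorem local_lengths I l k0 D : gideal I -> stable I l k0 D ->
  exists2 pts : seq (P2 K), size pts = D & forall p, qdim O (ext p I) (count_mem p pts).
Proof.
elim: D I => [|D IH] I hI st.
  exists [::] => // p; apply: qdim_eq0; first exact: ext_subspace.
  have [_ st'] := st; have [h0 _] := st' k0 (leqnn _).
  apply: (@ext_top p I k0 hI) => h hh; exact: (qdim0_sub h0 hh).
have [h [a [hh nh la ha]]] := nullstellensatz hI st (ltn0Sn _).
have [D' [eD] st'] := stable_add_socle hI st hh nh la ha; rewrite -eD {D' eD} in st'.
set I' := sum_linear I h in st'.
have hI' : gideal I' := sum_linear_gideal h hI.
have [Ih Is Im] := hI; have [hl _] := st.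
have II' k x : I k x -> I' k x.
  by move=> ix; exists x, 0; rewrite mulr0 addr0; split=> //; apply: dhomog0.
have hX i : X i - a i *: l \is 1.-homog /\ I (1 + k0)%N ((X i - a i *: l) * h).
  split; last by rewrite mulrBl -scalerAl add1n; apply: ha.
  by apply: dhomogD; rewrite ?dhomogN ?dhomogZ //; apply: homogX.
have hs j s : s \is j.-homog -> I (j + k0)%N (s * h - s.@[a] *: (l ^+ j * h)).
  move=> hs; have [_] := gideal_eval (colon_gideal hI hh) hl hX hs.
  by rewrite mulrBl -scalerAl.
have hs0 s : s \is 1.-homog -> s.@[a] = 0 -> I k0.+1 (s * h).
  by move=> h1 s0; have := hs _ _ h1; rewrite s0 scale0r subr0 add1n.
have [i ai] : exists i, a i != 0.
  apply: contrapT => /forallNP na; move/eqP: la; apply/negP.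
  rewrite (meval_eq _ (v2 := o)) ?(meval_homog0 hl) 1?eq_sym ?oner_neq0 // => i.
  by have /negP/negPn/eqP := na i.
have [p [c [c0 ap]]] := P2_exists ai.
have [pts spts hpts] := IH I' hI' st'.
have I'h : ext p I' (tofrac (loc p h)).
  apply: (@ext_gen _ _ I' k0); exists 0, 1; rewrite mulr1 add0r; split=> //.
  by case: (Is k0).
exists (p :: pts); rewrite /= ?spts // => q; case: eqVneq => [<-|pq].
  apply: (@qdim_add _ _ O (ext p I') (ext p I)) => //.
  - exact: local_ring_subspace.
  - exact: ext_subspace.
  - exact: ext_subspace.
  - by move=> x; apply: sub_ext.
  - exact: ext_local.
  (* If a form [t] with [t(p) <> 0] multiplied [h] into [I], so would a power of [l], as [t h]
     equals [t(a) l^m h] modulo [I]; cancelling [l] contradicts [~ I k0 h]. *)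
  have nph : ~ ext p I (tofrac (loc p h)).
    move=> /(ext_form hI hh) [m [t [ht tp ith]]].
    have := subspaceB (Is _) ith (hs _ _ ht); rewrite subKr => ilh.
    have ta : t.@[a] != 0.
      rewrite (meval_eq _ (v2 := fun j => c * coords p j)) //.
      by rewrite (meval_homog _ _ ht) mulf_neq0 // expf_neq0.
    have {}ilh : I (m + k0)%N (l ^+ m * h).
      have := subspaceZ (t.@[a])^-1 (Is _) ilh.
      by rewrite scalerA mulVf // scale1r.
    elim: m {ht ith} ilh => [|m ih]; first by rewrite expr0 mul1r.
    rewrite addSn exprS -mulrA => /(stable_cancel hI st (leq_addl _ _)) h'.
    by apply/ih/h'; apply: dhomogM => //; apply: homogX_exp.
  (* Local coordinates at [p] are restrictions of linear forms vanishing at [a], and these multiply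
     [h] into [I]; hence the class of [h] spans a space of dimension one. *)
  have umh j : ext p I (tofrac 'X_j * tofrac (loc p h) : L).
    pose i0 := chart p; have p0 := chart_neq0 p.
    pose w : S := X (lift i0 j) - (coords p (lift i0 j) / coords p i0) *: X i0.
    have -> : 'X_j = loc p w.
      rewrite /w locB locZ locX_chart locX_lift -mul_mpolyC -mpolyCM divfK //.
      by rewrite [_%:MP + _]addrC addrK.
    rewrite -tofracM -locM; apply: (@ext_gen _ _ _ k0.+1); apply: hs0.
      by apply: dhomogD; rewrite ?dhomogN ?dhomogZ //; apply: homogX.
    rewrite /w mevalB mevalZ !mevalXU !ap mulrCA divfK //; exact: subrr.
  exists (fun=> tofrac (loc p h)); split=> [//|x|d].
    move=> /(ext_sum_linear hI hh) [q0 [b [hq0 hb ex]]].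
    have [e [b' [hb' eb]]] := local_ring_at_origin hb.
    exists (const_mx e); rewrite /lincomb big_ord1 mxE.
    have -> : x - e *: (tofrac (loc p h) : frac_module K) =
      q0 + \sum_j b' j * (tofrac 'X_j * tofrac (loc p h)) :> L.
      rewrite ex eb; rewrite -[e *: _]/(tofrac e%:MP * tofrac (loc p h) : L).
      rewrite mulrDl mulr_suml; under [in RHS]eq_bigr do rewrite mulrA.
      by move: (\sum__ _) => u; ring.
    apply: extD => //; elim/big_ind: _ => [|u v|j _]; first exact: ext0.
      exact: extD.
    by apply: extM; [exact: hb' | exact: umh].
  rewrite /lincomb big_ord1 => hd; apply/rowP => j; rewrite ord1 mxE.
  apply/eqP/negPn/negP => d0; apply: nph.
  have := subspaceZ (d 0 0)^-1 (ext_subspace p I) hd.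
  by rewrite scalerA mulVf // scale1r.
(* At [q] other than [p], a linear form vanishing at [a] but not at [q] multiplies [h] into [I] and
   is a unit, so [h] already lies in the local ideal. *)
rewrite add0n; suff hq : ext q I (tofrac (loc q h)).
  apply: (@qdim_ext _ _ O (ext q I') O (ext q I) _ _ _ (hpts q)) => [x|x]; first by split.
  split; last exact: (@sub_ext K I I' q x II').
  move=> /(ext_sum_linear hI hh) [q0 [b [hq0 hb ->]]].
  by apply: extD; [exact: hq0 | apply: extM; [exact: hb | exact: hq]].
have [s [hs1 sa sq]] : exists s : S, [/\ s \is 1.-homog, s.@[a] = 0 & s.@[coords q] != 0].
  apply: contrapT => ns; case/eqP: pq.
  have e j : a i * coords q j - a j * coords q i = 0.
    apply/eqP/negPn/negP => ne; apply: ns; exists (a i *: X j - a j *: X i).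
    split; first exact: homog_comb.
      by apply: (@eval_comb 1) => k; rewrite mul1r.
    by rewrite mevalB !mevalZ !mevalXU.
  have qi : coords q i != 0.
    apply: contraTneq (chart_neq0 q) => qi; have /eqP := e (chart q).
    by rewrite qi mulr0 subr0 mulf_eq0 (negbTE ai) /= => /eqP ->; rewrite eqxx.
  apply/esym; apply: (@P2_eq _ q p (c * coords q i / a i)) => j.
  have /eqP := e j; rewrite subr_eq0 => /eqP ej.
  by apply: (mulfI ai); rewrite ej ap; field.
have sh : ext q I (tofrac (loc q (s * h))) by apply: (@ext_gen _ _ _ k0.+1); apply: hs0.
have ls0 : (loc q s).@[o] != 0 by rewrite meval0_loc.
have -> : tofrac (loc q h) = (tofrac (loc q s))^-1 * tofrac (loc q (s * h)) :> L.
  by rewrite locM tofracM mulKf // tofrac_neq0.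
by apply: extM => //; apply: local_ringV.
Qed.

End LocalGlobal.

(** * The total Tjurina number *)

Section Derivatives.
Variables (n : nat) (K : numClosedFieldType).
Local Notation S := {mpoly K[n]}.
Implicit Types f g : S.

Lemma mderiv_homog f k i : f \is k.+1.-homog -> f^`M(i) \is k.-homog.
Proof.
move: f; apply: homog_ind => [|m mk].
  split=> [|c x y hx hy]; first by rewrite mderiv0; apply: dhomog0.
  by rewrite mderivD mderivZ; apply: dhomogD => //; apply: dhomogZ.
rewrite mderivX; case: (eqVneq (m i) 0%N) => [->|mi]; first by rewrite scale0r; apply: dhomog0.
have le : (U_(i) <= m)%MM by rewrite lep1mP.
have := congr1 (@mdeg n) (submK le); rewrite mdegD mdeg1 mk addn1 => -[e].
by apply: dhomogZ; rewrite dhomogX /= e.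
Qed.

Lemma mulX_mderivX i (m : 'X_{1..n}) : 'X_i * ('X_[m])^`M(i) = (m i)%:R *: 'X_[m] :> S.
Proof.
rewrite mderivX -scalerAr; case: (eqVneq (m i) 0%N) => [->|mi]; first by rewrite !scale0r.
by rewrite mulrC -mpolyXD submK ?lep1mP.
Qed.

Lemma euler f k : f \is k.-homog -> \sum_i 'X_i * f^`M(i) = k%:R *: f.
Proof.
move: f; apply: homog_ind => [|m mk].
  split=> [|c x y hx hy].
    by rewrite scaler0 big1 // => i _; rewrite mderiv0 mulr0.
  rewrite scalerDr scalerA mulrC -scalerA -hx -hy scaler_sumr -big_split /=.
  by apply: eq_bigr => i _; rewrite mderivD mderivZ mulrDr -scalerAr.
under eq_bigr do rewrite mulX_mderivX.
by rewrite -scaler_suml -mk mdegE natr_sum.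
Qed.

Lemma mderivXU i j : ('X_i : S)^`M(j) = (i == j)%:R.
Proof.
rewrite mderivX mnm1E; case: eqP => [->|_]; last by rewrite scale0r.
rewrite scale1r (_ : (U_(j) - U_(j))%MM = 0%MM) ?mpolyX0 //.
by apply/mnmP => k; rewrite mnmBE subnn mnm0E.
Qed.

(** For the chain rule: both of its sides are derivations along [phi], which are determined by
    constants and variables. *)
Lemma derivation_eq (R : comNzRingType) (phi : S -> R) (D1 D2 : S -> R) :
  {morph phi : x y / x * y} ->
  (forall x y, D1 (x + y) = D1 x + D1 y) -> (forall x y, D2 (x + y) = D2 x + D2 y) ->
  (forall x y, D1 (x * y) = D1 x * phi y + phi x * D1 y) ->
  (forall x y, D2 (x * y) = D2 x * phi y + phi x * D2 y) ->
  (forall c, D1 c%:MP = D2 c%:MP) -> (forall i, D1 'X_i = D2 'X_i) -> D1 =1 D2.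
Proof.
move=> hphi D1D D2D D1M D2M hC hX; pose P x := D1 x = D2 x.
have PM x y : P x -> P y -> P (x * y) by rewrite /P D1M D2M => -> ->.
have PX m : P 'X_[m].
  rewrite mpolyXE_id; elim/big_ind: _ => [|//|i _]; first exact: (hC 1).
  by elim: (m i) => [|k ih]; [exact: (hC 1) | rewrite exprS; apply: PM].
elim/mpolyind => [|c m x _ _ ih]; first by rewrite -mpolyC0; apply: hC.
by rewrite D1D D2D ih -mul_mpolyC; congr (_ + _); apply: PM.
Qed.

End Derivatives.

Section Tjurina.
Variable K : numClosedFieldType.
Local Notation S := {mpoly K[3]}.
Local Notation T := {mpoly K[2]}.
Local Notation L := {fraction T}.
Local Notation O := (@local_ring K : frac_module K -> Prop).
Local Notation o := (fun=> 0 : K).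
Implicit Types f g : S.

Lemma mderiv_loc (p : P2 K) f (j : 'I_2) :
  (loc p f)^`M(j) = loc p (f^`M(lift (chart p) j)).
Proof.
move: f; apply: (derivation_eq (phi := loc p)).
- exact: locM.
- by move=> x y; rewrite locD mderivD.
- by move=> x y; rewrite mderivD locD.
- by move=> x y; rewrite locM mderivM.
- by move=> x y; rewrite mderivM locD !locM.
- move=> c; have -> : loc p c%:MP = c%:MP by rewrite /loc /local_equation comp_mpolyC.
  by rewrite !mderivC loc0.
move=> k; rewrite mderivXU; case: (unliftP (chart p) k) => [j' ->|->].
  rewrite locX_lift mderivD mderivC add0r mderivXU (inj_eq lift_inj).
  by case: eqP; rewrite ?loc1 ?loc0.
rewrite locX_chart mderivC (negbTE (neq_lift _ _)); exact/esym/loc0.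
Qed.

(** The coefficients are arbitrary polynomials; homogeneous ones are obtained by taking components
    where degrees matter. *)
Definition family_ideal (u : 'I_3 -> S) k g : Prop :=
  g \is k.-homog /\ exists c : 'I_3 -> S, g = \sum_i c i * u i.

Lemma family_gideal (u : 'I_3 -> S) : gideal (family_ideal u).
Proof.
split=> [k h []//|k|k j h s [hh [c eh]] hs].
  split=> [|a x y [hx [c ex]] [hy [c' ey]]].
    split; first exact: dhomog0.
    by exists (fun=> 0); rewrite big1 // => i _; rewrite mul0r.
  split; first by apply: dhomogD => //; apply: dhomogZ.
  exists (fun i => a *: c i + c' i); rewrite ex ey scaler_sumr -big_split /=.
  by apply: eq_bigr => i _; rewrite mulrDl scalerAl.
split; first exact: dhomogM.
by exists (fun i => s * c i); rewrite eh mulr_sumr; apply: eq_bigr => i _; rewrite mulrA.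
Qed.

Lemma family_ideal_gen (u : 'I_3 -> S) k i : u i \is k.-homog -> family_ideal u k (u i).
Proof.
split=> //; exists (fun k => (k == i)%:R).
by rewrite (bigD1 i) //= eqxx mul1r big1 ?addr0 // => j /negbTE ->; rewrite mul0r.
Qed.

Definition jacobian_ideal f := family_ideal (fun i => f^`M(i)).

Lemma tjurina_ideal_subring (g : T) :
  [/\ forall q q', tjurina_ideal g q -> tjurina_ideal g q' -> tjurina_ideal g (q + q'),
      forall a q, local_ring a -> tjurina_ideal g q -> tjurina_ideal g (a * q),
      tjurina_ideal g (tofrac g) & forall j, tjurina_ideal g (tofrac (g^`M(j)))].
Proof.
have l0 : local_ring (0 : L) by rewrite -tofrac0; apply: local_ring_tofrac.
have l1 : local_ring (1 : L) by rewrite -tofrac1; apply: local_ring_tofrac.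
split.
- move=> q q' [a [b [ha hb ->]]] [a' [b' [ha' hb' ->]]].
  exists (a + a'), (fun j => b j + b' j); split; first exact: local_ringD.
    by move=> j; apply: local_ringD.
  under [in RHS]eq_bigr do rewrite mulrDl.
  by rewrite big_split /= mulrDl addrACA.
- move=> c q hc [a [b [ha hb ->]]]; exists (c * a), (fun j => c * b j); split.
  + exact: local_ringM.
  + by move=> j; apply: local_ringM.
  by rewrite mulrDr mulrA mulr_sumr; congr (_ + _); apply: eq_bigr => j _; rewrite mulrA.
- exists 1, (fun=> 0); split=> //.
  by rewrite mul1r big1 ?addr0 // => j _; rewrite mul0r.
- move=> j; exists 0, (fun k => (k == j)%:R); split=> //.
    by move=> k; case: eqP.
  rewrite mul0r add0r (bigD1 j) //= eqxx mul1r big1 ?addr0 // => k /negbTE ->.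
  by rewrite mul0r.
Qed.

(** The derivatives of the local equation are the partial derivatives in the two directions other
    than that of the chart. Euler's relation, in which the chart variable is a nonzero constant,
    recovers the third one from these and [f], and conversely [f] from all three. *)
Lemma tjurina_ideal_ext f d p : f \is d.+1.-homog ->
  forall q, tjurina_ideal (local_equation f p) q <-> ext p (jacobian_ideal f) q.
Proof.
move=> hf; have jf i : jacobian_ideal f d (f^`M(i)).
  by apply: (family_ideal_gen (u := fun i => f^`M(i))); apply: mderiv_homog.
have ej i : ext p (jacobian_ideal f) (tofrac (loc p f^`M(i))) by apply: ext_gen (jf i).
have hsum : d.+1%:R *: loc p f = coords p (chart p) *: loc p f^`M(chart p) +
    \sum_j loc p 'X_(lift (chart p) j) * loc p f^`M(lift (chart p) j).
  rewrite -locZ -(euler hf) loc_sum (bigD1_ord (chart p)) //= locM locX_chart mul_mpolyC.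
  by congr (_ + _); apply: eq_bigr => j _; rewrite locM.
have p0 := chart_neq0 p.
have d0 : d.+1%:R != 0 :> K by rewrite pnatr_eq0.
have [tD tM tg td] := tjurina_ideal_subring (loc p f).
have t0 : tjurina_ideal (loc p f) 0.
  by rewrite -(mul0r (tofrac (loc p f))); apply: (tM) => //; rewrite -tofrac0; apply: local_ring_tofrac.
have tsum (F : 'I_2 -> L) : (forall j, tjurina_ideal (loc p f) (F j)) ->
    tjurina_ideal (loc p f) (\sum_j F j).
  by move=> hF; elim/big_ind: _ => // j _.
have esum (F : 'I_2 -> L) : (forall j, ext p (jacobian_ideal f) (F j)) ->
    ext p (jacobian_ideal f) (\sum_j F j).
  by move=> hF; elim/big_ind: _ => [|x y|j _]; [exact: ext0 | exact: extD | exact: hF].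
move=> q; split.
  move=> [a [b [ha hb ->]]]; apply: extD; last first.
    by apply: esum => j; apply: extM; rewrite // mderiv_loc.
  apply: extM => //.
  have -> : local_equation f p = d.+1%:R^-1 *: (d.+1%:R *: loc p f).
    by rewrite scalerA mulVf // scale1r.
  rewrite -mul_mpolyC tofracM; apply: extM; first exact: local_ring_tofrac.
  rewrite hsum tofracD -mul_mpolyC tofracM; apply: extD.
    by apply: extM => //; apply: local_ring_tofrac.
  rewrite (big_morph _ (@tofracD _) (@tofrac0 _)); apply: esum => j.
  by rewrite tofracM; apply: extM => //; apply: local_ring_tofrac.
move=> [s hs ->]; rewrite big_seq; elim/big_ind: _ => // -[a g] /hs /= [ha [k [_ [c ->]]]].
apply: (tM) => //; rewrite loc_sum (big_morph _ (@tofracD _) (@tofrac0 _)).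
have tl j : tjurina_ideal (loc p f) (tofrac (loc p f^`M(lift (chart p) j))).
  by rewrite -mderiv_loc; apply: td.
have ti i : tjurina_ideal (loc p f) (tofrac (loc p f^`M(i))).
  case: (unliftP (chart p) i) => [j ->|->] //.
  have -> : loc p f^`M(chart p) = (coords p (chart p))^-1 *: (d.+1%:R *: loc p f -
      \sum_j loc p 'X_(lift (chart p) j) * loc p f^`M(lift (chart p) j)).
    by rewrite hsum addrK scalerA mulVf // scale1r.
  rewrite -mul_mpolyC tofracM; apply: (tM); first exact: local_ring_tofrac.
  rewrite tofracB; apply: (tD).
    by rewrite -mul_mpolyC tofracM; apply: (tM) => //; apply: local_ring_tofrac.
  rewrite -mulN1r; apply: (tM).
    by rewrite -tofrac1 -tofracN; apply: local_ring_tofrac.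
  rewrite (big_morph _ (@tofracD _) (@tofrac0 _)); apply: tsum => j.
  by rewrite tofracM; apply: (tM) => //; apply: local_ring_tofrac.
elim/big_ind: _ => // i _; rewrite locM tofracM; apply: (tM) => //; exact: local_ring_tofrac.
Qed.

Lemma quotient_dim_ext p I n (J : {fraction T} -> Prop) :
  (forall q, J q <-> ext p I q) -> qdim O (ext p I) n -> quotient_dim J = n.
Proof.
move=> hJ hn; have -> : J = ext p I by apply/funext => q; apply/propext.
have qb m : (exists e, @quotient_basis K (ext p I) m e) <-> qdim O (ext p I) m.
  have key (e : 'I_m -> frac_module K) :=
    @qdim_unique_coords K (frac_module K) O (ext p I) m e (local_ring_subspace K) (ext_subspace p I).
  split=> [[e [he hc]]|[e [he sf ff]]]; exists e.
    by have [_] := key e he; case=> // s f; split.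
  by split=> //; have [h _] := key e he; apply: h.
apply: xget_unique; first exact/qb.
by move=> m /qb hm; apply: qdim_uniq hm hn; apply: ext_subspace.
Qed.

(** The Tjurina number at a point is its multiplicity in the list [pts] of length [D]. The sum over
    the singular points exhausts the list, since the multiplicity is zero exactly where some partial
    derivative is a unit. *)
Theorem total_tjurina_stable f d l k0 D : f \is d.+1.-homog ->
  stable (jacobian_ideal f) l k0 D -> total_tjurina f = D.
Proof.
move=> hf st; have hJ := family_gideal (fun i => f^`M(i)).
have [pts <- hpts] := local_lengths hJ st.
have tj p : tjurina f p = count_mem p pts.
  exact: (quotient_dim_ext (tjurina_ideal_ext p hf) (hpts p)).
have sing p : singular_points f p <-> p \in pts.
  rewrite -has_pred1 has_count lt0n; split.
    move=> [_ fi]; apply/eqP => c0; have := hpts p; rewrite c0 => h0.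
    have : ext p (jacobian_ideal f) (tofrac (loc p 1)).
      by apply: (qdim0_sub h0); rewrite loc1; apply: local_ring_tofrac.
    move=> /(ext_form hJ (dhomog1 _ _)) [m [t [ht tp [_ [c e]]]]].
    move: tp; rewrite -[t]mulr1 e raddf_sum /= big1 ?eqxx // => i _.
    by rewrite mevalM fi mulr0.
  move=> c0; suff fi i : (f^`M(i)).@[coords p] = 0.
    split=> //; have /(congr1 (meval (coords p))) := euler hf.
    rewrite raddf_sum mevalZ big1 => [|i _]; last by rewrite /= mevalM fi mulr0.
    by move/esym/eqP; rewrite mulf_eq0 pnatr_eq0 /= => /eqP.
  apply/eqP/negPn/negP => fi; case/eqP: c0.
  apply: (qdim_uniq (ext_subspace p (jacobian_ideal f)) (hpts p)).
  apply: qdim_eq0; first exact: ext_subspace.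
  move=> q hq; have -> : q = (q * (tofrac (loc p f^`M(i)))^-1) * tofrac (loc p f^`M(i)) :> L.
    by rewrite divfK // tofrac_neq0 // meval0_loc.
  apply: extM; first by apply: local_ringM => //; apply: local_ringV; rewrite meval0_loc.
  apply: (@ext_gen _ _ _ d).
  by apply: (family_ideal_gen (u := fun i => f^`M(i))); apply: mderiv_homog.
rewrite /total_tjurina.
have -> : singular_points f = [set` undup pts]%classic.
  by apply/seteqP; split=> p /=; rewrite mem_undup => /sing.
rewrite -fsbig_seq ?undup_uniq //=.
under eq_bigr do rewrite tj.
rewrite -[RHS]sum1_size -[RHS]big_undup_iterop_count.
under [RHS]eq_bigr do rewrite Monoid.iteropE iter_addn_0 mul1n.
by [].
Qed.

End Tjurina.

(** * Coprime families and cross products *)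

Section CoprimeFamilies.
Variable K : numClosedFieldType.
Local Notation S := {mpoly K[3]}.
Implicit Types (u w : 'I_3 -> S).

Definition coprime_family u : Prop := forall q, prime_elt q -> ~ forall i, divides q (u i).

Lemma coprime_family_neq0 u : coprime_family u -> exists i, u i != 0.
Proof.
move=> cu; apply: contrapT => /forallNP u0.
have [||q hq _] := @prime_divisor_exists S 'X_ord0 (factorial_mpoly (n := 3)).
- exact: mpolyXU_neq0.
- apply/negP => /(homog_unit (mpolyXU_neq0 K ord0) (homogX K ord0)); discriminate.
apply: (cu q hq) => i; have /negP/negPn/eqP -> := u0 i; exact: divides0.
Qed.

Definition spanned u : S -> Prop := fun h => exists c : 'I_3 -> K, h = \sum_i c i *: u i.

Lemma spanned_subspace u : subspace (spanned u).
Proof.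
split=> [|a _ _ [c ->] [c' ->]].
  by exists (fun=> 0); rewrite big1 // => i _; rewrite scale0r.
exists (fun i => a * c i + c' i); rewrite scaler_sumr -big_split /=.
by apply: eq_bigr => i _; rewrite scalerDl scalerA.
Qed.

Lemma spanned_gen u i : spanned u (u i).
Proof.
exists (fun k => (k == i)%:R); rewrite (bigD1 i) //= eqxx scale1r big1 ?addr0 // => k /negbTE ->.
by rewrite scale0r.
Qed.

Lemma coprime_family_regular u g : coprime_family u -> g != 0 ->
  exists2 h, spanned u h & regular g h.
Proof.
move=> cu g0; apply: regular_pair_exists => // [|q hq _]; first exact: spanned_subspace.
apply: contrapT => nh; apply: (cu q hq) => i; apply: contrapT => ni; apply: nh.
by exists (u i) => //; apply: spanned_gen.
Qed.

(** Let [h], the sum of the [c_j u_j], be coprime to a nonzero [u_i0]. Proportionality gives [u_i0]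
    times the sum of the [c_j w_j] equal to [w_i0 h], so [u_i0] divides [w_i0]; the quotient is the
    factor sought. *)
Lemma coprime_family_proportional u w : coprime_family u ->
  (forall i j, w i * u j = w j * u i) -> exists g, forall i, w i = g * u i.
Proof.
move=> cu wu; have [i0 ui0] := coprime_family_neq0 cu.
have [_ [c ->] reg] := coprime_family_regular cu ui0.
have [|g eg] := reg (\sum_j c j *: w j) (w i0).
  rewrite mulr_suml mulr_sumr; apply: eq_bigr => j _.
  by rewrite -scalerAl -scalerAr wu.
exists g => i; apply: (mulIf ui0); rewrite wu eg; ring.
Qed.

Lemma regular_neq0 (g h : S) : g != 0 -> g \isn't a GRing.unit -> regular g h -> h != 0.
Proof.
move=> g0 gu reg; apply: contraNneq gu => h0.
have [|c e] := reg 0 1; first by rewrite h0 mulr0 mul0r.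
by apply/unitrPr; exists c.
Qed.

Lemma homog_nonunit (g : S) k : g != 0 -> g \is k.+1.-homog -> g \isn't a GRing.unit.
Proof. by move=> g0 hg; apply/negP => /(homog_unit g0 hg). Qed.

(** The degree is positive so that the chosen [u i] is not a unit, which makes its regular partner
    nonzero. *)
Lemma stable_of_coprime_family I k u : gideal I -> (forall i, I k.+1 (u i)) ->
  coprime_family u -> exists l k0 D, stable I l k0 D.
Proof.
move=> hI Iu cu; have [Ih Is Im] := hI; have [i ui] := coprime_family_neq0 cu.
have [h [c eh] reg] := coprime_family_regular cu ui.
have h0 := regular_neq0 ui (homog_nonunit ui (Ih _ _ (Iu i))) reg.
apply: (stable_exists hI (Iu i) _ ui h0 reg) => //.
by rewrite eh; apply: subspace_sum => // j _; apply: subspaceZ.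
Qed.

Lemma squarefree_neq0 (f : S) : squarefree f -> f != 0.
Proof.
move=> sf; apply/eqP => f0; have := sf 0 0; rewrite f0 mulr0 => /(_ erefl).
by rewrite unitr0.
Qed.

(** A common prime [q] divides [f] by Euler's relation. With [f = q h] and [q] not dividing [h], it
    divides its own partial derivatives, which have lower degree and so vanish; Euler's relation for
    [q] then gives [q = 0]. *)
Lemma squarefree_coprime (f : S) d : f \is d.+1.-homog -> squarefree f ->
  coprime_family (fun i => f^`M(i)).
Proof.
move=> hf sf q hq qf; have [q0 qu pq] := hq.
have d0 : d.+1%:R != 0 :> K by rewrite pnatr_eq0.
have f0 := squarefree_neq0 sf.
have [h ef] : divides q f.
  have -> : f = d.+1%:R^-1 *: \sum_i 'X_i * f^`M(i).
    by rewrite (euler hf) scalerA mulVf // scale1r.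
  by rewrite -mul_mpolyC; apply: divides_mull; apply: divides_sum => i _; apply: divides_mull.
have qqh : ~ divides q h.
  move=> [c eh]; case/negP: qu; apply: (sf q c); rewrite ef eh; ring.
have [k [_ [hk _ _]]] : exists i j, [/\ q \is i.-homog, h \is j.-homog & d.+1 = (i + j)%N].
  by apply: homog_factor; rewrite -ef.
case: k hk => [|k] hk; first by rewrite homog0_unit in qu.
have qi i : q^`M(i) = 0.
  have [c e] : divides q q^`M(i).
    have : divides q (q^`M(i) * h).
      have := qf i; rewrite ef mderivM => /dividesB -/(_ (q * h^`M(i))).
      by rewrite addrK; apply; apply: divides_mulr; apply: divides_refl.
    by case/pq.
  have hqi := mderiv_homog i hk.
  have c0 : c = 0.
    by apply: (homog_divl_lt hk (k := k)); rewrite // mulrC -e.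
  by rewrite e c0 mulr0.
have /eqP := euler hk; rewrite big1 => [|i _]; last by rewrite qi mulr0.
by rewrite eq_sym -mul_mpolyC mulf_eq0 mpolyC_eq0 pnatr_eq0 (negbTE q0).
Qed.

End CoprimeFamilies.

Section Determinant.
Variable R : comNzRingType.

Lemma det_mx22 (A : 'M[R]_2) : \det A = A ord0 ord0 * A ord_max ord_max
  - A ord0 ord_max * A ord_max ord0.
Proof.
rewrite (expand_det_row _ ord0) !big_ord_recl big_ord0 addr0 /cofactor !det_mx11 !mxE /=.
rewrite expr0 mul1r expr1 mulN1r mulrN.
by congr (A _ _ * A _ _ - A _ _ * A _ _); apply: val_inj.
Qed.

Lemma det_mx33 (A : 'M[R]_3) : \det A =
    A ord0 ord0 * (A o1 o1 * A o2 o2 - A o1 o2 * A o2 o1)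
  + A ord0 o1 * (A o1 o2 * A o2 ord0 - A o1 ord0 * A o2 o2)
  + A ord0 o2 * (A o1 ord0 * A o2 o1 - A o1 o1 * A o2 ord0).
Proof.
rewrite (expand_det_row _ ord0) !big_ord_recl big_ord0 addr0 addrA /cofactor !det_mx22 !mxE.
have -> : lift ord0 (lift ord0 ord0) = o2 :> 'I_3 by apply: val_inj.
have -> : lift ord0 ord0 = o1 by [].
have -> : lift ord0 ord_max = o2 :> 'I_3 by apply: val_inj.
have -> : lift o1 ord0 = ord0 :> 'I_3 by apply: val_inj.
have -> : lift o1 ord_max = o2 :> 'I_3 by apply: val_inj.
have -> : lift o2 ord0 = ord0 :> 'I_3 by apply: val_inj.
have -> : lift o2 ord_max = o1 :> 'I_3 by apply: val_inj.
by rewrite /=; ring.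
Qed.

End Determinant.

Section CrossProduct.
Variable K : numClosedFieldType.
Local Notation S := {mpoly K[3]}.
Local Notation row := 'rV[S]_3.
Implicit Types (r s : row).

Definition cross r s (i : 'I_3) : S :=
  if i == ord0 then r 0 o1 * s 0 o2 - r 0 o2 * s 0 o1
  else if i == o1 then r 0 o2 * s 0 ord0 - r 0 ord0 * s 0 o2
  else r 0 ord0 * s 0 o1 - r 0 o1 * s 0 ord0.

Lemma sum3 (V : nmodType) (F : 'I_3 -> V) : \sum_i F i = F ord0 + F o1 + F o2.
Proof.
rewrite !big_ord_recr big_ord0 /= add0r.
by congr (F _ + F _ + F _); apply: val_inj.
Qed.

Lemma Delta_cross r s : Delta r s = \sum_i 'X_i * cross r s i.
Proof. by rewrite /Delta det_mx33 !mxE sum3 /cross. Qed.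

(** A copy of [S^3] regarded as a [K]-vector space instead of an [S]-module. *)
Definition triples : Type := 'rV[{mpoly K[3]}]_3.
HB.instance Definition _ := GRing.Zmodule.on triples.

Definition triple_scale (c : K) (r : triples) : triples := (c%:MP : S) *: (r : row).

Fact triple_scaleA a b v : triple_scale a (triple_scale b v) = triple_scale (a * b) v.
Proof. by rewrite /triple_scale mpolyCM scalerA. Qed.
Fact triple_scale1 : left_id 1 triple_scale.
Proof. by move=> v; rewrite /triple_scale mpolyC1 scale1r. Qed.
Fact triple_scaleDr : right_distributive triple_scale +%R.
Proof. by move=> a u v; rewrite /triple_scale; exact: scalerDr. Qed.
Fact triple_scaleDl v : {morph triple_scale^~ v : a b / a + b}.
Proof. by move=> a b; rewrite /triple_scale mpolyCD; exact: scalerDl. Qed.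
HB.instance Definition _ := GRing.Zmodule_isLmodule.Build K triples
  triple_scaleA triple_scale1 triple_scaleDr triple_scaleDl.

Definition coord (i : 'I_3) (r : triples) : S := (r : row) 0 i.
Fact coord_is_linear i : linear (coord i).
Proof. by move=> c r s; rewrite /coord !mxE mul_mpolyC. Qed.
HB.instance Definition _ i := GRing.isLinear.Build K triples S _ (coord i) (coord_is_linear i).

Definition pairing (u : 'I_3 -> S) (r : triples) : S := \sum_i coord i r * u i.
Fact pairing_is_linear u : linear (pairing u).
Proof.
move=> c r s; rewrite /pairing scaler_sumr -big_split /=; apply: eq_bigr => i _.
by rewrite linearP mulrDl scalerAl.
Qed.
HB.instance Definition _ u := GRing.isLinear.Build K triples S _ (pairing u) (pairing_is_linear u).

Definition scale_triple (r : triples) (a : S) : triples := a *: (r : row).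
Fact scale_triple_is_linear r : linear (scale_triple r).
Proof.
by move=> c a b; apply/rowP => i; rewrite !mxE mulrDl -scalerAl mul_mpolyC.
Qed.
HB.instance Definition _ r := GRing.isLinear.Build K S triples _ (scale_triple r)
  (scale_triple_is_linear r).

Definition homog_triples k : triples -> Prop := fun r => homog_triple k r.

Lemma homog_triples_subspace k : subspace (homog_triples k).
Proof.
split=> [i|c r s hr hs i]; first by rewrite mxE; apply: dhomog0.
by rewrite !mxE mul_mpolyC; apply: dhomogD; [apply: dhomogZ; apply: hr | apply: hs].
Qed.

(** Filtration by the vanishing of the last coordinates: each of the three steps contributes a copy
    of the forms of degree [k]. *)
Lemma homog_triples_dim k : qdim (homog_triples k) (@zeros _) (3 * sdim k).
Proof.
pose P m : triples -> Prop := fun r =>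
  homog_triples k r /\ forall i : 'I_3, (m <= i)%N -> coord i r = 0.
have Ps m : subspace (P m).
  split=> [|c r s [hr zr] [hs zs]].
    by split=> [|i _]; [case: (homog_triples_subspace k) | rewrite linear0].
  split=> [|i mi]; first by case: (homog_triples_subspace k) => _; apply.
  by rewrite linearP /= zr // zs // scaler0 addr0.
have step (i : 'I_3) : qdim (P i.+1) (P i) (sdim k).
  apply: (@qdim_preimage K triples S (coord i) _ _ (form k) (@zeros _)) (form_dim K k) => //.
  - exact: zeros_subspace.
  - by move=> r [hr _]; apply: hr.
  - move=> a ha; exists (\row_j (if j == i then a else 0)).
      split=> [j|j ij]; first by rewrite mxE; case: eqP => // _; apply: dhomog0.
      by rewrite /coord mxE -val_eqE gtn_eqF.
    by rewrite /zeros /= /coord mxE eqxx subrr.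
  - move=> r [hr zr]; split=> [h|[_ h]]; last exact: h.
    by split=> // j; rewrite leq_eqVlt => /orP [/eqP/val_inj <-|/zr].
have sub m x : P m x -> P m.+1 x.
  by move=> [h1 h2]; split=> // i mi; apply: h2; apply: ltnW.
have d1 := step ord0; have d2 := step o1; have d3 := step o2.
have d12 := qdim_add (Ps 2) (Ps 1) (Ps 0) (sub 0) (sub 1) d1 d2.
have d123 := qdim_add (Ps 3) (Ps 2) (Ps 0) (fun x h => sub 1 _ (sub 0 _ h)) (sub 2) d12 d3.
have -> : (3 * sdim k = sdim k + sdim k + sdim k)%N by lia.
apply: qdim_ext d123 => r.
  by split=> [[]//|h]; split=> // -[i hi] /= /(leq_trans hi); rewrite ltnn.
split=> [[_ h]|->]; first by apply/rowP => i; rewrite mxE; apply: h.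
by split=> [|i _]; [case: (homog_triples_subspace k) | rewrite linear0].
Qed.

Lemma cross_homog a b r s i : homog_triple a r -> homog_triple b s ->
  cross r s i \is (a + b).-homog.
Proof.
move=> hr hs; have hrs j k : r 0 j * s 0 k \is (a + b).-homog by apply: dhomogM.
by rewrite /cross; case: ifP => _; [|case: ifP => _]; apply: dhomogD; rewrite ?dhomogN.
Qed.

Lemma cross_proportional r s : (forall i, cross r s i = 0) ->
  forall i j, s 0 i * r 0 j = s 0 j * r 0 i.
Proof.
move=> h; have h0 := h ord0; have h1 := h o1; have h2 := h o2.
rewrite /cross /= in h0 h1 h2.
have e01 : r 0 ord0 * s 0 o1 = r 0 o1 * s 0 ord0 by apply/eqP; rewrite -subr_eq0 h2.
have e12 : r 0 o1 * s 0 o2 = r 0 o2 * s 0 o1 by apply/eqP; rewrite -subr_eq0 h0.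
have e20 : r 0 o2 * s 0 ord0 = r 0 ord0 * s 0 o2 by apply/eqP; rewrite -subr_eq0 h1.
elim/ord3P => [||]; elim/ord3P => [||] //; rewrite mulrC [RHS]mulrC //; exact: esym.
Qed.

(* Both factors of [cross r s] are orthogonal to [u], so that over the fraction
   field it is parallel to [u]. *)
Lemma cross_orthogonal r s (u : 'I_3 -> S) : \sum_i r 0 i * u i = 0 -> \sum_i s 0 i * u i = 0 ->
  forall i j, cross r s i * u j = cross r s j * u i.
Proof.
rewrite !sum3 => hr hs.
have k01 : cross r s ord0 * u o1 = cross r s o1 * u ord0.
  have -> : cross r s ord0 * u o1 = cross r s o1 * u ord0 +
    (r 0 ord0 * u ord0 + r 0 o1 * u o1 + r 0 o2 * u o2) * s 0 o2 -
    (s 0 ord0 * u ord0 + s 0 o1 * u o1 + s 0 o2 * u o2) * r 0 o2.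
    by rewrite /cross /=; ring.
  by rewrite hr hs !mul0r addr0 subr0.
have k12 : cross r s o1 * u o2 = cross r s o2 * u o1.
  have -> : cross r s o1 * u o2 = cross r s o2 * u o1 +
    (r 0 ord0 * u ord0 + r 0 o1 * u o1 + r 0 o2 * u o2) * s 0 ord0 -
    (s 0 ord0 * u ord0 + s 0 o1 * u o1 + s 0 o2 * u o2) * r 0 ord0.
    by rewrite /cross /=; ring.
  by rewrite hr hs !mul0r addr0 subr0.
have k20 : cross r s o2 * u ord0 = cross r s ord0 * u o2.
  have -> : cross r s o2 * u ord0 = cross r s ord0 * u o2 +
    (r 0 ord0 * u ord0 + r 0 o1 * u o1 + r 0 o2 * u o2) * s 0 o1 -
    (s 0 ord0 * u ord0 + s 0 o1 * u o1 + s 0 o2 * u o2) * r 0 o1.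
    by rewrite /cross /=; ring.
  by rewrite hr hs !mul0r addr0 subr0.
by elim/ord3P => [||]; elim/ord3P => [||].
Qed.

End CrossProduct.

(** * The Bourbaki ideal *)

Section Bourbaki.
Variable K : numClosedFieldType.
Local Notation S := {mpoly K[3]}.
Local Notation row := 'rV[S]_3.
Local Notation coprimer r := (coprime_family (fun i => (r : row) 0 i)).

Lemma crossD (r s t : row) i : cross r (s + t) i = cross r s i + cross r t i.
Proof. by rewrite /cross !mxE; do 2?case: ifP => _; ring. Qed.

Lemma crossZ (r s : row) a i : cross r (a *: s) i = a * cross r s i.
Proof. by rewrite /cross !mxE; do 2?case: ifP => _; ring. Qed.

Lemma cross_self (r : row) i : cross r r i = 0.
Proof. by rewrite /cross; do 2?case: ifP => _; ring. Qed.

Lemma Delta_linear (r s t : row) a b :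
  Delta r (a *: s + b *: t) = a * Delta r s + b * Delta r t.
Proof.
rewrite !Delta_cross !mulr_sumr -big_split; apply: eq_bigr => i _ /=.
by rewrite crossD !crossZ; ring.
Qed.

Definition Delta_map (r : row) (s : triples K) : S := \sum_i 'X_i * cross r s i.
Fact Delta_map_is_linear r : linear (Delta_map r).
Proof.
move=> c s t; rewrite /Delta_map scaler_sumr -big_split /=; apply: eq_bigr => i _.
have -> : cross r (c *: s + t) i = c%:MP * cross r s i + cross r t i.
  by rewrite crossD crossZ.
by rewrite mulrDr mul_mpolyC scalerAr.
Qed.
HB.instance Definition _ r := GRing.isLinear.Build K (triples K) S _ (Delta_map r)
  (Delta_map_is_linear r).

Lemma Delta_mapE r s : Delta_map r s = Delta r s.
Proof. by rewrite Delta_cross. Qed.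

Lemma AR_D (f : S) (r s : row) : AR f r -> AR f s -> AR f (r + s).
Proof.
rewrite /AR /= => hr hs; under eq_bigr do rewrite mxE mulrDl.
by rewrite big_split /= hr hs addr0.
Qed.

Lemma AR_Z (f a : S) (r : row) : AR f r -> AR f (a *: r).
Proof.
rewrite /AR /= => hr; under eq_bigr do rewrite mxE -mulrA.
by rewrite -mulr_sumr hr mulr0.
Qed.

Lemma AR_0 (f : S) : AR f 0.
Proof. by rewrite /AR /= big1 // => i _; rewrite mxE mul0r. Qed.

Variables (f : S) (e d1 : nat) (r1 : row).
Hypotheses (hf : f \is e.+1.-homog) (sf : squarefree f).
Hypotheses (r1_AR : AR f r1) (r1_homog : homog_triple d1 r1) (r1_coprime : coprimer r1).

Let c0 : K := e.+1%:R.
Let c0_neq0 : c0 != 0. Proof. by rewrite /c0 pnatr_eq0. Qed.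

Let f_neq0 : f != 0 := squarefree_neq0 sf.

Let grad_coprime : coprime_family (fun i => f^`M(i)) := squarefree_coprime hf sf.

(** The cross product is parallel to the gradient of [f], whose entries are coprime, so the factor
    is a polynomial. Pairing with [(x, y, z)] and Euler's relation then show that [f] divides
    [Delta], the quotient being [g] times the degree of [f]. *)
Lemma syzygy_cross r : AR f r -> exists g, (forall i, cross r1 r i = g * f^`M(i)).
Proof.
by move=> hr; apply: coprime_family_proportional => //; apply: cross_orthogonal.
Qed.

Lemma Delta_of_cross r g : (forall i, cross r1 r i = g * f^`M(i)) ->
  Delta r1 r = (c0 *: g) * f.
Proof.
move=> h; rewrite Delta_cross.
rewrite (eq_bigr (fun i => g * ('X_i * f^`M(i)))) => [|i _]; last by rewrite h mulrCA.
by rewrite -mulr_sumr (euler hf) -scalerAr -scalerAl.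
Qed.

Lemma cross_of_Delta r h : AR f r -> Delta r1 r = h * f ->
  forall i, cross r1 r i = (c0^-1 *: h) * f^`M(i).
Proof.
move=> hr e1; have [g hg] := syzygy_cross hr.
have := Delta_of_cross hg; rewrite e1 => /(mulIf f_neq0) -> i.
by rewrite scalerA mulVf // scale1r hg.
Qed.

Lemma Delta_eq0 r : AR f r -> Delta r1 r = 0 -> exists p, r = p *: r1.
Proof.
move=> hr D0; have h : forall i, cross r1 r i = 0.
  have := cross_of_Delta (h := 0) hr; rewrite mul0r => /(_ D0) h i.
  by rewrite h scaler0 mul0r.
have [p hp] := coprime_family_proportional r1_coprime (cross_proportional h).
by exists p; apply/rowP => i; rewrite mxE hp.
Qed.

Lemma Delta_scale p : Delta r1 (p *: r1) = 0.
Proof.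
by rewrite Delta_cross big1 // => i _; rewrite crossZ cross_self !mulr0.
Qed.

Lemma bourbaki_exists r : AR f r -> exists2 h, bourbaki f r1 h & Delta r1 r = h * f.
Proof.
move=> hr; have [g hg] := syzygy_cross hr; have e1 := Delta_of_cross hg.
by exists (c0 *: g) => //; exists r.
Qed.

Definition bourbaki_piece k h : Prop := h \is k.-homog /\ bourbaki f r1 h.

Lemma bourbakiD h h' : bourbaki f r1 h -> bourbaki f r1 h' -> bourbaki f r1 (h + h').
Proof.
move=> [r hr eh] [r' hr' eh']; exists (r + r'); first exact: AR_D.
by rewrite mulrDl -eh -eh' !Delta_cross -big_split; apply: eq_bigr => i _;
  rewrite crossD mulrDr.
Qed.

Lemma bourbakiM s h : bourbaki f r1 h -> bourbaki f r1 (s * h).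
Proof.
move=> [r hr eh]; exists (s *: r); first exact: AR_Z.
rewrite -mulrA -eh !Delta_cross mulr_sumr; apply: eq_bigr => i _.
by rewrite crossZ mulrCA.
Qed.

Lemma bourbaki_piece_gideal : gideal bourbaki_piece.
Proof.
split=> [k h []//|k|k j h s [hh bh] hs].
  split=> [|c x y [hx bx] [hy b_y]].
    split; first exact: dhomog0.
    by rewrite -(mul0r 0); apply: bourbakiM; exists 0; [exact: AR_0 |
       rewrite mul0r -(scale0r r1) Delta_scale].
  split; first by apply: dhomogD => //; apply: dhomogZ.
  by rewrite -mul_mpolyC; apply: bourbakiD => //; apply: bourbakiM.
by split; [exact: dhomogM | exact: bourbakiM].
Qed.

(** The condition [k + e = j + d1] is the degree shift [d1 - d + 1] of the Bourbaki map with
    [e = d - 1], written additively to avoid truncated subtraction. *)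
Lemma homog_Delta r j k h : homog_triple j r -> (k + e = j + d1)%N ->
  Delta r1 r = h * f -> h \is k.-homog.
Proof.
move=> hr kj eh; apply: (homog_divl f_neq0 hf); rewrite -eh Delta_cross addnS kj.
apply: rpred_sum => i _; rewrite addnC; apply: homog_mul1; first exact: homogX.
exact: cross_homog.
Qed.

(** A preimage of [h] need not be homogeneous, but its component of degree [j] maps to the component
    of degree [k] of [h]. *)
Lemma bourbaki_lift k h j : bourbaki f r1 h -> (k + e = j + d1)%N ->
  exists r, [/\ AR f r, homog_triple j r & Delta r1 r = pihomog mdeg k h * f].
Proof.
move=> [r hr eh] kj; have hg := cross_of_Delta hr eh.
pose r' : row := \row_i pihomog mdeg j (r 0 i).
have hr' : AR f r'.
  rewrite /AR /= (eq_bigr (fun i => pihomog mdeg (j + e) (r 0 i * f^`M(i)))).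
    by rewrite -raddf_sum hr raddf0.
  by move=> i _; rewrite mxE pihomogMr //; apply: mderiv_homog.
exists r'; split=> // [i|]; first by rewrite mxE; apply: pihomogP.
rewrite (@Delta_of_cross _ (c0^-1 *: pihomog mdeg k h)) ?scalerA ?divff ?scale1r // => i.
rewrite -linearZ -(pihomogMr _ k (mderiv_homog i hf)) -hg kj.
have pM a b : pihomog mdeg (j + d1) (r1 0 a * r 0 b) = r1 0 a * r' 0 b.
  by rewrite [r1 0 a * _]mulrC pihomogMr ?r1_homog // mxE mulrC.
by rewrite /cross; do 2?case: ifP => _; rewrite pihomogB !pM.
Qed.

Lemma bourbaki_piece_lift k h j : bourbaki_piece k h -> (k + e = j + d1)%N ->
  exists r, [/\ AR f r, homog_triple j r & Delta r1 r = h * f].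
Proof. by move=> [hh bh] /(bourbaki_lift bh); rewrite pihomog_dE. Qed.

(** Degrees below [d1 - e] have no source: [cross r1 r] has only components of degree at least
    [d1]. *)
Lemma bourbaki_pihomog_lt k h : bourbaki f r1 h -> (k + e < d1)%N -> pihomog mdeg k h = 0.
Proof.
move=> [r hr eh] kj; have hg := cross_of_Delta hr eh.
have [i fi] := coprime_family_neq0 grad_coprime.
have : pihomog mdeg k (c0^-1 *: h) * f^`M(i) = 0.
  rewrite -(pihomogMr _ k (mderiv_homog i hf)) -hg.
  have pM a b : pihomog mdeg (k + e) (r1 0 a * r 0 b) = 0.
    by rewrite mulrC (pihomogMr_lt _ (r1_homog a)).
  by rewrite /cross; do 2?case: ifP => _; rewrite pihomogB !pM subrr.
by move/eqP; rewrite mulf_eq0 (negbTE fi) orbF linearZ /= -mul_mpolyC mulf_eq0 mpolyC_eq0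
  invr_eq0 (negbTE c0_neq0) => /eqP.
Qed.

Lemma bourbaki_pihomog k h : bourbaki f r1 h -> bourbaki_piece k (pihomog mdeg k h).
Proof.
move=> bh; split; first exact: pihomogP.
case: (leqP d1 (k + e)) => [le|lt]; last first.
  rewrite (bourbaki_pihomog_lt bh lt); case: bourbaki_piece_gideal => _ Is _.
  by have [[]] := Is 0%N.
have [r [hr _ er]] := bourbaki_lift bh (esym (subnK le)); by exists r.
Qed.

(* The Koszul syzygy in the coordinates other than [i] is mapped to a multiple of
   the [i]-th component of [r1]. *)
Lemma bourbaki_koszul i : bourbaki_piece d1 (r1 0 i).
Proof.
suff [r [hr hc]] : exists r : row, AR f r /\ forall j, cross r1 r j = r1 0 i * f^`M(j).
  split; first exact: r1_homog.
  have -> : r1 0 i = (c0^-1)%:MP * (c0 *: r1 0 i).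
    by rewrite mul_mpolyC scalerA mulVf // scale1r.
  by apply: bourbakiM; exists r => //; apply: Delta_of_cross.
have := r1_AR; rewrite /AR /= sum3 => h1.
pose k0 : row := \row_j (if j == o1 then f^`M(o2) else if j == o2 then - f^`M(o1) else 0).
pose k1 : row := \row_j (if j == o2 then f^`M(ord0) else if j == ord0 then - f^`M(o2) else 0).
pose k2 : row := \row_j (if j == ord0 then f^`M(o1) else if j == o1 then - f^`M(ord0) else 0).
move: i; elim/ord3P; [exists k0|exists k1|exists k2]; (split;
  [by rewrite /AR /= sum3 !mxE /=; ring |
   elim/ord3P; rewrite /cross !mxE /=;
   first [ring | (rewrite -[LHS]addr0 -h1; ring) | (rewrite -[LHS]subr0 -h1; ring)]]).
Qed.

End Bourbaki.

(** * The relation between the Tjurina number and the codimension of the Bourbaki ideal *)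

Section BourbakiDegree.
Variable K : numClosedFieldType.
Local Notation S := {mpoly K[3]}.
Local Notation row := 'rV[S]_3.
Local Notation coprimer r := (coprime_family (fun i => (r : row) 0 i)).

Variables (f : S) (e d1 : nat) (r1 : row).
Hypotheses (hf : f \is e.+1.-homog) (sf : squarefree f).
Hypotheses (r1_AR : AR f r1) (r1_homog : homog_triple d1 r1) (r1_coprime : coprimer r1).

Let f_neq0 : f != 0 := squarefree_neq0 sf.

Let hB := bourbaki_piece_gideal f r1.
Let hJ := family_gideal (fun i => f^`M(i)).

Definition homog_syzygies j : triples K -> Prop := fun r => AR f r /\ homog_triple j r.

Lemma homog_syzygies_subspace j : subspace (homog_syzygies j).
Proof.
have [h0 hZD] := homog_triples_subspace K j.
split=> [|c x y [ax hx] [ay hy]]; first by split; [exact: AR_0|].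
split; last exact: hZD.
by apply: AR_D => //; apply: AR_Z.
Qed.

(** Rank-nullity for the map from [S_j^3] onto the Jacobian ideal in degree [j + e] given by the
    partial derivatives. *)
Lemma homog_syzygies_dim j : exists a g, [/\ qdim (homog_syzygies j) (@zeros _) a,
  qdim (jacobian_ideal f (j + e)) (@zeros _) g & (3 * sdim j = a + g)%N].
Proof.
have [|||||a [g [ha hg eg]]] := @qdim_split K (triples K) (homog_triples j) (homog_syzygies j)
  (@zeros _) (3 * sdim j) _ _ _ _ _ (homog_triples_dim K j).
- exact: homog_triples_subspace.
- exact: homog_syzygies_subspace.
- exact: zeros_subspace.
- by move=> x ->; case: (homog_syzygies_subspace j).
- by move=> x [].
exists a, g; split=> //.
apply: (@qdim_image K (triples K) S (pairing (fun i => f^`M(i)))) hg.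
- exact: homog_triples_subspace.
- exact: zeros_subspace.
- move=> r hr; split; last by exists (fun i => coord i r).
  by apply: rpred_sum => i _; apply: dhomogM; [exact: hr | exact: mderiv_homog].
- move=> y [hy [c ey]]; exists (\row_i pihomog mdeg j (c i)).
    by move=> i; rewrite mxE; apply: pihomogP.
  rewrite /zeros -(pihomog_dE hy) ey raddf_sum /= /pairing -sumrB big1 // => i _.
  by rewrite /coord mxE pihomogMr ?subrr //; apply: mderiv_homog.
- by move=> r hr; split=> [h|[]].
Qed.

Lemma homog_syzygies_bourbaki_dim j k a b : (d1 <= j)%N -> (k + e = j + d1)%N ->
  qdim (homog_syzygies j) (@zeros _) a -> qdim (bourbaki_piece f r1 k) (@zeros _) b ->
  a = (sdim (j - d1) + b)%N.
Proof.
move=> dj kj ha hb; pose R1 : triples K -> Prop := fun r => exists2 p, form (j - d1) p & r = scale_triple r1 p.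
have [i ri] := coprime_family_neq0 r1_coprime.
have R1s : subspace R1.
  split=> [|c _ _ [p hp ->] [q hq ->]].
    by exists 0; [exact: dhomog0 | rewrite linear0].
  exists (c *: p + q); last by rewrite linearP.
  by apply: dhomogD => //; apply: dhomogZ.
have R1d : qdim R1 (@zeros _) (sdim (j - d1)).
  apply: (@qdim_image K S (triples K) (scale_triple r1) (form (j - d1)) (@zeros _)) (form_dim K _).
  - exact: form_subspace.
  - exact: zeros_subspace.
  - by move=> p hp; exists p.
  - by move=> _ [p hp ->]; exists p; rewrite // /zeros subrr.
  - move=> p hp; split=> [/rowP/(_ i)|->]; last by rewrite /zeros linear0.
    by rewrite !mxE => /eqP; rewrite mulf_eq0 (negbTE ri) orbF => /eqP.
have [|||||a1 [b' [ha1 hb' ->]]] := @qdim_split K (triples K) (homog_syzygies j) R1 (@zeros _) a _ _ _ _ _ ha.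
- exact: homog_syzygies_subspace.
- exact: R1s.
- exact: zeros_subspace.
- by move=> x ->; case: R1s.
- move=> _ [p hp ->]; split; first exact: AR_Z.
  by move=> l; rewrite mxE -(subnK dj); apply: dhomogM.
rewrite (qdim_uniq (@zeros_subspace _ _) ha1 R1d); congr (_ + _)%N.
pose P' : S -> Prop := fun y => exists2 h, bourbaki_piece f r1 k h & y = mulby f h.
apply: (@qdim_uniq K S P' (@zeros _)); first exact: zeros_subspace.
  apply: (@qdim_image K (triples K) S (Delta_map r1)) hb'.
  - exact: homog_syzygies_subspace.
  - exact: zeros_subspace.
  - move=> r [ar hr]; have [h bh eh] := bourbaki_exists hf sf r1_AR ar.
    exists h; last exact: (etrans (Delta_mapE _ _) eh).
    by split=> //; apply: (homog_Delta hf sf r1_homog hr kj eh).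
  - move=> _ [h bh ->]; have [r [ar hr er]] := bourbaki_piece_lift hf sf r1_AR r1_homog bh kj.
    by exists r => //; rewrite /zeros /= Delta_mapE er subrr.
  - move=> r [ar hr]; rewrite /zeros /= Delta_mapE; split=> [D0|[p hp ->]]; last exact: Delta_scale.
    have [p ep] := Delta_eq0 hf sf r1_AR r1_coprime ar D0.
    exists p; last exact: ep.
    apply: (homog_divl ri (r1_homog i)); rewrite subnK //.
    by have := hr i; rewrite ep mxE.
apply: (@qdim_image K S S (mulby f)) hb.
- by case: hB.
- exact: zeros_subspace.
- by move=> h bh; exists h.
- by move=> _ [h bh ->]; exists h; rewrite // /zeros subrr.
- move=> h bh; split=> [/eqP|->]; last by rewrite /zeros linear0.
  by rewrite mulf_eq0 (negbTE f_neq0) orbF => /eqP.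
Qed.

Theorem bourbaki_degree lJ kJ tau lB kB delta :
  stable (jacobian_ideal f) lJ kJ tau -> stable (bourbaki_piece f r1) lB kB delta ->
  (tau + delta + e * d1 = e * e + d1 * d1)%N.
Proof.
(* [t] puts [j + e] and [k] beyond both stability thresholds; [j] and [k] are sums so that [j - d1]
   is exactly [t + e]. *)
move=> [_ sJ] [_ sB]; pose t := (kJ + kB)%N; pose j := (t + d1 + e)%N.
pose k := (t + d1 + d1)%N.
have kj : (k + e = j + d1)%N by rewrite /k /j; lia.
have [a [g [ha hg eg]]] := homog_syzygies_dim j.
have kJj : (kJ <= j + e)%N by rewrite /j /t -!addnA leq_addr.
have kBk : (kB <= k)%N by rewrite /k /t -!addnA addnCA leq_addr.
have [hJd _] := sJ _ kJj; have [hBd _] := sB _ kBk.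
have splitI (I : nat -> S -> Prop) n D : gideal I -> qdim (form n) (I n) D ->
    exists2 b, qdim (I n) (@zeros _) b & (sdim n = b + D)%N.
  move=> [Ih Is Im] hD.
  have [|||||b [D' [hb hD' ->]]] := @qdim_split K S (form n) (I n) (@zeros _) _ _ _ _ _ _ (form_dim K n).
  - exact: form_subspace.
  - exact: Is.
  - exact: zeros_subspace.
  - by move=> x ->; case: (Is n).
  - exact: Ih.
  by exists b => //; rewrite (qdim_uniq (Is n) hD' hD).
have [g' hg' eJ] := splitI _ _ _ hJ hJd; have [b hb eB] := splitI _ _ _ hB hBd.
have eg' := qdim_uniq (@zeros_subspace _ _) hg' hg.
have ea := homog_syzygies_bourbaki_dim _ kj ha hb.
have {}ea : a = (sdim (t + e) + b)%N.
  rewrite ea; last by rewrite /j addnAC leq_addl.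
  by congr (sdim _ + _)%N; rewrite /j addnAC addnK.
move: (sdimE (j + e)) (sdimE j) (sdimE (t + e)) (sdimE k) eg eJ eB.
rewrite ea eg' /j /k; clear; clearbody t.
move: (sdim _) (sdim _) (sdim _) (sdim _) => s1 s2 s3 s4 h1 h2 h3 h4 h5 h6 h7; nia.
Qed.

End BourbakiDegree.

(** * Zeros of homogeneous ideals, and the Koszul complex of the variables *)

Section Zeros.
Variable K : numClosedFieldType.
Local Notation S := {mpoly K[3]}.
Implicit Types (g h q : S).

Definition zero_of (I : nat -> S -> Prop) (p : P2 K) : Prop :=
  forall k g, I k g -> g.@[coords p] = 0.

(** At a point outside the list the local length is zero, so [1] lies in the extended ideal, and
    some form of [I] does not vanish there. *)
Lemma finite_zeros I l k0 D : gideal I -> stable I l k0 D ->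
  exists pts : seq (P2 K), forall p, zero_of I p -> p \in pts.
Proof.
move=> hI st; have [pts _ hpts] := local_lengths hI st; exists pts => p Ip.
rewrite -has_pred1 has_count lt0n; apply/eqP => c0.
have h0 := hpts p; rewrite c0 in h0.
have : ext p I (tofrac (loc p 1)).
  by apply: (qdim0_sub h0); rewrite loc1; apply: local_ring_tofrac.
move=> /(ext_form hI (dhomog1 _ _)) [m [t [ht tp it]]].
by move: tp; rewrite -[t]mulr1 (Ip _ _ it) eqxx.
Qed.

(** The point of the eigenvalues [a] works: for [g] in [I], the product [g h] lies in [I] and equals
    [g(a) l^k h] modulo [I], so [g(a) = 0]. *)
Lemma zero_exists I l k0 D : gideal I -> stable I l k0 D -> (0 < D)%N ->
  exists p, zero_of I p.
Proof.
move=> hI st D0; have [Ih Is Im] := hI; have [hl _] := st.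
have [h [a [hh nh la ha]]] := nullstellensatz hI st D0.
have [i ai] : exists i, a i != 0.
  apply: contrapT => /forallNP na; move/eqP: la; apply/negP.
  rewrite (meval_eq _ (v2 := fun=> 0)) ?(meval_homog0 hl) 1?eq_sym ?oner_neq0 // => i.
  by have /negP/negPn/eqP := na i.
have [p [c [c0 ap]]] := P2_exists ai; exists p => k g ig.
have hg := Ih _ _ ig.
have hX j : 'X_j - a j *: l \is 1.-homog /\ I (1 + k0)%N (('X_j - a j *: l) * h).
  split; last by rewrite mulrBl -scalerAl add1n; apply: ha.
  by apply: dhomogD; rewrite ?dhomogN ?dhomogZ //; apply: homogX.
have [_] := gideal_eval (colon_gideal hI hh) hl hX hg.
rewrite mulrBl -scalerAl => igh.
have ga : g.@[a] = 0.
  apply/eqP/negPn/negP => ga; apply: nh.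
  have igh' : I (k + k0)%N (g * h) by rewrite addnC mulrC; apply: Im.
  have := subspaceB (Is _) igh' igh; rewrite subKr => /(subspaceZ (g.@[a])^-1 (Is _)).
  rewrite scalerA mulVf // scale1r {igh igh' hg ig}.
  elim: k => [|k ih]; first by rewrite expr0 mul1r.
  rewrite addSn exprS -mulrA => /(stable_cancel hI st (leq_addl _ _)) h'.
  by apply/ih/h'; apply: dhomogM => //; apply: homogX_exp.
apply: (mulfI (expf_neq0 k c0)); rewrite mulr0 -(meval_homog _ _ hg) -ga.
by apply: meval_eq => j; rewrite ap.
Qed.

Lemma poly_infinite_roots (p : {poly K}) : (forall x, x != 0 -> p.[x] = 0) -> p = 0.
Proof.
move=> hp; apply/eqP/negPn/negP => p0.
have [|x] := @poly_nonroot K ('X * p); first by rewrite mulf_neq0 // polyX_eq0.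
rewrite hornerM hornerX mulf_eq0 negb_or => /andP [x0].
by rewrite hp // eqxx.
Qed.

Definition line_poly (A B : 'I_3 -> K) g : {poly K} :=
  mmap polyC (fun i => A i *: 'X + (B i)%:P) g.

Lemma line_polyE A B g s : (line_poly A B g).[s] = g.@[fun i => A i * s + B i].
Proof.
elim/mpolyind: g => [|c m g _ _ ih].
  by rewrite /line_poly mmap0 horner0 meval0.
rewrite /line_poly mmapD hornerD mevalD; apply: (congr2 +%R); last exact: ih.
rewrite mmapZ mmapX hornerM hornerC mevalZ mevalX; congr (_ * _).
rewrite /mmap1 (big_morph (fun p => p.[s]) (fun a b => hornerM a b s) (hornerC 1 s)).
by apply: eq_bigr => i _; rewrite horner_exp hornerD hornerZ hornerX hornerC.
Qed.

(** Without a zero on the affine part of the line, [q] restricts to a nonzero constant [c] there. By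
    homogeneity it is [c u^(k+1)] in the other affine coordinate [u], so it vanishes at the
    remaining point [A]. *)
Lemma form_zero_on_line (A B : 'I_3 -> K) q k : q \is k.+1.-homog ->
  q.@[A] = 0 \/ exists s, q.@[fun i => A i * s + B i] = 0.
Proof.
move=> hq; apply: contrapT => /not_orP [qA /forallNP nq].
pose Q := line_poly A B q.
have : size Q == 1%N.
  by apply/negPn/negP => /closed_rootP [s /rootP]; rewrite line_polyE; apply: nq.
move=> /size_poly1P [c c0 eQ].
have : line_poly B A q - c *: 'X^(k.+1) = 0.
  apply: poly_infinite_roots => u u0; rewrite hornerD hornerN hornerZ hornerXn line_polyE.
  have -> : q.@[fun i => B i * u + A i] = u ^+ k.+1 * Q.[u^-1].
    rewrite line_polyE -(meval_homog _ _ hq); apply: meval_eq => i.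
    by field.
  by rewrite eQ hornerC mulrC subrr.
move=> /(congr1 (fun p : {poly K} => p.[0])).
rewrite hornerD hornerN hornerZ hornerXn expr0n mulr0 subr0 horner0 line_polyE => h; apply: qA.
by rewrite -h; apply: meval_eq => i; rewrite mulr0 add0r.
Qed.

(** In the family of lines [w_0 + t w_1 + t^2 w_2 = 0] each point lies on finitely many, so some
    line avoids [pts]; a curve of positive degree meets it. *)
Lemma infinite_zeros q k (pts : seq (P2 K)) : q \is k.+1.-homog ->
  exists2 p, p \notin pts & q.@[coords p] = 0.
Proof.
move=> hq; pose L (p : P2 K) : {poly K} :=
  (coords p ord0)%:P + coords p o1 *: 'X + coords p o2 *: 'X^2.
have L0 p : L p != 0.
  apply/eqP => Lp; have [j0 hj0] := coords_neq0 p; case/eqP: hj0; move: j0.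
  have h j := congr1 (fun P : {poly K} => P`_j) Lp.
  elim/ord3P; [have := h 0%N | have := h 1%N | have := h 2%N];
    by rewrite /= !coefD coefC !coefZ coefX coefXn coef0 /= ?mulr0 ?mulr1 ?addr0 ?add0r.
have [t] : exists t, (\prod_(p <- pts) L p).[t] != 0.
  by apply: poly_nonroot; rewrite prodf_seq_neq0; apply/allP => p _; apply: L0.
rewrite horner_prod prodf_seq_neq0 => /allP ht.
(* [A] and [B] span the line of parameter [t]. *)
pose A i : K := if i == ord0 then - t else if i == o1 then 1 else 0.
pose B i : K := if i == ord0 then - t ^+ 2 else if i == o1 then 0 else 1.
have [w [qw ww [i wi]]] : exists w : 'I_3 -> K,
    [/\ q.@[w] = 0, w ord0 + t * w o1 + t ^+ 2 * w o2 = 0 & exists i, w i != 0].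
  have [qA|[s qs]] := form_zero_on_line A B hq.
    exists A; split=> //; first by rewrite /A /=; ring.
    by exists o1; rewrite /A /= oner_neq0.
  exists (fun i => A i * s + B i); split=> //; first by rewrite /A /B /=; ring.
  by exists o2; rewrite /A /B /= mul0r add0r oner_neq0.
have [p [c [c0 wp]]] := P2_exists wi; exists p.
  apply/negP => ppts; have := ht p ppts.
  rewrite 2!hornerD hornerC !hornerZ hornerX hornerXn.
  apply/negP; rewrite negbK; apply/eqP; apply: (mulfI c0).
  by rewrite mulr0 -ww !wp; ring.
apply: (mulfI (expf_neq0 k.+1 c0)); rewrite mulr0 -(meval_homog _ _ hq) -qw.
by apply: meval_eq => j; rewrite wp.
Qed.

End Zeros.

Lemma ord3_symmetric (P : 'I_3 -> 'I_3 -> Prop) :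
  (forall i, P i i) -> (forall i j, P i j -> P j i) ->
  P ord0 o1 -> P o1 o2 -> P o2 ord0 -> forall i j, P i j.
Proof.
move=> refl sym p01 p12 p20.
elim/ord3P; elim/ord3P; by [exact: refl | exact: p01 | exact: p12 | exact: p20 |
  exact: sym p01 | exact: sym p12 | exact: sym p20].
Qed.

Lemma scaled_sub_eq (R : comNzRingType) n (x z p a b : R) (u v s : 'rV[R]_n) :
  x *: u - z *: v = p *: s -> p = x * a - z * b -> x *: (u - a *: s) = z *: (v - b *: s).
Proof.
move=> /rowP e ep; apply/rowP => k; have := e k; rewrite !mxE ep => ek.
apply/eqP; rewrite -subr_eq0; apply/eqP; rewrite -[RHS](subrr (x * u 0 k - z * v 0 k)) {2}ek; ring.
Qed.

Section Koszul.
Variable K : numClosedFieldType.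
Local Notation S := {mpoly K[3]}.
Implicit Types (a b c g h : S).

Definition restrict0 (i : 'I_3) (g : S) : S :=
  g \mPo [tuple (if j == i then 0 else 'X_j) | j < 3].

Lemma restrict0M i g h : restrict0 i (g * h) = restrict0 i g * restrict0 i h.
Proof. exact: rmorphM. Qed.

Lemma restrict0D i g h : restrict0 i (g + h) = restrict0 i g + restrict0 i h.
Proof. exact: comp_mpolyD. Qed.

Lemma restrict0X i j : restrict0 i 'X_j = if j == i then 0 else 'X_j.
Proof. by rewrite /restrict0 comp_mpolyXU -tnth_nth tnth_mktuple. Qed.

Lemma restrict0_mod i g : divides 'X_i (g - restrict0 i g).
Proof.
have modM x y : divides 'X_i (x - restrict0 i x) -> divides 'X_i (y - restrict0 i y) ->
    divides 'X_i (x * y - restrict0 i (x * y)).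
  move=> hx hy; rewrite restrict0M.
  have -> : x * y - restrict0 i x * restrict0 i y =
    (x - restrict0 i x) * y + restrict0 i x * (y - restrict0 i y) by ring.
  by apply: dividesD; [apply: divides_mulr | apply: divides_mull].
have mod1 : divides 'X_i (1 - restrict0 i 1).
  by rewrite /restrict0 comp_mpoly1 subrr; apply: divides0.
elim/mpolyind: g => [|c m g _ _ ih].
  by rewrite /restrict0 comp_mpoly0 subrr; apply: divides0.
have -> : c *: 'X_[m] + g - restrict0 i (c *: 'X_[m] + g) =
    c *: ('X_[m] - restrict0 i 'X_[m]) + (g - restrict0 i g).
  by rewrite restrict0D {1}/restrict0 comp_mpolyZ opprD addrACA scalerBr.
apply: dividesD => //; rewrite -mul_mpolyC; apply: divides_mull.
rewrite ['X_[m]]mpolyXE_id; apply: (big_ind (fun x => divides 'X_i (x - restrict0 i x))).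
- exact: mod1.
- exact: modM.
move=> j _; elim: (m j) => [|k ihk]; first exact: mod1.
rewrite exprS; apply: modM; last exact: ihk.
rewrite restrict0X; case: eqP => [->|_]; last by rewrite subrr; apply: divides0.
by rewrite subr0; apply: divides_refl.
Qed.

Lemma divides_variable i g : divides 'X_i g <-> restrict0 i g = 0.
Proof.
split=> [[h ->]|h]; first by rewrite restrict0M restrict0X eqxx mul0r.
by rewrite -[g]subr0 -h; apply: restrict0_mod.
Qed.

Lemma variable_prime_to i j g : i != j -> divides 'X_i ('X_j * g) -> divides 'X_i g.
Proof.
move=> ij /divides_variable; rewrite restrict0M restrict0X eq_sym (negbTE ij).
move/eqP; rewrite mulf_eq0 (negbTE (mpolyXU_neq0 _ _)) /= => /eqP.
by move/divides_variable.
Qed.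

(* Exactness of the Koszul complex of the variables in the middle. *)
Lemma koszul_exact a b c : 'X_ord0 * a + 'X_o1 * b + 'X_o2 * c = 0 ->
  exists u v w, [/\ a = 'X_o2 * v - 'X_o1 * w, b = 'X_ord0 * w - 'X_o2 * u &
                    c = 'X_o1 * u - 'X_ord0 * v].
Proof.
move=> h; pose r0 := @restrict0 ord0.
have [b' eb] := restrict0_mod ord0 b; have [c' ec] := restrict0_mod ord0 c.
have rel : 'X_o1 * r0 b + 'X_o2 * r0 c = 0.
  have := congr1 r0 h.
  rewrite /r0 !restrict0D !restrict0M !restrict0X /= mul0r add0r => ->.
  by rewrite /restrict0 comp_mpoly0.
have [u eu] : divides 'X_o2 (r0 b).
  apply: (@variable_prime_to o2 o1) => //; exists (- r0 c).
  by rewrite mulrN; apply/eqP; rewrite -addr_eq0 rel.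
have X0 i := mpolyXU_neq0 K i.
have ec0 : r0 c + 'X_o1 * u = 0.
  apply: (mulfI (X0 o2)); rewrite mulr0 -rel eu; ring.
have eb0 : b = 'X_o2 * u + 'X_ord0 * b' by rewrite -eu -eb addrC subrK.
have ec1 : c = 'X_ord0 * c' - 'X_o1 * u.
  by rewrite -ec -[RHS]addr0 -ec0 /r0; ring.
exists (- u), (- c'), b'; split.
- apply: (mulfI (X0 ord0)); apply/eqP; rewrite -subr_eq0 -h eb0 ec1; apply/eqP; ring.
- rewrite eb0; ring.
- rewrite ec1; ring.
Qed.

(** The coefficients [p] form a Koszul cycle because [s <> 0]. By exactness they come from
    coefficients [q i], and [y i = r i - q i s] satisfies [X_j y_i = X_i y_j], so every [y i] is
    [X_i] times one vector. This yields saturation of ideals, where [s] spans the kernel of the map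
    along which one lifts. *)
Lemma koszul_lift n (s : 'rV[S]_n) (r : 'I_3 -> 'rV[S]_n) : s != 0 ->
  (forall i j, exists p, 'X_j *: r i - 'X_i *: r j = p *: s) ->
  exists t q, forall i, r i = 'X_i *: t + q i *: s.
Proof.
move=> s0 h; have X0 i := mpolyXU_neq0 K i.
have [a ea] := h o1 o2; have [b eb] := h o2 ord0; have [c ec] := h ord0 o1.
have [k sk] : exists k, s 0 k != 0.
  apply: contrapT => /forallNP ns; case/eqP: s0; apply/rowP => k; rewrite mxE.
  by have /negP/negPn/eqP := ns k.
have [|u [v [w [ea' eb' ec']]]] := @koszul_exact a b c.
  apply: (mulIf sk); rewrite mul0r !mulrDl -!mulrA.
  have co x y z i j : x *: r i - y *: r j = z *: s -> z * s 0 k = x * r i 0 k - y * r j 0 k.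
    by move=> /rowP/(_ k); rewrite !mxE.
  have := co _ _ _ _ _ ea; have := co _ _ _ _ _ eb; have := co _ _ _ _ _ ec.
  move: (a * s 0 k) (b * s 0 k) (c * s 0 k) => x y z -> -> ->.
  move: (r ord0 0 k) (r o1 0 k) (r o2 0 k) ('X_ord0 : S) ('X_o1 : S) ('X_o2 : S) => *; ring.
pose q i := if i == ord0 then u else if i == o1 then v else w.
pose y i := r i - q i *: s.
have key i j : 'X_j *: y i = 'X_i *: y j.
  suff aux i' j' p : 'X_j' *: r i' - 'X_i' *: r j' = p *: s ->
      p = 'X_j' * q i' - 'X_i' * q j' -> 'X_j' *: y i' = 'X_i' *: y j'.
    have h01 := aux _ _ _ ec ec'; have h12 := aux _ _ _ ea ea'; have h20 := aux _ _ _ eb eb'.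
    apply: (ord3_symmetric (P := fun i j => 'X_j *: y i = 'X_i *: y j)).
    - by move=> i'; reflexivity.
    - by move=> i' j' e'; exact: (esym e').
    - exact: h01.
    - exact: h12.
    - exact: h20.
  exact: scaled_sub_eq.
have yE i : r i = y i + q i *: s by rewrite subrK.
clearbody y.
have [t et] : exists t, y ord0 = 'X_ord0 *: t.
  have /choice [z hz] k' : divides 'X_ord0 (y ord0 0 k').
    apply: (@variable_prime_to ord0 o1); first exact: isT.
  by exists (y o1 0 k'); have /rowP/(_ k') := key ord0 o1; rewrite mxE [in RHS]mxE.
  exists (\row_k' z k'); apply/rowP => k'; rewrite mxE mxE; exact: hz.
exists t, q => i; rewrite yE; congr (_ + _).
apply/rowP => k'; apply: (mulfI (X0 ord0)).
have /rowP/(_ k') := key i ord0; rewrite et scalerA !mxE => ->.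
by rewrite mulrA [_ * 'X_ord0]mulrC.
Qed.

End Koszul.

(** * Minimal generators *)

Section Generators.
Variable K : numClosedFieldType.
Local Notation S := {mpoly K[3]}.
Local Notation row := 'rV[S]_3.
Variable f : S.
Implicit Types (r s : row).

Definition spans_AR m (rho : 'I_m -> row) : Prop :=
  forall s, AR f s <-> exists c : 'I_m -> S, s = \sum_i c i *: rho i.

Lemma spans_AR_gen m (rho : 'I_m -> row) i : spans_AR rho -> AR f (rho i).
Proof.
move=> h; apply/h; exists (fun k => (k == i)%:R).
by rewrite (bigD1 i) //= eqxx scale1r big1 ?addr0 // => j /negbTE ->; rewrite scale0r.
Qed.

Lemma AR_sum m (P : pred 'I_m) (rho : 'I_m -> row) (c : 'I_m -> S) :
  (forall i, AR f (rho i)) -> AR f (\sum_(i | P i) c i *: rho i).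
Proof.
move=> h; elim/big_ind: _ => [|x y|i _]; [exact: AR_0 | exact: AR_D | exact: AR_Z].
Qed.

Lemma spans_of_gens m (rho : 'I_m -> row) : (forall i, AR f (rho i)) ->
  (forall s, AR f s -> exists c : 'I_m -> S, s = \sum_i c i *: rho i) -> spans_AR rho.
Proof. by move=> h1 h2 s; split=> [/h2 //|[c ->]]; apply: AR_sum. Qed.

Lemma pihomog0 (p : S) : pihomog mdeg 0 p = (p@_0%MM)%:MP.
Proof.
rewrite (homog0_const (pihomogP mdeg 0 p)); congr _%:MP.
rewrite pihomogE raddf_sum /= big_mkcond /=.
case: (boolP (0%MM \in msupp p)) => [p0|p0].
  rewrite (bigD1_seq 0%MM) //= mdeg0 eqxx mcoeffZ mcoeffX eqxx mulr1 big1 ?addr0 // => m m0.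
  by rewrite mdeg_eq0 (negbTE m0).
rewrite big_seq big1 ?(memN_msupp_eq0 p0) // => m mp; rewrite mdeg_eq0.
by case: eqP => // m0; rewrite m0 (negbTE p0) in mp.
Qed.

(** Graded Nakayama: in the component of degree [deg k] of the relation, the coefficient of [rho k]
    is its nonzero constant term, so [rho k] is a combination of the others. *)
Lemma redundant_generator m (rho : 'I_m -> row) (deg : 'I_m -> nat) (D : 'I_m -> S) k :
  spans_AR rho -> (forall i, homog_triple (deg i) (rho i)) ->
  \sum_j D j *: rho j = 0 -> (D k)@_0%MM != 0 ->
  generates_AR f rho ([set: 'I_m] :\ k)%SET.
Proof.
move=> hsp hdeg rel Dk; set a := (D k)@_0%MM in Dk.
pose E j := if (deg j <= deg k)%N then pihomog mdeg (deg k - deg j) (D j) else 0.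
have relE : \sum_j E j *: rho j = 0.
  apply/rowP => l; rewrite summxE mxE.
  have /rowP/(_ l) := rel; rewrite summxE mxE => /(congr1 (pihomog mdeg (deg k))).
  rewrite raddf_sum raddf0 => h0; rewrite -[RHS]h0; apply: eq_bigr => j _ /=; rewrite !mxE /E.
  case: leqP => [le|lt]; last by rewrite mul0r (pihomogMr_lt _ (hdeg j l)).
  by rewrite -[in RHS](subnK le) (pihomogMr _ _ (hdeg j l)).
have Ek : E k = a%:MP by rewrite /E leqnn subnn pihomog0.
have rk : rho k = \sum_(j | j != k) (- a^-1%:MP * E j) *: rho j.
  move: relE; rewrite (bigD1 k) //= Ek => /eqP; rewrite addr_eq0 => /eqP e1.
  have -> : rho k = a^-1%:MP *: (a%:MP *: rho k).
    by rewrite scalerA -mpolyCM mulVf // mpolyC1 scale1r.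
  by rewrite e1 scalerN -scaleNr scaler_sumr; apply: eq_bigr => j _; rewrite scalerA.
have inI j : (j \in ([set: 'I_m] :\ k)%SET) = (j != k) by rewrite !inE andbT.
move=> s; split=> [/hsp [c ->]|[c ->]].
  exists (fun j => c j - c k * (a^-1%:MP * E j)).
  rewrite (bigD1 k) //= rk scaler_sumr -big_split /=.
  rewrite [RHS](eq_bigl _ _ inI); apply: eq_bigr => j _.
  by rewrite scalerA -scalerDl; congr (_ *: _); ring.
by apply: AR_sum => i; apply: spans_AR_gen.
Qed.

(** Constant terms of the two transition matrices: were their product not the identity, some
    relation would have a coefficient with nonzero constant term; and the identity of size [m] does
    not factor through size [n < m]. The family [sigma] need not be homogeneous. *)
Lemma minimal_generators_leq m (rho : 'I_m -> row) (deg : 'I_m -> nat) n (sigma : 'I_n -> row) :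
  minimal_generators f rho -> (forall i, homog_triple (deg i) (rho i)) ->
  spans_AR sigma -> (m <= n)%N.
Proof.
move=> [gen irr] hdeg hsig; rewrite leqNgt; apply/negP => nm.
have hrho : spans_AR rho.
  move=> s; split=> [/gen [c ->]|[c ->]]; first by exists c; apply: eq_bigl => i; rewrite inE.
  by apply/gen; exists c; apply: eq_bigl => i; rewrite inE.
have /choice [A hA] j : exists a : 'I_m -> S, sigma j = \sum_i a i *: rho i.
  by apply/hrho; apply: spans_AR_gen.
have /choice [B hB] i : exists b : 'I_n -> S, rho i = \sum_j b j *: sigma j.
  by apply/hsig; apply: spans_AR_gen.
pose C i k := \sum_j B i j * A j k.
have rel i : \sum_k ((i == k)%:R - C i k) *: rho k = 0.
  under eq_bigr do rewrite scalerBl.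
  rewrite sumrB (bigD1 i) //= eqxx scale1r big1 ?addr0; last first.
    by move=> k /negbTE ki; rewrite eq_sym ki scale0r.
  apply/eqP; rewrite subr_eq0 {1}hB; apply/eqP.
  under [RHS]eq_bigr do rewrite /C scaler_suml.
  rewrite exchange_big; apply: eq_bigr => j _; rewrite hA scaler_sumr.
  by apply: eq_bigr => k _; rewrite scalerA.
pose mA := \matrix_(j, k) (A j k)@_0%MM; pose mB := \matrix_(i, j) (B i j)@_0%MM.
have [BA|nBA] := eqVneq (mB *m mA) 1%:M.
  by have := mulmx1_min BA; rewrite leqNgt nm.
have [i [k ik]] : exists i k, (((i == k)%:R - C i k)@_0%MM != 0).
  apply: contrapT => nik; case/eqP: nBA; apply/matrixP => i k; apply/eqP/negPn/negP => ne.
  apply: nik; exists i, k; rewrite mcoeffB subr_eq0 eq_sym; apply: contraNneq ne.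
  rewrite /C raddf_sum /= !mxE => h; apply/eqP; transitivity (((i == k)%:R : S)@_0%MM); last first.
    by case: (i == k); rewrite ?mcoeff0 ?mcoeff1 ?eqxx.
  rewrite -h; apply: eq_bigr => j _; rewrite !mxE.
  by have [-> _] := mcoeff0_is_multiplicative 3 K.
have /irr := redundant_generator hrho hdeg (rel i) ik.
by move/setP/(_ k); rewrite !inE eqxx.
Qed.

End Generators.

(** * Exponents and the Bourbaki ideal *)

Section Exchange.
Variable K : numClosedFieldType.
Local Notation S := {mpoly K[3]}.
Local Notation row := 'rV[S]_3.
Variable f : S.
Implicit Types (r s : row).

Lemma spans_of_minimal m (rho : 'I_m -> row) : minimal_generators f rho -> spans_AR f rho.
Proof.
move=> [gen _] s; split=> [/gen [c ->]|[c ->]].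
  by exists c; apply: eq_bigl => i; rewrite inE.
by apply/gen; exists c; apply: eq_bigl => i; rewrite inE.
Qed.

Lemma minimal_of_leq m (rho : 'I_m -> row) : spans_AR f rho ->
  (forall n (sigma : 'I_n -> row), spans_AR f sigma -> (m <= n)%N) -> minimal_generators f rho.
Proof.
move=> hsp hleq; split.
  move=> s; split=> [/hsp [c ->]|[c ->]].
    by exists c; apply: eq_bigl => i; rewrite inE.
  by apply/hsp; exists c; apply: eq_bigl => i; rewrite inE.
move=> I gI; apply/eqP; rewrite eqEcard finset.subsetT /= cardsT card_ord.
apply: (hleq _ (fun j => rho (enum_val j))) => s; split.
  by move=> /gI [c ->]; exists (fun j => c (enum_val j)); rewrite big_enum_val.
move=> [c ->]; apply: AR_sum => j; exact: spans_AR_gen.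
Qed.

(** The second conjunct guards against truncated subtraction: for [k < deg i] the first one alone
    would allow constants. *)
Lemma homog_combination m (rho : 'I_m -> row) (deg : 'I_m -> nat) s k :
  spans_AR f rho -> (forall i, homog_triple (deg i) (rho i)) -> AR f s -> homog_triple k s ->
  exists2 c : 'I_m -> S, s = \sum_i c i *: rho i &
    forall i, c i \is (k - deg i).-homog /\ ((k < deg i)%N -> c i = 0).
Proof.
move=> hsp hdeg /hsp [c ->] hk.
exists (fun i => if (deg i <= k)%N then pihomog mdeg (k - deg i) (c i) else 0); last first.
  by move=> i; case: leqP => // _; split=> //; [apply: pihomogP | apply: dhomog0].
apply/rowP => l; rewrite -[LHS](pihomog_dE (hk l)) !summxE raddf_sum.
apply: eq_bigr => i _ /=; rewrite !mxE; case: leqP => [le|lt].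
  by rewrite -{1}(subnK le) (pihomogMr _ _ (hdeg i l)).
by rewrite mul0r (pihomogMr_lt _ (hdeg i l)).
Qed.

(** The given [r1] need not be one of the chosen generators. By minimality of its degree it involves
    some generator [rho i] of the same degree with a nonzero constant coefficient; [r1] takes the
    place [i0], and the former generator [rho i0] moves to the place vacated by [rho i]. *)
Lemma exchange_generator m (rho : 'I_m -> row) (deg : 'I_m -> nat) (i0 : 'I_m) r1 :
  minimal_generators f rho -> (forall i, homog_triple (deg i) (rho i)) ->
  (forall i, deg i0 <= deg i)%N -> AR f r1 -> r1 != 0 -> homog_triple (deg i0) r1 ->
  exists rho' : 'I_m -> row, [/\ minimal_generators f rho',
    forall i, homog_triple (deg i) (rho' i) & rho' i0 = r1].
Proof.
move=> hmin hdeg hle hr1 r10 h1; have hsp := spans_of_minimal hmin.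
have [c ec hc] := homog_combination hsp hdeg hr1 h1.
have [i ci] : exists i, c i != 0.
  apply: contrapT => /forallNP nc; case/eqP: r10; rewrite ec big1 // => i _.
  by have /negP/negPn/eqP -> := nc i; rewrite scale0r.
have degi : deg i = deg i0.
  have [_ c0] := hc i; apply/eqP; rewrite eqn_leq hle andbT leqNgt; apply/negP => /c0 ci0.
  by rewrite ci0 eqxx in ci.
have [a a0 ea] : exists2 a, a != 0 & c i = a%:MP.
  have [] := hc i; rewrite degi subnn => /homog0_const e1 _; exists (c i)@_0%MM => //.
  by apply: contra_neq ci => c0; rewrite e1 c0 mpolyC0.
pose rho' j := if j == i0 then r1 else rho (tperm i0 i j).
exists rho'; split; last by rewrite /rho' eqxx.
  have hspan : spans_AR f rho'.
    apply: spans_of_gens => [j|s].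
      by rewrite /rho'; case: ifP => _ //; apply: spans_AR_gen.
    have hD x y : (exists b, x = \sum_j b j *: rho' j) -> (exists b, y = \sum_j b j *: rho' j) ->
        exists b, x + y = \sum_j b j *: rho' j.
      move=> [b ->] [b' ->]; exists (fun j => b j + b' j); rewrite -big_split /=.
      by apply: eq_bigr => j _; rewrite scalerDl.
    have hZ t x : (exists b, x = \sum_j b j *: rho' j) -> exists b, t *: x = \sum_j b j *: rho' j.
      move=> [b ->]; exists (fun j => t * b j); rewrite scaler_sumr.
      by apply: eq_bigr => j _; rewrite scalerA.
    have hG j : exists b, rho' j = \sum_j b j *: rho' j.
      exists (fun k => (k == j)%:R); rewrite (bigD1 j) //= eqxx scale1r big1 ?addr0 // => k /negbTE ->.
      by rewrite scale0r.
    have h0 : exists b, 0 = \sum_j b j *: rho' j.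
      by exists (fun=> 0); rewrite big1 // => j _; rewrite scale0r.
    have hne j : j != i -> exists b, rho j = \sum_j b j *: rho' j.
      move=> ji; have := hG (tperm i0 i j); rewrite {1}/rho' tpermK.
      case: eqP => [e1|//]; case/eqP: ji.
      by rewrite -(tpermK i0 i j) e1 tpermL.
    have hi : exists b, rho i = \sum_j b j *: rho' j.
      have -> : rho i = a^-1%:MP *: (r1 + (-1) *: (\sum_(j | j != i) c j *: rho j)).
        rewrite ec (bigD1 i) //= scaleN1r addrK ea scalerA -mpolyCM mulVf // mpolyC1.
        by rewrite scale1r.
      apply: (hZ); apply: (hD); first by have := hG i0; rewrite {1}/rho' eqxx.
      by apply: (hZ); elim/big_ind: _ => // j ji; apply: (hZ); exact: hne.
    move=> /hsp [b ->]; elim/big_ind: _ => // j _; apply: (hZ).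
    by case: (eqVneq j i) => [->|]; [exact: hi | exact: hne].
  apply: minimal_of_leq hspan _ => n sigma; exact: minimal_generators_leq hmin hdeg.
move=> j; rewrite /rho'; case: eqP => [-> //|/eqP ji0].
case: tpermP => [e1|->|_ _]; [by rewrite e1 eqxx in ji0 | by rewrite degi | exact: hdeg].
Qed.

End Exchange.

(** * Bounds for the codimension of the Bourbaki ideal *)

Section Main.
Variable K : numClosedFieldType.
Local Notation S := {mpoly K[3]}.
Local Notation row := 'rV[S]_3.
Variables (f : S) (e m : nat) (deg : 'I_m -> nat) (rho : 'I_m -> row) (i0 i1 i2 : 'I_m).
Hypotheses (hf : f \is e.+1.-homog) (sf : squarefree f).
Hypotheses (rho_min : minimal_generators f rho) (rho_homog : forall i, homog_triple (deg i) (rho i)).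
Hypotheses (m_gt2 : (2 < m)%N) (hi0 : i0 = 0%N :> nat) (hi1 : i1 = 1%N :> nat) (hi2 : i2 = 2%N :> nat).
Hypothesis deg_mono : forall i j : 'I_m, (i <= j)%N -> (deg i <= deg j)%N.

Let r1 := rho i0.
Let d1 := deg i0.
Let rho_spans : spans_AR f rho := spans_of_minimal rho_min.
Let hB := bourbaki_piece_gideal f r1.
Let r1_AR : AR f r1. Proof. exact: spans_AR_gen. Qed.
Let r1_homog : homog_triple d1 r1 := rho_homog i0.

Let f_neq0 : f != 0 := squarefree_neq0 sf.

Lemma rho_irredundant (D : 'I_m -> S) k : \sum_j D j *: rho j = 0 -> (D k)@_0%MM = 0.
Proof.
move=> rel; apply/eqP/negPn/negP => Dk; have [_ irr] := rho_min.
have /irr := redundant_generator rho_spans rho_homog rel Dk.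
by move/setP/(_ k); rewrite !inE eqxx.
Qed.

Lemma rho_neq0 i : rho i != 0.
Proof.
apply/eqP => ri; have := @rho_irredundant (fun j => (j == i)%:R) i.
rewrite eqxx mcoeff1 eqxx (bigD1 i) //= ri scaler0 big1 ?addr0; last first.
  by move=> j /negbTE ->; rewrite scale0r.
by move=> /(_ erefl)/eqP; rewrite oner_eq0.
Qed.

Lemma min_degree s k : AR f s -> s != 0 -> homog_triple k s -> (d1 <= k)%N.
Proof.
move=> hs s0 hk; have [c ec hc] := homog_combination rho_spans rho_homog hs hk.
rewrite leqNgt; apply/negP => kd; case/eqP: s0; rewrite ec big1 // => i _.
have [_ ->] := hc i; first by rewrite scale0r.
by apply: leq_trans kd _; apply: deg_mono; rewrite hi0.
Qed.

(** A common prime factor would be homogeneous of positive degree, and dividing by it would give a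
    syzygy of degree below [d1]. *)
Lemma r1_coprime : coprime_family (fun i => r1 0 i).
Proof.
move=> q [q0 qu pq] /choice [c hc].
have [i ri] : exists i, r1 0 i != 0.
  apply: contrapT => /forallNP nr; case/eqP: (rho_neq0 i0); apply/rowP => i; rewrite mxE.
  by have /negP/negPn/eqP := nr i.
have [u [v [hq hc' duv]]] : exists u v, [/\ q \is u.-homog, c i \is v.-homog & d1 = (u + v)%N].
  by apply: homog_factor; rewrite -hc //; apply: r1_homog.
have u0 : (0 < u)%N.
  by case: u hq {duv} => // hq; rewrite homog0_unit in qu.
pose r' : row := \row_j c j.
have hr' : AR f r'.
  rewrite /AR /=; apply: (mulfI q0); rewrite mulr0.
  have := r1_AR; rewrite /AR /= => e1; rewrite -[RHS]e1 mulr_sumr; apply: eq_bigr => j _.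
  by rewrite mxE mulrA -hc.
have r'0 : r' != 0.
  apply: contra_neq ri => /rowP/(_ i); rewrite !mxE hc => ->; exact: mulr0.
have /(min_degree hr' r'0) : homog_triple v r'.
  by move=> j; rewrite mxE; apply: (homog_divl q0 hq); rewrite mulrC -hc addnC -duv; apply: r1_homog.
by rewrite duv leqNgt -{1}[v]add0n ltn_add2r u0.
Qed.

Let cop := r1_coprime.

Lemma Delta_sub r s a b h h' : Delta r1 r = h * f -> Delta r1 s = h' * f ->
  Delta r1 (a *: r - b *: s) = (a * h - b * h') * f.
Proof. by move=> hr hs; rewrite -scaleNr Delta_linear hr hs; ring. Qed.

(* [AR f] is generated by [r1] and lifts of generators of the Bourbaki ideal. *)
Lemma generators_from_bourbaki n (s : 'I_n -> row) (h : 'I_n -> S) :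
  (forall i, AR f (s i)) -> (forall i, Delta r1 (s i) = h i * f) ->
  (forall g, bourbaki f r1 g -> exists c : 'I_n -> S, g = \sum_i c i * h i) -> (m <= n.+1)%N.
Proof.
move=> hs hD hg; pose sigma : 'I_n.+1 -> row := fun i => if unlift ord0 i is Some j then s j else r1.
apply: (minimal_generators_leq (sigma := sigma) rho_min rho_homog).
apply: spans_of_gens => [i|r hr]; first by rewrite /sigma; case: unlift.
have [g bg eg] := bourbaki_exists hf sf r1_AR hr; have [c ec] := hg g bg.
have hsum : AR f (\sum_i c i *: s i) by apply: AR_sum.
have Dsum : Delta r1 (\sum_i c i *: s i) = g * f.
  rewrite ec mulr_suml Delta_cross; under eq_bigr => i _.
    have -> : cross r1 (\sum_j c j *: s j) i = \sum_j c j * cross r1 (s j) i.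
      rewrite (big_morph (fun x => cross r1 x i) (fun x y => crossD r1 x y i) (_ : cross r1 0 i = 0)).
        by apply: eq_bigr => j _; rewrite crossZ.
      by rewrite -(scale0r r1) crossZ mul0r.
    rewrite mulr_sumr; over.
  rewrite exchange_big; apply: eq_bigr => j _ /=.
  by rewrite -mulrA -hD Delta_cross mulr_sumr; apply: eq_bigr => i _; rewrite mulrCA.
have D0 : Delta r1 (r - \sum_i c i *: s i) = 0.
  have := Delta_sub 1 1 eg Dsum; rewrite !scale1r => ->; ring.
have hd : AR f (r - \sum_i c i *: s i).
  by rewrite -scaleN1r; apply: AR_D => //; apply: AR_Z.
have [p ep] := Delta_eq0 hf sf r1_AR cop hd D0.
exists (fun i => if unlift ord0 i is Some j then c j else p).
rewrite big_ord_recl /sigma unlift_none.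
under eq_bigr do rewrite liftK.
by rewrite -ep subrK.
Qed.

(** If [1] were an image, [r1] and one lift would generate [AR f]; this is the free case, excluded
    by [2 < m]. *)
Lemma not_bourbaki1 : ~ bourbaki f r1 1.
Proof.
move=> [s hs es].
have := @generators_from_bourbaki 1 (fun=> s) (fun=> 1) (fun=> hs) (fun=> es).
rewrite leqNgt m_gt2 => h; suff : false by []; apply: h => g _.
by exists (fun=> g); rewrite big_ord1 mulr1.
Qed.

Lemma bourbaki_homog0 h : bourbaki f r1 h -> h \is 0.-homog -> h = 0.
Proof.
move=> bh h0; apply/eqP/negPn/negP => hn; apply: not_bourbaki1.
have /mulVr <- := homog0_unit hn h0; exact: bourbakiM.
Qed.

Lemma d1_gt0 : (0 < d1)%N.
Proof.
rewrite lt0n; apply/eqP => d10; have [i ri] := coprime_family_neq0 cop.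
have [h bh] := bourbaki_koszul hf r1_AR r1_homog i.
by rewrite (bourbaki_homog0 bh) ?eqxx // in ri; rewrite d10 in h.
Qed.

(** For lifts [r i] of the [X_i h], each [X_j r_i - X_i r_j] lies in the kernel [S r1]; the Koszul
    argument corrects them to [X_i t], and [t] lifts [h]. *)
Lemma bourbaki_saturated h : (forall i, bourbaki f r1 ('X_i * h)) -> bourbaki f r1 h.
Proof.
move=> hX; have /choice [r hr] i : exists r, AR f r /\ Delta r1 r = 'X_i * h * f.
  by have [r] := hX i; exists r.
have [|t [q rt]] := koszul_lift (s := r1) (r := r) (rho_neq0 i0).
  move=> i j; have [hi ei] := hr i; have [hj ej] := hr j.
  apply: (Delta_eq0 hf sf r1_AR cop).
    by rewrite -scaleNr; apply: AR_D; apply: AR_Z.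
  rewrite (Delta_sub _ _ ei ej); ring.
have X0 := mpolyXU_neq0 K ord0.
have eXt : 'X_ord0 *: t = 1 *: r ord0 - q ord0 *: r1 by rewrite scale1r rt addrK.
have [h0 e0] := hr ord0.
exists t.
  apply: (mulfI X0); rewrite mulr0.
  have : AR f ('X_ord0 *: t) by rewrite eXt scale1r -scaleNr; apply: AR_D => //; apply: AR_Z.
  rewrite /AR /= => e1; rewrite -[RHS]e1 mulr_sumr; apply: eq_bigr => i _.
  by rewrite mxE mulrA.
apply: (mulfI X0).
have -> : 'X_ord0 * Delta r1 t = Delta r1 ('X_ord0 *: t).
  by rewrite !Delta_cross mulr_sumr; apply: eq_bigr => i _; rewrite crossZ mulrCA.
have D1 : Delta r1 r1 = 0 * f by rewrite mul0r -[X in Delta _ X]scale1r Delta_scale.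
rewrite eXt (Delta_sub _ _ e0 D1); ring.
Qed.

(** Stability holds because the coprime components of [r1] lie in the ideal. Were the codimension
    zero, all forms of degree [k0] would be in the ideal, and saturation would descend from them to
    [1]. *)
Lemma bourbaki_stable : exists l k0 delta,
  stable (bourbaki_piece f r1) l k0 delta /\ (0 < delta)%N.
Proof.
have ed : d1 = d1.-1.+1 by rewrite prednK // d1_gt0.
have [|l [k0 [delta st]]] := stable_of_coprime_family (k := d1.-1) hB _ cop.
  by move=> i; rewrite -ed; apply: (bourbaki_koszul hf r1_AR r1_homog i).
exists l, k0, delta; split=> //; rewrite lt0n; apply/eqP => d0.
have [_ st'] := st; have [hD _] := st' k0 (leqnn _); rewrite d0 in hD.
suff h n : (forall h, h \is n.-homog -> bourbaki f r1 h) -> bourbaki f r1 1.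
  by apply: not_bourbaki1; apply: (h k0) => g hg; have [] := qdim0_sub hD hg.
elim: n => [|n ih] hn; first by apply: hn; apply: dhomog1.
apply: ih => g hg; apply: bourbaki_saturated => i; apply: hn.
by apply: homog_mul1 => //; apply: homogX.
Qed.

(** [h2] is nonzero because by minimality [rho i1] is not a multiple of [r1], and not constant
    because [1] is not in the ideal. *)
Lemma second_generator : exists h2 e2, [/\ (e2 + e = d1 + deg i1)%N, (0 < e2)%N,
  bourbaki_piece f r1 e2 h2, h2 != 0 & Delta r1 (rho i1) = h2 * f].
Proof.
have hr : AR f (rho i1) by apply: spans_AR_gen.
have [h bh eh] := bourbaki_exists hf sf r1_AR hr.
have h0 : h != 0.
  apply/eqP => h0; rewrite h0 mul0r in eh.
  have [p ep] := Delta_eq0 hf sf r1_AR cop hr eh.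
  have i01 : i1 != i0 by rewrite -val_eqE /= hi0 hi1.
  pose D j : S := if j == i1 then 1 else if j == i0 then - p else 0.
  have D1 : D i1 = 1 by rewrite /D eqxx.
  have D0 : D i0 = - p by rewrite /D eq_sym (negbTE i01) eqxx.
  have := @rho_irredundant D i1; rewrite D1 mcoeff1 eqxx.
  rewrite (bigD1 i1) //= (bigD1 i0) /=; last by rewrite eq_sym.
  rewrite D1 D0 scale1r scaleNr ep addrA subrr add0r big1 => [|j /andP [/negbTE j1 /negbTE j0]].
    by move=> /(_ erefl)/eqP; rewrite oner_eq0.
  by rewrite /D j1 j0 scale0r.
have hD : h * f \is (d1 + deg i1).+1.-homog.
  rewrite -eh Delta_cross; apply: rpred_sum => i _; apply: homog_mul1; first exact: homogX.
  by apply: cross_homog.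
have le : (e <= d1 + deg i1)%N.
  rewrite leqNgt; apply/negP => lt; case/eqP: h0.
  by apply: (homog_divl_lt hf hD).
have hh : h \is (d1 + deg i1 - e).-homog.
  by apply: (homog_divl f_neq0 hf); rewrite addnS subnK.
exists h, (d1 + deg i1 - e)%N; split=> //; first by rewrite subnK.
rewrite lt0n; apply/eqP => z; rewrite z in hh.
by rewrite (bourbaki_homog0 bh hh) eqxx in h0.
Qed.

(** A prime dividing [h2] and the whole piece of degree [k] would give infinitely many base points,
    as a plane curve has infinitely many points. *)
Lemma regular_partner (h2 : S) e2 k (pts : seq (P2 K)) : h2 != 0 -> h2 \is e2.-homog -> (0 < e2)%N ->
  (forall p, (forall h, bourbaki_piece f r1 k h -> h.@[coords p] = 0) -> p \in pts) ->
  exists h', [/\ bourbaki_piece f r1 k h', h' != 0 & regular h2 h'].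
Proof.
move=> h20 hh2 e20 hpts; have [_ Bs _] := hB.
have [q hq [c ec]|h' bh' reg] := @regular_pair_exists 3 K h2 (bourbaki_piece f r1 k) h20 (Bs k).
  have [q0 qu _] := hq; apply: contrapT => nq.
  have [u [_ [hu _ _]]] : exists u v, [/\ q \is u.-homog, c \is v.-homog & e2 = (u + v)%N].
    by apply: homog_factor; rewrite -ec.
  case: u hu => [|u] hu; first by rewrite homog0_unit in qu.
  have [p pp qp] := infinite_zeros pts hu; case/negP: pp; apply: hpts => h bh.
  have [b ->] : divides q h by apply: contrapT => nh; apply: nq; exists h.
  by rewrite mevalM qp mul0r.
exists h'; split=> //; apply: (regular_neq0 h20 _ reg).
by case: e2 e20 hh2 => // n _ hn; exact: homog_nonunit h20 hn.
Qed.

Lemma bourbaki_from_pieces (n : nat) (h : 'I_n -> S) :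
  (forall k g, bourbaki_piece f r1 k g -> exists c : 'I_n -> S, g = \sum_i c i * h i) ->
  forall g, bourbaki f r1 g -> exists c : 'I_n -> S, g = \sum_i c i * h i.
Proof.
move=> hp g bg; rewrite [g](@pihomog_partitionE _ _ mdeg (msize g)) //.
elim/big_ind: _ => [|x y [c ->] [c' ->]|k _].
- by exists (fun=> 0); rewrite big1 // => i _; rewrite mul0r.
- exists (fun i => c i + c' i); rewrite -big_split /=.
  by apply: eq_bigr => i _; rewrite mulrDl.
- by apply: (hp k); apply: (bourbaki_pihomog hf sf r1_AR r1_homog).
Qed.

(** The syzygies of a regular pair are the multiples of [s = (h', - h2)], so the Koszul argument
    applies to the coefficient vectors of the [X_i g]. *)
Lemma regular_ideal_saturated (h2 h' g : S) : h2 != 0 -> h' != 0 -> regular h2 h' ->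
  (forall i, exists a b, 'X_i * g = a * h2 + b * h') -> exists a b, g = a * h2 + b * h'.
Proof.
move=> h20 h'0 reg hX; pose s : 'rV[S]_2 := \row_i (if i == ord0 then h' else - h2).
have s0 : s != 0.
  by apply: contra_neq h'0 => /rowP/(_ ord0); rewrite !mxE eqxx.
have /choice [r hr] i : exists r : 'rV[S]_2, 'X_i * g = r 0 ord0 * h2 + r 0 ord_max * h'.
  have [a [b ->]] := hX i; exists (\row_i (if i == ord0 then a else b)).
  by rewrite !mxE eqxx.
have [i j|t [q rt]] := koszul_lift (r := r) s0.
  pose A := 'X_j * r i 0 ord0 - 'X_i * r j 0 ord0.
  pose B := 'X_j * r i 0 ord_max - 'X_i * r j 0 ord_max.
  have AB : A * h2 = - B * h'.
    apply/eqP; rewrite -subr_eq0; apply/eqP.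
    transitivity ('X_j * (r i 0 ord0 * h2 + r i 0 ord_max * h') -
      'X_i * (r j 0 ord0 * h2 + r j 0 ord_max * h')); first by rewrite /A /B; ring.
    by rewrite -!hr; ring.
  have [p ep] := reg _ _ AB; exists p; apply/rowP => k; rewrite !mxE.
  case: (unliftP ord0 k) => [k' ->|->].
    rewrite ord1 (_ : lift ord0 ord0 = ord_max); last by apply: val_inj.
    transitivity B => //=; rewrite -[B]opprK ep; ring.
  by rewrite eqxx; apply: (mulIf h20); rewrite -/A AB ep; ring.
exists (t 0 ord0), (t 0 ord_max); apply: (mulfI (mpolyXU_neq0 K ord0)).
by rewrite hr rt !mxE /=; ring.
Qed.

Lemma homog_two_combination (h2 h' g a b : S) e2 k' j : h2 \is e2.-homog -> h' \is k'.-homog ->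
  g \is (j + e2 + k').-homog -> g = a * h2 + b * h' ->
  combinations h2 h' (j + k') (j + e2) g.
Proof.
move=> hh2 hh' hg eg.
exists (pihomog mdeg (j + k') a), (pihomog mdeg (j + e2) b); split; try exact: pihomogP.
rewrite -(pihomogMr _ _ hh2) -(pihomogMr _ _ hh') [(j + k' + e2)%N]addnAC -pihomogD -eg.
by rewrite pihomog_dE.
Qed.

Section Partner.
Variables (h2 h' : S) (e2 k' : nat).
Hypotheses (bh2 : bourbaki_piece f r1 e2 h2) (h20 : h2 != 0) (e20 : (0 < e2)%N).
Hypotheses (bh' : bourbaki_piece f r1 k' h') (h'0 : h' != 0) (reg : regular h2 h').
Variables (l : S) (k0 delta : nat).
Hypothesis st : stable (bourbaki_piece f r1) l k0 delta.

Lemma combinations_bourbaki j x : combinations h2 h' (j + k') (j + e2) x ->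
  bourbaki_piece f r1 (j + e2 + k') x.
Proof.
have [Bh Bs Bm] := hB; move=> [a [b [ha hb ->]]]; apply: subspaceD => //.
  by rewrite addnAC; apply: Bm.
exact: Bm.
Qed.

(** Valid for any regular pair in the ideal: besides [h2] and its partner, it is applied to two
    forms of degree [d1 - 1] in the case of lines. *)
Lemma delta_leq : (delta <= e2 * k')%N.
Proof.
have [Bh Bs Bm] := hB; have [_ st'] := st.
have le : (k0 <= k0 + e2 + k')%N by rewrite -addnA leq_addr.
have [hD _] := st' _ le.
have hc := combinations_dim k0 h20 h'0 (Bh _ _ bh2) (Bh _ _ bh') reg.
have [D Dle hD'] := qdim_quot (Bs _) (@combinations_bourbaki k0) hc.
by rewrite (qdim_uniq (Bs _) hD hD').
Qed.

(** Equal codimensions make the ideal coincide with [(h2, h')] in large degrees, and saturation of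
    [(h2, h')] carries this down to every degree. *)
Lemma delta_eq_leq3 : delta = (e2 * k')%N -> (m <= 3)%N.
Proof.
move=> dE; have [Bh Bs Bm] := hB; have [_ st'] := st.
pose P k := forall g, bourbaki_piece f r1 k g -> exists a b, g = a * h2 + b * h'.
have PS k : P k.+1 -> P k.
  move=> hP g bg; apply: regular_ideal_saturated => // i; apply: hP.
  by apply: gideal_mul1 => //; apply: homogX.
have Pbig j : (k0 <= j)%N -> P (j + e2 + k')%N.
  move=> kj g bg.
  have le : (k0 <= j + e2 + k')%N by rewrite -addnA (leq_trans kj) // leq_addr.
  have [hD _] := st' _ le.
  have hc := combinations_dim j h20 h'0 (Bh _ _ bh2) (Bh _ _ bh') reg.
  have [|||||a [b [ha hb eab]]] := @qdim_split _ _ (form (j + e2 + k')) (bourbaki_piece f r1 (j + e2 + k'))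
    (combinations h2 h' (j + k') (j + e2)) (e2 * k') _ _ _ _ _ hc.
  - exact: form_subspace.
  - exact: Bs.
  - exact: combinations_subspace.
  - exact: combinations_bourbaki.
  - by move=> x /Bh.
  have b0 : b = delta := qdim_uniq (Bs _) hb hD.
  have a0 : a = 0%N by move: eab; rewrite b0 -dE -{1}[delta]add0n => /eqP; rewrite eqn_add2r => /eqP.
  rewrite a0 in ha; have [u [v [_ _ ->]]] := qdim0_sub ha bg; by exists u, v.
have Pall k : P k.
  have : P (k + (k0 + e2 + k'))%N.
    have -> : (k + (k0 + e2 + k') = (k + k0) + e2 + k')%N by rewrite !addnA.
    by apply: Pbig; apply: leq_addl.
  by elim: (k0 + e2 + k')%N => [|n ih]; rewrite ?addn0 // addnS => /PS.
have [[_ [r hr er]] [_ [r' hr' er']]] := (bh2, bh').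
apply: (@generators_from_bourbaki 2 (fun i => if i == ord0 then r else r')
  (fun i => if i == ord0 then h2 else h')) => [i|i|]; try by case: ifP.
apply: bourbaki_from_pieces => k g /Pall [a [b ->]].
by exists (fun i => if i == ord0 then a else b); rewrite !big_ord_recl big_ord0 addr0.
Qed.

Hypotheses (Dh2 : Delta r1 (rho i1) = h2 * f) (k'E : (k' + e = d1 + deg i2)%N).

(** With three generators, [k'] is the degree of the image [h3] of the third one, so
    [h' = c1 h2 + c2 h3] with [c2] constant; regularity excludes [c2 = 0]. Hence the ideal is
    [(h2, h')]. *)
Lemma delta_eq_of_leq3 : (m <= 3)%N -> delta = (e2 * k')%N.
Proof.
move=> m3; have [Bh Bs Bm] := hB; have [_ st'] := st.
have [h3 bh3 eh3] := bourbaki_exists hf sf r1_AR (spans_AR_gen i2 rho_spans).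
have sum_m (c : 'I_m -> S) : Delta r1 (\sum_i c i *: rho i) = (c i1 * h2 + c i2 * h3) * f.
  have i01 : i1 != i0 by rewrite -val_eqE /= hi0 hi1.
  have i02 : i2 != i0 by rewrite -val_eqE /= hi0 hi2.
  have i12 : i2 != i1 by rewrite -val_eqE /= hi1 hi2.
  have -> : \sum_i c i *: rho i = c i0 *: r1 + c i1 *: rho i1 + c i2 *: rho i2.
    rewrite (bigD1 i0) //= (bigD1 i1) //= (bigD1 i2) /= ?i02 ?i12 // big1 ?addr0 ?addrA // => i.
    rewrite -!val_eqE /= hi0 hi1 hi2; have := ltn_ord i; have := m3.
    by case: (nat_of_ord i) => [|[|[|k]]] // m3' lt; have := leq_trans lt m3'.
  rewrite Delta_cross; under eq_bigr do rewrite 2!crossD 3!crossZ cross_self mulr0 add0r mulrDr.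
  rewrite big_split /= [RHS]mulrDl -!mulrA -Dh2 -eh3 !Delta_cross !mulr_sumr.
  by congr (_ + _); apply: eq_bigr => i _; rewrite mulrCA.
have [r [hr hrj er]] := bourbaki_piece_lift hf sf r1_AR r1_homog bh' (etrans k'E (addnC _ _)).
have [c ec hc] := homog_combination rho_spans rho_homog hr hrj.
have eh' : h' = c i1 * h2 + c i2 * h3.
  by apply: (mulIf f_neq0); rewrite -er ec sum_m.
have [b eb] : exists b, c i2 = b%:MP.
  by have [] := hc i2; rewrite subnn => /homog0_const e1 _; exists (c i2)@_0%MM.
have b0 : b != 0.
  apply/eqP => b0; have := reg (a := c i1) (b := 1).
  rewrite eh' eb b0 mpolyC0 mul0r addr0 mul1r => /(_ erefl) [x ex].
  have : h2 \is a GRing.unit by apply/unitrPr; exists x.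
  by apply/negP; case: e2 e20 bh2 => // n _ [hn _]; exact: homog_nonunit h20 hn.
have eh3' : h3 = (b^-1)%:MP * (h' - c i1 * h2).
  by rewrite eh' eb addrC addKr mulrA -mpolyCM mulVf // mpolyC1 mul1r.
have all_g g k : bourbaki_piece f r1 k g -> exists u v, g = u * h2 + v * h'.
  move=> [_ [s /rho_spans [x ->]]]; rewrite sum_m => /(mulIf f_neq0) <-.
  exists (x i1 - x i2 * (b^-1)%:MP * c i1), (x i2 * (b^-1)%:MP).
  by rewrite eh3'; ring.
have le : (k0 <= k0 + e2 + k')%N by rewrite -addnA leq_addr.
have [hD _] := st' _ le.
have hcd := combinations_dim k0 h20 h'0 (Bh _ _ bh2) (Bh _ _ bh') reg.
apply: (qdim_uniq (Bs _) hD); apply: qdim_ext hcd => x //.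
split; first exact: combinations_bourbaki.
move=> bx; have [u [v e1]] := all_g _ _ bx.
exact: (homog_two_combination (Bh _ _ bh2) (Bh _ _ bh') (Bh _ _ bx) e1).
Qed.

End Partner.

(** Otherwise the lifts of the components of [r1], which have degree [e], would involve only [r1]
    and [rho i1], and the nonconstant [h2] would divide all of [r1]. *)
Lemma third_degree_leq : (deg i2 <= e)%N.
Proof.
rewrite leqNgt; apply/negP => lt.
have [h2 [e2 [_ e20 [hh2 _] h20 Dh2]]] := second_generator.
have [|q hq qh2] := prime_divisor_exists (factorial_mpoly (n := 3)) h20.
  by case: e2 e20 hh2 => // n _ hn; exact: homog_nonunit h20 hn.
apply: (cop hq) => i; apply: divides_trans qh2 _.
have [r [hr hrj er]] := bourbaki_piece_lift hf sf r1_AR r1_homog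
  (bourbaki_koszul hf r1_AR r1_homog i) (addnC d1 e).
have [c ec hc] := homog_combination rho_spans rho_homog hr hrj.
have i01 : i1 != i0 by rewrite -val_eqE /= hi0 hi1.
have {}ec : r = c i0 *: r1 + c i1 *: rho i1.
  rewrite ec (bigD1 i0) //= (bigD1 i1) //= big1 ?addr0 // => j /andP [j0 j1].
  have [_ ->] := hc j; first by rewrite scale0r.
  apply: leq_trans lt (deg_mono _); rewrite hi2.
  by move: j0 j1; rewrite -!val_eqE /= hi0 hi1; case: (nat_of_ord j) => [|[|]].
exists (c i1); apply: (mulIf f_neq0); rewrite -er ec Delta_cross.
rewrite mulrAC -Dh2 Delta_cross mulr_suml; apply: eq_bigr => k _.
by rewrite crossD !crossZ cross_self mulr0 add0r mulrCA mulrC.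
Qed.

(** For [D = e] the piece has degree [d1] and contains the components of [r1], which have finitely
    many common zeros. If [D] bounds all degrees, the image [h j] of each generator vanishes at a
    base point, as one sees by multiplying with a power of a variable nonzero there; so again the
    components of [r1] vanish. *)
Lemma finite_base_locus D k : (k + e = d1 + D)%N -> (D = e \/ forall i, (deg i <= D)%N) ->
  exists pts : seq (P2 K),
    forall p, (forall h, bourbaki_piece f r1 k h -> h.@[coords p] = 0) -> p \in pts.
Proof.
move=> kD hDe; have hI := family_gideal (fun i => r1 0 i).
have ed : d1 = d1.-1.+1 by rewrite prednK // d1_gt0.
have [|l [k0 [n sI]]] := stable_of_coprime_family (k := d1.-1) hI _ cop.
  by move=> i; rewrite -ed; apply: (family_ideal_gen (u := fun i => r1 0 i)).
have [pts hpts] := finite_zeros hI sI; exists pts => p hp; apply: hpts => _ _ [_ [c ->]].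
rewrite raddf_sum big1 // => i _ /=; rewrite mevalM.
suff -> : (r1 0 i).@[coords p] = 0 by rewrite mulr0.
have bk := bourbaki_koszul hf r1_AR r1_homog i.
case: hDe => [De|hle].
  by apply: hp; have -> : k = d1 by apply/eqP; rewrite -(eqn_add2r e) kD De.
have [_ [r /rho_spans [b ->] er]] := bk.
have /choice [h hh] j : exists h, Delta r1 (rho j) = h * f.
  by have [h _ eh] := bourbaki_exists hf sf r1_AR (spans_AR_gen j rho_spans); exists h.
have -> : r1 0 i = \sum_j b j * h j.
  apply: (mulIf f_neq0); rewrite -er mulr_suml.
  have DlD x y : Delta r1 (x + y) = Delta r1 x + Delta r1 y.
    by rewrite !Delta_cross -big_split; apply: eq_bigr => k' _; rewrite crossD mulrDr.
  have Dl0 : Delta r1 0 = 0 by rewrite -(scale0r r1) Delta_scale.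
  rewrite (big_morph _ DlD Dl0); apply: eq_bigr => j _.
  rewrite -mulrA -hh !Delta_cross mulr_sumr; apply: eq_bigr => k' _.
  by rewrite crossZ mulrCA.
rewrite raddf_sum big1 // => j _ /=; rewrite mevalM.
suff -> : (h j).@[coords p] = 0 by rewrite mulr0.
have [t pt] := coords_neq0 p.
have hX : ('X_t : S) ^+ (D - deg j) \is (D - deg j).-homog by apply: homogX_exp; apply: homogX.
have eD : Delta r1 ('X_t ^+ (D - deg j) *: rho j) = ('X_t ^+ (D - deg j) * h j) * f.
  rewrite -mulrA -hh !Delta_cross mulr_sumr; apply: eq_bigr => k' _.
  by rewrite crossZ mulrCA.
have hs : homog_triple D ('X_t ^+ (D - deg j) *: rho j).
  by move=> u; rewrite mxE; have := dhomogM hX (rho_homog j u); rewrite subnK.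
have : ('X_t ^+ (D - deg j) * h j).@[coords p] = 0.
  apply: hp; split; last by exists ('X_t ^+ (D - deg j) *: rho j) => //; apply/AR_Z/spans_AR_gen.
  exact: (homog_Delta hf sf r1_homog hs (etrans kD (addnC _ _)) eD).
by rewrite mevalM rmorphXn /= mevalXU => /eqP; rewrite mulf_eq0 expf_eq0 (negbTE pt) andbF => /eqP.
Qed.

Lemma base_point : exists p : P2 K, forall k h, bourbaki_piece f r1 k h -> h.@[coords p] = 0.
Proof.
have [l [k0 [delta [st d0]]]] := bourbaki_stable.
by have [p hp] := zero_exists hB st d0; exists p.
Qed.

End Main.

(** * Line arrangements *)

Section Derivations.
Variable K : numClosedFieldType.
Local Notation S := {mpoly K[3]}.
Local Notation row := 'rV[S]_3.
Implicit Types (r s : row) (f g h l : S).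

(** The derivation of [S] attached to the triple [r]; syzygies of [f] are the triples whose
    derivation kills [f]. *)
Definition along r g : S := \sum_i r 0 i * g^`M(i).

Lemma alongM r g h : along r (g * h) = along r g * h + g * along r h.
Proof.
rewrite /along mulr_suml mulr_sumr -big_split; apply: eq_bigr => i _ /=.
by rewrite mderivM; ring.
Qed.

Lemma alongC r (c : K) : along r c%:MP = 0.
Proof. by rewrite /along big1 // => i _; rewrite mderivC mulr0. Qed.

Lemma along_prod r n (l m : 'I_n -> S) : (forall i, along r (l i) = l i * m i) ->
  along r (\prod_i l i) = (\prod_i l i) * \sum_i m i.
Proof.
move=> h; elim/big_ind2: _ => [|x x' y y' ex ey|i _]; last exact: h.
  by rewrite mulr0 -mpolyC1 alongC.
by rewrite alongM ex ey mulrDr mulrAC mulrA.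
Qed.

Definition position : row := \row_i 'X_i.
Definition gradient g : row := \row_i g^`M(i).
Definition crossv r s : row := \row_i cross r s i.

Lemma along_position g k : g \is k.-homog -> along position g = k%:R *: g.
Proof. by move=> /euler <-; rewrite /along; apply: eq_bigr => i _; rewrite mxE. Qed.

Lemma alongD r s g : along (r + s) g = along r g + along s g.
Proof. by rewrite /along -big_split; apply: eq_bigr => i _; rewrite mxE mulrDl. Qed.

Lemma alongZ a r g : along (a *: r) g = a * along r g.
Proof. by rewrite /along mulr_sumr; apply: eq_bigr => i _; rewrite mxE mulrA. Qed.

Lemma along_crossl g h : along (crossv (gradient g) (gradient h)) g = 0.
Proof. by rewrite /along sum3 !mxE /cross /= !mxE; ring. Qed.

Lemma along_crossr g h : along (crossv (gradient g) (gradient h)) h = 0.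
Proof. by rewrite /along sum3 !mxE /cross /= !mxE; ring. Qed.

Lemma Delta_position r : Delta r position = 0.
Proof. by rewrite Delta_cross sum3 /cross /= !mxE; ring. Qed.

Lemma Delta_crossv r g h : Delta r (crossv (gradient g) (gradient h)) =
  along position g * along r h - along position h * along r g.
Proof. by rewrite Delta_cross /along !sum3 /cross /= !mxE /cross /= !mxE; ring. Qed.

Lemma prime_of_degree1 g : g != 0 -> g \is 1.-homog -> prime_elt g.
Proof.
move=> g0 hg; have gu := homog_nonunit g0 hg.
have [q hq [u eu]] := prime_divisor_exists (factorial_mpoly (n := 3)) g0 gu.
have [q0 qu pq] := hq.
have [i [j [hi hj ij]]] : exists i j, [/\ q \is i.-homog, u \is j.-homog & 1%N = (i + j)%N].
  by apply: homog_factor; rewrite -eu.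
have u0 : u != 0 by apply: contra_neq g0 => u0; rewrite eu u0 mulr0.
case: i hi ij => [|i] hi; first by rewrite homog0_unit in qu.
case: j hj => [hj _|j _]; last by rewrite addSn addnS.
have uu := homog0_unit u0 hj.
have gq x : divides g x <-> divides q x.
  split=> -[z ->]; first by exists (u * z); rewrite eu mulrA.
  by exists (u^-1 * z); rewrite eu -mulrA mulVKr.
by split=> // a b /gq /pq [] /gq ?; [left | right].
Qed.

End Derivations.

Section Lines.
Variable K : numClosedFieldType.
Local Notation S := {mpoly K[3]}.
Local Notation row := 'rV[S]_3.
Variables (f : S) (e n d1 : nat) (c : K) (l : 'I_n -> S) (r1 : row).
Hypotheses (hf : f \is e.+1.-homog) (sf : squarefree f).
Hypotheses (fE : f = c *: \prod_i l i) (l_homog : forall i, l i \is 1.-homog).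
Hypotheses (r1_AR : AR f r1) (r1_homog : homog_triple d1.+1 r1).

Let f_neq0 : f != 0 := squarefree_neq0 sf.

Let l_neq0 i : l i != 0.
Proof. by apply: contra_neq f_neq0 => li; rewrite fE (bigD1 i) //= li mul0r scaler0. Qed.

(** From [r1(f) = 0], [l i] divides [r1(l i)] times the product of the other lines; by
    squarefreeness it does not divide that product. *)
Lemma line_derivative i : exists2 m, m \is d1.-homog & along r1 (l i) = l i * m.
Proof.
have hl := prime_of_degree1 (l_neq0 i) (l_homog i); have [_ lu pl] := hl.
pose g := c *: \prod_(j | j != i) l j.
have eg : f = l i * g by rewrite fE (bigD1 i) //= -scalerAr.
have lg : divides (l i) (along r1 (l i) * g).
  exists (- along r1 g); rewrite mulrN; apply/eqP; rewrite -addr_eq0; apply/eqP.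
  by rewrite -alongM -eg; exact: r1_AR.
have [[m em]|[h eh]] := pl _ _ lg; last first.
  case/negP: lu; apply: (sf (h := h)); rewrite eg eh; ring.
exists m => //; apply: (homog_divl (l_neq0 i) (l_homog i)).
rewrite mulrC -em addn1; apply: rpred_sum => k _; rewrite -[d1.+1]addn0.
by apply: dhomogM; [exact: r1_homog | exact: mderiv_homog].
Qed.

Lemma lines_nonempty : (0 < n)%N.
Proof.
rewrite lt0n; apply/eqP => n0.
have l1 : \prod_i l i = 1 by apply: big1 => -[k kn]; exfalso; move: kn; rewrite n0.
move: (hf) (f_neq0); rewrite fE l1 => h c0.
have : (c *: 1 : S) \is 0.-homog by apply: dhomogZ; apply: dhomog1.
by move/(dhomog_uniq c0)/(_ h).
Qed.

(* With [h = f / (l_i l_j)] and [p] the common point of the two lines, the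
   syzygy [h p - (D_p h / d) (x, y, z)] has Bourbaki image [m_j - m_i]. *)
Lemma bourbaki_lines i j mi mj : i != j ->
  along r1 (l i) = l i * mi -> along r1 (l j) = l j * mj -> bourbaki f r1 (mj - mi).
Proof.
move=> ij ei ej; pose h := c *: \prod_(k | (k != i) && (k != j)) l k.
have eh : f = l i * l j * h.
  by rewrite fE (bigD1 i) //= (bigD1 j) 1?eq_sym //= -scalerAr mulrA.
pose p := crossv (gradient (l i)) (gradient (l j)).
have d0 : e.+1%:R != 0 :> K by rewrite pnatr_eq0.
have pf : along p f = l i * l j * along p h.
  by rewrite eh !alongM along_crossl along_crossr; ring.
exists (h *: p + (- ((e.+1%:R^-1 : K) *: along p h)) *: position K).
  rewrite /AR /=; change (along (h *: p + (- ((e.+1%:R^-1 : K) *: along p h)) *: position K) f = 0).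
  rewrite alongD !alongZ pf (along_position hf) -!mul_mpolyC.
  transitivity (h * (l i * l j * along p h) - (e.+1%:R^-1)%:MP * (e.+1%:R)%:MP * (along p h * f)).
    by ring.
  by rewrite -mpolyCM mulVf // mpolyC1 eh; ring.
rewrite Delta_linear Delta_position mulr0 addr0 Delta_crossv.
by rewrite !(along_position (l_homog _)) !scale1r ei ej eh; ring.
Qed.

(** As [r1(f)] vanishes and equals [f] times the sum of the [m_i], each [m_i] is the mean of the
    differences [m_i - m_j], which lie in the ideal. If [q] divides all [m_i], it divides all
    [r1(l_i)], hence [r1] when the [l_i] span the linear forms; if they do not, a constant vector
    field kills every line and gives a syzygy of degree 0. *)
Lemma lines_no_common_divisor q : prime_elt q -> coprime_family (fun i => r1 0 i) ->
  (forall r, AR f r -> homog_triple 0 r -> r = 0) ->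
  exists2 h, bourbaki_piece f r1 d1 h & ~ divides q h.
Proof.
move=> hq cop noconst; apply: contrapT => hdiv.
have /choice [m hm] i : exists m, m \is d1.-homog /\ along r1 (l i) = l i * m.
  by have [m] := line_derivative i; exists m.
have m_sum : \sum_i m i = 0.
  have ml i : along r1 (l i) = l i * m i by case: (hm i).
  apply: (mulfI f_neq0); rewrite mulr0; transitivity (along r1 f); last exact: r1_AR.
  by rewrite fE -mul_mpolyC alongM alongC mul0r add0r (along_prod ml) mulrA.
have bm i : bourbaki f r1 (m i).
  have -> : m i = (n%:R^-1)%:MP * \sum_j (m i - m j).
    rewrite sumrB m_sum subr0 sumr_const card_ord -[X in _ * X]mulr_natl -mpolyC_nat mulrA.
    by rewrite -mpolyCM mulVf ?mpolyC1 ?mul1r // pnatr_eq0 -lt0n lines_nonempty.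
  apply: bourbakiM; elim/big_ind: _ => [|x y bx b_y|j _].
  - by exists 0; [exact: AR_0 | rewrite mul0r -(scale0r r1) Delta_scale].
  - exact: bourbakiD.
  have [->|ij] := eqVneq i j.
    by rewrite subrr; exists 0; [exact: AR_0 | rewrite mul0r -(scale0r r1) Delta_scale].
  have [[_ ei] [_ ej]] := (hm i, hm j).
  by apply: (bourbaki_lines _ ej ei); rewrite eq_sym.
have qm i : divides q (m i).
  by apply: contrapT => nq; apply: hdiv; exists (m i) => //; split=> //; case: (hm i).
(* The rows are the coefficients of the lines; full column rank means that the lines are not
   concurrent. *)
pose A : 'M[K]_(n, 3) := \matrix_(i, k) ((l i)^`M(k))@_0%MM.
have lA i k : (l i)^`M(k) = (A i k)%:MP.
  by rewrite mxE; apply: homog0_const; apply: mderiv_homog.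
have [full|nfull] := boolP (row_full A).
  have /row_fullP [B BA] := full.
  apply: (cop q hq) => k; have -> : r1 0 k = \sum_i (B k i)%:MP * along r1 (l i).
    rewrite /along; under eq_bigr do rewrite mulr_sumr.
    rewrite exchange_big (bigD1 k) //= [X in _ + X]big1 => [|k' kk'].
      rewrite addr0; under eq_bigr do rewrite lA mulrCA -mpolyCM.
      rewrite -mulr_sumr -raddf_sum /=; have /matrixP/(_ k k) := BA.
      by rewrite !mxE eqxx => ->; rewrite mpolyC1 mulr1.
    under eq_bigr do rewrite lA mulrCA -mpolyCM.
    rewrite -mulr_sumr -raddf_sum /=; have /matrixP/(_ k k') := BA.
    by rewrite !mxE eq_sym (negbTE kk') => ->; rewrite mpolyC0 mulr0.
  apply: divides_sum => i _; apply: divides_mull.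
  by have [_ ->] := hm i; apply: divides_mull.
have : cokermx A != 0 by rewrite cokermx_eq0.
case/matrix0Pn => u [v uv].
pose r : row := \row_k (cokermx A k v)%:MP.
have /rowP/(_ u) : r = 0.
  apply: noconst => [|k]; last by rewrite mxE; apply: homogC.
  change (along r f = 0); rewrite fE -mul_mpolyC alongM alongC mul0r add0r.
  have rl i : along r (l i) = l i * 0.
    rewrite mulr0 /along; under eq_bigr do rewrite lA mxE -mpolyCM mulrC.
    rewrite -raddf_sum /=; have /matrixP/(_ i v) := mulmx_coker A.
    by rewrite !mxE => ->; rewrite mpolyC0.
  by rewrite (along_prod rl) sumr_const mul0rn !mulr0.
by rewrite mxE [RHS]mxE => /eqP; rewrite mpolyC_eq0 (negbTE uv).
Qed.

End Lines.

(** * From codimensions to the stated inequalities *)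

Section Conclusion.
Variable K : numClosedFieldType.
Local Notation S := {mpoly K[3]}.
Local Notation row := 'rV[S]_3.

Lemma exponents_size (f : S) ds ds' : exponents f ds -> exponents f ds' -> size ds = size ds'.
Proof.
move=> [_ [r [rmin rh]]] [_ [s [smin sh]]]; apply/eqP; rewrite eqn_leq.
rewrite (minimal_generators_leq rmin rh (spans_of_minimal smin)).
by rewrite (minimal_generators_leq smin sh (spans_of_minimal rmin)).
Qed.

(** Translates the signed degree of the statement into the additive convention [k' + e = d1 + k]. *)
Lemma component_base_locus (f : S) r1 (d1 k k' e : nat) p : (k' + e = d1 + k)%N ->
  base_locus (component (d1%:Z + k%:Z - e.+1%:Z + 1) (bourbaki f r1)) p <->
  forall h, bourbaki_piece f r1 k' h -> h.@[coords p] = 0.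
Proof.
move=> kE; have -> : (d1%:Z + k%:Z - e.+1%:Z + 1)%R = k'%:Z by lia.
by split=> h g [g1 g2]; apply: h.
Qed.

Section Curve.
Variables (f : S) (e : nat) (ds : seq nat) (r1 : row).
Hypotheses (e_gt1 : (1 < e)%N) (hf : f \is e.+1.-homog) (sf : squarefree f).
Hypotheses (hds : exponents f ds) (m_gt2 : (2 < size ds)%N).
Hypotheses (r1_AR : AR f r1) (r1_neq0 : r1 != 0) (r1_homog : homog_triple (nth 0%N ds 0) r1).

(** All the geometry in one package: [delta] is the codimension of the Bourbaki ideal, and what
    remains for the theorem is arithmetic. The fourth clause holds for every admissible [d'], not
    only for the least one. *)
Lemma tjurina_defect : exists delta : nat,
  [/\ (total_tjurina f + delta + e * nth 0 ds 0 = e * e + nth 0 ds 0 * nth 0 ds 0)%N,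
      (nth 0 ds 2 <= e)%N,
      exists d', admissible f e.+1 ds r1 d',
      forall d', admissible f e.+1 ds r1 d' -> exists e2 k',
        [/\ (e2 + e = nth 0 ds 0 + nth 0 ds 1)%N, (0 < e2)%N, (k' + e = nth 0 ds 0 + d')%N,
            (delta <= e2 * k')%N & delta = (e2 * k')%N <-> size ds = 3%N] &
      line_arrangement f -> (0 < nth 0 ds 0)%N /\
        (delta <= (nth 0 ds 0).-1 * (nth 0 ds 0).-1)%N].
Proof.
have [ds_sorted [rho0 [rho0_min rho0_homog]]] := hds.
pose m := size ds; pose deg (i : 'I_m) := nth 0%N ds i.
have deg_mono (i j : 'I_m) : (i <= j)%N -> (deg i <= deg j)%N.
  by apply: (sorted_leq_nth leq_trans leqnn) => //; rewrite inE.
pose i0 : 'I_m := Ordinal (ltnW (ltnW m_gt2)); pose i1 : 'I_m := Ordinal (ltnW m_gt2).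
pose i2 : 'I_m := Ordinal m_gt2.
(* The given [r1] becomes the first member of a minimal system of generators. *)
have [rho [rho_min rho_homog er1]] : exists rho : 'I_m -> row, [/\ minimal_generators f rho,
    forall i, homog_triple (deg i) (rho i) & rho i0 = r1].
  by apply: (exchange_generator rho0_min rho0_homog (i0 := i0)) => // i; apply: deg_mono.
have e_gt0 := ltnW e_gt1.
have hi0 : i0 = 0%N :> nat by [].
have hi1 : i1 = 1%N :> nat by [].
have hi2 : i2 = 2%N :> nat by [].
have [l [k0 [delta [st delta_gt0]]]] := bourbaki_stable hf sf rho_min rho_homog m_gt2 hi0 deg_mono.
have cop := r1_coprime rho_min rho_homog hi0 deg_mono.
have d1_pos := d1_gt0 hf sf rho_min rho_homog m_gt2 hi0 deg_mono.
have [h2 [e2 [e2E e2_gt0 bh2 h20 Dh2]]] := second_generator hf sf rho_min rho_homog m_gt2 hi0 hi1 deg_mono.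
have d3e := third_degree_leq hf sf rho_min rho_homog m_gt2 hi0 hi1 hi2 deg_mono.
have deg_last i : (deg i <= last 0%N ds)%N.
  rewrite -nth_last; apply: (sorted_leq_nth leq_trans leqnn) => //; rewrite ?inE //.
    by rewrite prednK // (ltn_trans _ m_gt2).
  by rewrite -ltnS prednK ?ltn_ord // (ltn_trans _ m_gt2).
exists delta; split=> //.
- have [l' [k0' [tau stJ]]] : exists l k0 tau, stable (jacobian_ideal f) l k0 tau.
    have hJ := family_gideal (fun i => f^`M(i)).
    apply: (stable_of_coprime_family (k := e.-1) (I := jacobian_ideal f) hJ _ (squarefree_coprime hf sf)) => i.
    by rewrite prednK //; apply: (family_ideal_gen (u := fun i => f^`M(i))); apply: mderiv_homog.
  rewrite (total_tjurina_stable hf stJ).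
  exact: (bourbaki_degree hf sf (spans_AR_gen i0 (spans_of_minimal rho_min)) (rho_homog i0) cop stJ st).
(* The upper end [min (d_m, d - 1)] is admissible: either it is [d - 1], or it bounds all
   exponents. *)
- pose D := minn (last 0%N ds) e; exists D; split.
  + by rewrite leq_min d3e andbT; exact: (deg_last i2).
  + by rewrite subn1.
  + have e2D : (deg i1 <= D)%N by rewrite leq_min deg_last (leq_trans _ d3e) // deg_mono.
    have [k kE] : exists k, (k + e = deg i0 + D)%N.
      by exists (deg i0 + D - e)%N; rewrite subnK // (leq_trans _ (leq_add (leqnn _) e2D)) // -e2E leq_addl.
    rewrite -er1; split.
      have [|pts hpts] := finite_base_locus hf sf rho_min rho_homog m_gt2 hi0 deg_mono kE.
        by rewrite /D; case: leqP => _; [right => i; exact: deg_last | left].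
      apply: (sub_finite_set _ (finite_seq pts)) => p /(component_base_locus _ _ _ kE) hp.
      exact: hpts.
    have [p hp] := base_point hf sf rho_min rho_homog m_gt2 hi0 deg_mono.
    by exists p; apply/(component_base_locus _ _ _ kE) => h; apply: hp.
- move=> d' [d3d' d'le [fin _]]; rewrite -er1 in fin.
  have d2d' : (deg i1 <= d')%N by apply: leq_trans d3d'; apply: (deg_mono i1 i2).
  have [k kE] : exists k, (k + e = deg i0 + d')%N.
    by exists (deg i0 + d' - e)%N; rewrite subnK // (leq_trans _ (leq_add (leqnn _) d2d')) // -e2E leq_addl.
  have /finite_seqP [pts hpts] := fin.
  have [|h' [bh' h'0 reg]] := @regular_partner _ f _ rho i0 h2 e2 k pts h20 (proj1 bh2) e2_gt0.
    move=> p hp; have : [set` pts]%classic p by rewrite -hpts; apply/(component_base_locus _ _ _ kE).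
    by [].
  exists e2, k; split=> //; first exact: (delta_leq bh2 h20 bh' h'0 reg st).
  split=> [dE|m3].
    apply/eqP; rewrite eqn_leq m_gt2 andbT.
    exact: (delta_eq_leq3 hf sf rho_min rho_homog hi0 deg_mono bh2 h20 bh' h'0 reg st dE).
  (* With three exponents, [d3 <= d' <= d_m] leaves only [d' = d3]. *)
  have d'3 : d' = deg i2.
    apply/eqP; rewrite eqn_leq d3d' andbT; apply: leq_trans d'le _; apply: (leq_trans (geq_minl _ _)).
    by rewrite -nth_last m3.
  apply: (delta_eq_of_leq3 hf sf rho_min rho_homog hi0 hi1 hi2 bh2 h20 e2_gt0 bh' h'0 reg st Dh2).
    by rewrite kE d'3.
  by rewrite /m m3.
- move=> [n [lin [c [c0 hlin _ fE]]]]; split=> //.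
  have d1E : deg i0 = (deg i0).-1.+1 by rewrite prednK.
  have r1h : homog_triple (deg i0).-1.+1 (rho i0) by rewrite -d1E; exact: rho_homog.
  have nodiv q : prime_elt q -> exists2 h, bourbaki_piece f (rho i0) (deg i0).-1 h & ~ divides q h.
    move=> hq; apply: (lines_no_common_divisor hf sf fE _ _ r1h hq cop).
    - by move=> i; case: (hlin i).
    - exact: (spans_AR_gen i0 (spans_of_minimal rho_min)).
    move=> r hr r0; apply/eqP; apply/negPn/negP => rn0.
    have := min_degree rho_min rho_homog hi0 deg_mono hr rn0 r0.
    by rewrite leqNgt d1_pos.
  have [g bg g0] : exists2 g, bourbaki_piece f (rho i0) (deg i0).-1 g & g != 0.
    have [h bh nh] := nodiv _ (prime_of_degree1 (mpolyXU_neq0 K ord0) (homogX K ord0)).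
    by exists h => //; apply/eqP => h0; apply: nh; rewrite h0; exact: divides0.
  (* The ideal contains no nonzero constant, so its nonzero form [g] of degree [d1 - 1] has positive
     degree. *)
  have d1'_gt0 : (0 < (deg i0).-1)%N.
    rewrite lt0n; apply: contra_neqN g0 => /eqP d1'0; have [hg Bg] := bg.
    apply: (bourbaki_homog0 hf sf rho_min rho_homog m_gt2 hi0 deg_mono Bg).
    by move: hg; rewrite d1'0.
  have g_nonunit : g \isn't a GRing.unit.
    by apply: (homog_nonunit (k := (deg i0).-1.-1) g0); rewrite prednK //; case: bg.
  have [_ Bs _] := bourbaki_piece_gideal f (rho i0).
  have [q hq _|h bh reg] := regular_pair_exists g0 (Bs (deg i0).-1); first exact: nodiv.
  exact: (delta_leq bg g0 bh (regular_neq0 g0 g_nonunit reg) reg st).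
Qed.

End Curve.
End Conclusion.

Theorem theorem3p5 (R : realType) (f : {mpoly R[i][3]}) (d : nat)
    (ds : seq nat) (r1 : 'rV[{mpoly R[i][3]}]_3)
    (d_ge3 : (3 <= d)%N)
    (f_homog : f \is d.-homog)
    (f_reduced : squarefree f)
    (ds_exponents : exponents f ds)
    (m_ge3 : (3 <= size ds)%N)
    (r1_syzygy : AR f r1)
    (r1_neq0 : r1 != 0)
    (r1_degree : homog_triple (nth 0%N ds 0) r1) :
  let D := d%:Z in
  let d1 := (nth 0%N ds 0)%:Z in
  let d2 := (nth 0%N ds 1)%:Z in
  let d3 := (nth 0%N ds 2)%:Z in
  let tau := (total_tjurina f)%:Z in
  (exists d', is_least (admissible f d ds r1) d') /\
  (forall d' : nat, is_least (admissible f d ds r1) d' ->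
     let bound := (D - 1) * (D - d1 - 1) + d1 ^+ 2
                  - (d1 - (D - 1 - d2)) * (d1 - (D - 1 - d'%:Z)) in
     [/\ bound <= tau,
         tau = bound <-> syzygy_curve 3 f &
         tau = bound -> d'%:Z = d3]) /\
  (tau = (D - 1) * (D - d1 - 1) <->
     [/\ syzygy_curve 3 f, d2 = D - 1 & d3 = D - 1]) /\
  (line_arrangement f ->
     (D - 1) * (D - d1 - 1) + 2 * d1 - 1 <= tau /\
     (D - 1) * (D - d1 - 1) < tau).
Proof.
case: d d_ge3 f_homog => [//|e] e_gt1 f_homog D d1 d2 d3 tau.
have [delta [tauE d3e [d0 adm0] hadm hlines]] :=
  tjurina_defect e_gt1 f_homog f_reduced ds_exponents m_ge3 r1_syzygy r1_neq0 r1_degree.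
have syz3 : syzygy_curve 3 f <-> size ds = 3%N.
  split=> [[ds' hds' <-]|m3]; last by exists ds.
  exact: (exponents_size (K := R[i]) ds_exponents hds').
(* The bound of the theorem is this formula with [delta] replaced by [e2 k']. *)
have tauZ : tau = (D - 1) * (D - d1 - 1) + d1 * d1 - delta%:Z.
  have tE : tau + delta%:Z + e%:Z * d1 = e%:Z * e%:Z + d1 * d1 by rewrite -!PoszM -!PoszD tauE.
  have -> : tau = e%:Z * e%:Z + d1 * d1 - delta%:Z - e%:Z * d1 by rewrite -tE; ring.
  have -> : D = e%:Z + 1 by rewrite /D; lia.
  by ring.
have d23 : (nth 0%N ds 1 <= nth 0%N ds 2)%N.
  have [ds_sorted _] := ds_exponents.
  by apply: (sorted_leq_nth leq_trans leqnn) => //; rewrite inE // ltnW.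
have adm_bounds d' : admissible f e.+1 ds r1 d' ->
    [/\ (nth 0 ds 2 <= d')%N, (d' <= e)%N & size ds = 3%N -> d' = nth 0%N ds 2].
  move=> [lb ub _]; move: ub; rewrite subn1 leq_min => /andP [le_last le_e]; split=> // m3.
  by apply/eqP; rewrite eqn_leq lb andbT; rewrite -nth_last m3 in le_last.
split; [|split; [|split]].
- have ex : exists k, `[< admissible f e.+1 ds r1 k >] by exists d0; apply/asboolP.
  exists (ex_minn ex); case: ex_minnP => k /asboolP hk kmin; split=> // j hj.
  by apply: kmin; apply/asboolP.
- move=> d' [hd' _] bound; have [e2 [k' [e2E e2_gt0 k'E dle dE]]] := hadm _ hd'.
  have [lb ub last3] := adm_bounds _ hd'.
  have boundE : tau - bound = (e2 * k')%:Z - delta%:Z.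
    have -> : (e2 * k')%:Z = (d1 - (D - 1 - d2)) * (d1 - (D - 1 - d'%:Z)).
      by rewrite PoszM; congr (_ * _); rewrite /D /d1 /d2; lia.
    by rewrite tauZ /bound expr2; ring.
  split.
  + lia.
  + split=> [h|/syz3 /dE h]; last lia.
    apply/syz3/dE; lia.
  + by move=> h; congr Posz; apply/last3/dE; lia.
- have [e2 [k' [e2E e2_gt0 k'E dle dE]]] := hadm _ adm0.
  have [lb ub last3] := adm_bounds _ adm0.
  split=> [h|[/syz3 m3 h2 h3]].
    (* Equality means [delta = d1^2], while [delta <= e2 k'] with both factors at most [d1], because
       [d2] and [d'] are at most [d - 1]. So both factors equal [d1], that is, [d2 = d' = d - 1]. *)
    have delE : delta = (nth 0 ds 0 * nth 0 ds 0)%N by rewrite tauZ /d1 in h; lia.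
    have e2_le : (e2 <= nth 0 ds 0)%N by lia.
    have k'_le : (k' <= nth 0 ds 0)%N by lia.
    have e2d : e2 = nth 0%N ds 0 by clear -delE dle e2_le k'_le e2_gt0; nia.
    have k'd : k' = nth 0%N ds 0 by clear -delE dle e2_le k'_le e2_gt0; nia.
    have m3 : size ds = 3%N by apply/dE; rewrite e2d k'd.
    have := last3 m3.
    by split; [exact/syz3 | rewrite /d2 /D; lia | rewrite /d3 /D; lia].
  have /dE delE := m3.
  have e2d : e2 = nth 0%N ds 0 by rewrite /d2 /D in h2; lia.
  have k'd : k' = nth 0%N ds 0 by rewrite /d3 /D in h3; lia.
  by rewrite tauZ delE e2d k'd PoszM -/d1; ring.
move=> /hlines [d1_gt0 dle].
(* The surplus over the du Plessis-Wall bound is at least [d1^2 - (d1 - 1)^2 = 2 d1 - 1], which is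
   positive as [d1 >= 1]. *)
have : delta%:Z <= (d1 - 1) * (d1 - 1) by rewrite /d1; move: d1_gt0 dle; case: (nth _ _ _) => // a _ /=; lia.
have : 1 <= d1 by [].
by rewrite tauZ; split; lia.
Qed.
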